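(* Let $n\ge 2$, $T>0$, and let $\Omega\subseteq\mathbb{R}^n$ be an open bounded and convex domain with smooth boundary $\partial\Omega$. Let $c_0>0$ and let $\Psi=\Psi(v,u,\omega)\in C^1(\mathbb{R}^n\times\mathbb{R}^n\times\mathbb{S}^{n-1})$ be a nonnegative function satisfying, for every $v\in\mathbb{R}^n$, $\Psi(v,u,\omega)\ge c_0$ for all $(u,\omega)\in B_3(v)\times\mathbb{S}^{n-1}$. For $\ell=1,2$ let $\Phi_\ell\in C^1((0,T)\times\Omega\times(0,\infty))$, $\Phi_\ell=\Phi_\ell(t,x,r)$, and suppose that for each fixed $r>0$ $$\|\Phi_\ell(\cdot,\cdot,r)\|_{C((0,T)\times\Omega)}\le M_1\quad\text{and}\quad \operatorname{supp}(\Phi_1-\Phi_2)(\cdot,\cdot,r)\subset(0,T)\times\Omega$$ for a fixed constant $M_1>0$. Put $K_\ell(t,x,v,u,\omega)=\Phi_\ell(t,x,|v|)\Psi(v,u,\omega)$ and assume $K_\ell,\ \nabla_xK_\ell,\ \nabla_vK_\ell\in\mathcal{M}$ for $\ell=1,2$. Let $\mathcal{A}_{K_\ell}$ be the measurement operator associated with the Boltzmann initial boundary value problem with collision kernel $K_\ell$. Suppose that for some $\kappa>0$ (such that $\mathcal{A}_{K_1},\mathcal{A}_{K_2}$ are defined on $\mathcal{X}_\kappa$) $$\mathcal{A}_{K_1}(g,h)=\mathcal{A}_{K_2}(g,h)\quad\text{for all }(g,h)\in\mathcal{X}_\kappa.$$ Then $\Phi_1=\Phi_2$ in $(0,T)\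times\Omega\times(0,\infty)$.
   Context: Notation. $B_\alpha(x)$ is the open ball of radius $\alpha$ centered at $x$. $U=\Omega\times\mathbb{R}^n$, $U_T=(0,T)\times U$, $\Gamma_\pm=\{(x,v)\in\partial\Omega\times\mathbb{R}^n:\pm v\cdot n(x)>0\}$ with $n(x)$ the unit outer normal to $\partial\Omega$ at $x$, and $\Gamma_\pm^T=(0,T)\times\Gamma_\pm$. The support of $(\Phi_1-\Phi_2)(\cdot,\cdot,r)$ is compact in $(0,T)\times\Omega$. Admissible set. Fix a constant $M>0$. $\mathcal{M}$ is the set of $K\in L^\infty(U_T;L^1(\mathbb{R}^n\times\mathbb{S}^{n-1}))$ with $\left\|\int_{\mathbb{R}^n}\int_{\mathbb{S}^{n-1}}|K(t,x,v,u,\omega)|\,d\omega\,du\right\|_{L^\infty(U_T)}<M$ (for vector-valued functions, $|\cdot|$ is the Euclidean norm). Boltzmann problem. For $K\in\mathcal{M}$, consider $$\partial_tF+v\cdot\nabla_xF=Q(F,F)\ \text{in }U_T,\qquad F=g\ \text{on }\Gamma_-^T,\qquad F=h\ \text{on }\{0\}\times U,$$ with $$Q(F_1,F_2)(t,x,v)=\int_{\mathbb{R}^n}\int_{\mathbb{S}^{n-1}}K(t,x,v,u,\omega)\,[F_1(t,x,u')F_2(t,x,v')-F_1(t,x,u)F_2(t,x,v)]\,d\omega\,du,$$ $u'=u-[(u-v)\cdot\omega]\omega$, $v'=v+[(u-v)\cdot\omega]\omega$. Solution concept. With $\tau_-(x,v)=\sup\{s\ge0:x-sv\in\Omega\}$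 and $H$ the Heaviside function, for $f\in L^\infty(U_T)$, $g\in L^\infty(\Gamma_-^T)$, $h\in L^\infty(U)$ the $L^\infty(U_T)$ solution of $\partial_tF+v\cdot\nabla_xF=f$ with $F=g$ on $\Gamma_-^T$, $F=h$ at $t=0$ is $$F(t,x,v)=g(t-\tau_-(x,v),x-\tau_-(x,v)v,v)H(t-\tau_-(x,v))+h(x-tv,v)H(\tau_-(x,v)-t)+\int_0^tf(t-s,x-sv,v)H(\tau_-(x,v)-s)\,ds;$$ a solution of the Boltzmann problem is $F\in L^\infty(U_T)$ satisfying this with $f=Q(F,F)$. The same formula gives its traces on $\Gamma_+^T$ and at $t=T$. Measurement operator. $\mathcal{X}_\kappa=\{(g,h)\in L^\infty(\Gamma_-^T)\times L^\infty(U):\|g\|_{L^\infty(\Gamma_-^T)}+\|h\|_{L^\infty(U)}\le\kappa\}$. For $\kappa>0$ sufficiently small, the Boltzmann problem with $(g,h)\in\mathcal{X}_\kappa$ has a unique solution $F\in L^\infty(U_T)$ with $\|F\|_{L^\infty(U_T)}\le C(\|g\|_{L^\infty(\Gamma_-^T)}+\|h\|_{L^\infty(U)})$, $C$ depending on $\kappa,M,T$; throughout $\kappa$ is such a constant. Then $\mathcal{A}_K:\mathcal{X}_\kappa\to L^\infty(\Gamma_+^T)\times L^\infty(U)$, $(g,h)\mapsto(F|_{\Gamma_+^T},F(T,\cdot,\cdot))$. *)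

(* Defs.v *)
From HB Require Import structures.
From mathcomp Require Import all_boot all_order all_algebra.
From mathcomp Require Import all_classical all_reals all_analysis measurable_realfun.
Set Implicit Arguments. Unset Strict Implicit. Unset Printing Implicit Defensive.
Import Order.TTheory GRing.Theory Num.Theory.
Import numFieldNormedType.Exports.
Local Open Scope classical_set_scope.
Local Open Scope ring_scope.

(* 'rV[R]_n is the model of R^n.  It gets the sigma-algebra generated by its
   coordinates, i.e. the Borel sigma-algebra.  The library norm on 'rV[R]_n is the
   sup norm; the Euclidean norm is [enorm] below. *)
Definition measure_row_display : measure_display. Proof. exact. Qed.

Section measurable_row.
Context {R : realType} (n : nat).

Definition row_coord (i : 'I_n) (x : 'rV[R]_n) : R := x ord0 i.

Let row_set0 : g_sigma_preimage row_coord set0.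
Proof. exact: sigma_algebra0. Qed.
Let row_setC A : g_sigma_preimage row_coord A ->
  g_sigma_preimage row_coord (~` A).
Proof. exact: sigma_algebraC. Qed.
Let row_bigcup (F : _^nat) : (forall i, g_sigma_preimage row_coord (F i)) ->
  g_sigma_preimage row_coord (\bigcup_i (F i)).
Proof. exact: sigma_algebra_bigcup. Qed.

HB.instance Definition _ := @isMeasurable.Build measure_row_display
  'rV[R]_n (g_sigma_preimage row_coord) row_set0 row_setC row_bigcup.

Lemma measurable_row_coord i : measurable_fun [set: 'rV[R]_n] (row_coord i).
Proof.
move=> _ Y mY; rewrite setTI; apply: sub_sigma_algebra => /=.
rewrite -bigcup_seq/=; exists i => /=; first by rewrite mem_index_enum.
by exists Y => //; rewrite setTI.
Qed.

Lemma measurable_fun_rowP d (T : measurableType d) (f : T -> 'rV[R]_n) :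
  (forall i, measurable_fun [set: T] (row_coord i \o f)) ->
  measurable_fun [set: T] f.
Proof.
move=> mf.
have : g_sigma_preimage (fun i => row_coord i \o f) `<=` measurable.
  apply: smallest_sub; first exact: sigma_algebra_measurable.
  rewrite -bigcup_seq => A [i /= _ [B mB <-]].
  exact: mf.
rewrite g_sigma_preimage_comp => h _ A mA; apply: h; by exists A.
Qed.

End measurable_row.

(* [m1 \x m2] under another name: the library does not infer a sigma-finite
   structure on the product of two sigma-finite measures. *)
Section product_sigma_finite.
Local Open Scope ereal_scope.
Context d1 d2 (T1 : measurableType d1) (T2 : measurableType d2) (R : realType).
Variable m1 : {sigma_finite_measure set T1 -> \bar R}.
Variable m2 : {sigma_finite_measure set T2 -> \bar R}.

Definition prod_measure : set (T1 * T2) -> \bar R := m1 \x m2.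

HB.instance Definition _ := Measure.copy prod_measure (m1 \x m2).

Let prod_measure_sigma_finite : sigma_finite setT prod_measure.
Proof.
have /sigma_finiteP[F [TF ndF Foo]] := sigma_finiteT m1.
have /sigma_finiteP[G [TG ndG Goo]] := sigma_finiteT m2.
exists (fun n => F n `*` G n).
  rewrite -setXTT TF TG predeqE => -[x y]; split.
    move=> [/= [n _ Fnx] [k _ Gky]]; exists (maxn n k) => //; split.
    - by move: x Fnx; exact/subsetPset/ndF/leq_maxl.
    - by move: y Gky; exact/subsetPset/ndG/leq_maxr.
  by move=> [n _ []/= ? ?]; split; exists n.
move=> k; have [? ?] := Foo k; have [? ?] := Goo k.
split; first exact: measurableX.
by rewrite /prod_measure product_measure1E// lte_mul_pinfty// ge0_fin_numE.
Qed.

HB.instance Definition _ := Measure_isSigmaFinite.Build _ _ _ prod_measure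
  prod_measure_sigma_finite.

End product_sigma_finite.

Section lebesgue_row.
Context {R : realType}.

Definition row_cons m (p : R * 'rV[R]_m) : 'rV[R]_m.+1 :=
  \row_i oapp (p.2 ord0) p.1 (unlift ord0 i).

Lemma measurable_row_cons m : measurable_fun setT (@row_cons m).
Proof.
apply: measurable_fun_rowP => i; case: (unliftP ord0 i) => [j|] ->.
  rewrite (_ : _ \o _ = row_coord j \o snd); last first.
    by apply/funext => p /=; rewrite /row_coord mxE liftK.
  exact: measurableT_comp (measurable_row_coord j) measurable_snd.
rewrite (_ : _ \o _ = fst)//; apply/funext => p /=.
by rewrite /row_coord mxE unlift_none.
Qed.

Section next.
Context m (mu : {sigma_finite_measure set 'rV[R]_m -> \bar R}).

Definition lebesgue_row_next : set 'rV[R]_m.+1 -> \bar R :=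
  pushforward (prod_measure lebesgue_measure mu) (@row_cons m).


Let mpre A : measurable A -> measurable (@row_cons m @^-1` A).
Proof.
by move=> mA; rewrite -[X in measurable X]setTI; exact: measurable_row_cons.
Qed.

Let next0 : lebesgue_row_next set0 = 0%E.
Proof. by rewrite /lebesgue_row_next /pushforward preimage_set0 measure0. Qed.

Let next_ge0 A : (0 <= lebesgue_row_next A)%E.
Proof. by rewrite /lebesgue_row_next /pushforward; exact: measure_ge0. Qed.

Let next_sigma_additive : semi_sigma_additive lebesgue_row_next.
Proof.
move=> F mF tF mUF; rewrite /lebesgue_row_next /pushforward preimage_bigcup.
apply: measure_semi_sigma_additive.
- by move=> n; exact: mpre.
- apply/trivIsetP => /= i j _ _ ij; rewrite -preimage_setI.
  by move/trivIsetP : tF => /(_ _ _ _ _ ij) ->//; rewrite preimage_set0.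
- by rewrite -preimage_bigcup; exact: mpre.
Qed.

HB.instance Definition _ := isMeasure.Build _ _ _ lebesgue_row_next
  next0 next_ge0 next_sigma_additive.

Let next_sigma_finite : sigma_finite setT lebesgue_row_next.
Proof.
pose nu := prod_measure (@lebesgue_measure R) mu.
have [F FT Foo] := sigma_finiteT nu.
pose uncons (x : 'rV[R]_m.+1) : R * 'rV[R]_m :=
  (row_coord ord0 x, \row_j x ord0 (lift ord0 j)).
have consK : cancel (@row_cons m) uncons.
  move=> [x y]; rewrite /uncons /row_coord mxE unlift_none /=; congr pair.
  by apply/rowP => j; rewrite !mxE liftK.
have muncons : measurable_fun setT uncons.
  apply/measurable_fun_pairP; split => /=; first exact: measurable_row_coord.
  apply: measurable_fun_rowP => i.
  rewrite (_ : _ \o _ = row_coord (lift ord0 i)); first exact: measurable_row_coord.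
  by apply/funext => x /=; rewrite /row_coord mxE.
exists (fun k => uncons @^-1` F k) => [|k].
  by rewrite -preimage_bigcup -FT preimage_setT.
have [mF Foo'] := Foo k; split.
  by rewrite -[X in measurable X]setTI; exact: muncons.
rewrite /lebesgue_row_next /pushforward -comp_preimage.
by rewrite (_ : uncons \o _ = id)//; exact/funext.
Qed.

HB.instance Definition _ := Measure_isSigmaFinite.Build _ _ _ lebesgue_row_next
  next_sigma_finite.

End next.

Fixpoint lebesgue_row n : {sigma_finite_measure set 'rV[R]_n -> \bar R} :=
  if n is m.+1 then lebesgue_row_next (lebesgue_row m) else \d_(0 : 'rV[R]_0).

End lebesgue_row.

Arguments lebesgue_row {R} n.

Section euclid.
Context {R : realType} {n : nat}.
Definition dot (x y : 'rV[R]_n) : R := \sum_i x ord0 i * y ord0 i.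
Definition enorm (x : 'rV[R]_n) : R := Num.sqrt (dot x x).
Definition eball (x : 'rV[R]_n) (r : R) : set 'rV[R]_n :=
  [set y | enorm (y - x) < r].
Definition sphere : set 'rV[R]_n := [set w | enorm w = 1].

Lemma dot_ge0 (x : 'rV[R]_n) : 0 <= dot x x.
Proof. by apply: sumr_ge0 => i _; exact: sqr_ge0. Qed.

Lemma measurable_enorm : measurable_fun setT (enorm : _ -> R).
Proof.
rewrite (_ : enorm = (@powR R ^~ 2^-1) \o (fun x => dot x x)); last first.
  by apply/funext => x /=; rewrite powR12_sqrt// dot_ge0.
apply: measurableT_comp => //.
apply: (@measurable_sum _ _ R setT _ _
  (fun i (x : 'rV[R]_n) => row_coord i x * row_coord i x)) => i.
by apply: measurable_funM; exact: measurable_row_coord.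
Qed.

Definition normalize (x : 'rV[R]_n) : 'rV[R]_n := (enorm x)^-1 *: x.

Lemma measurable_normalize : measurable_fun setT normalize.
Proof.
apply: measurable_fun_rowP => i.
rewrite (_ : _ \o _ = (fun x => (@powR R ^~ (-1)) (enorm x) * row_coord i x)); last first.
  by apply/funext => x; rewrite /row_coord /= mxE powR_inv1 // sqrtr_ge0.
apply: measurable_funM; last exact: measurable_row_coord.
by apply: (measurableT_comp (f := @powR R ^~ (-1))) measurable_enorm.
Qed.

(* Surface measure of the unit sphere, from polar coordinates:
   sigma(A) = n |{r w : 0 < r < 1, w in A}|.  It is a Borel measure on R^n which is
   concentrated on [sphere]. *)
Definition cone (A : set 'rV[R]_n) : set 'rV[R]_n :=
  [set x | 0 < enorm x < 1 /\ A (normalize x)].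

Definition cone_measure (A : set 'rV[R]_n) : \bar R := lebesgue_row n (cone A).

Lemma measurable_cone A : measurable A -> measurable (cone A).
Proof.
move=> mA; rewrite (_ : cone A = (setT `&` enorm @^-1` `]0, 1[) `&` (setT `&` normalize @^-1` A)).
  apply: measurableI; last exact: measurable_normalize.
  by apply: measurable_enorm => //; exact: measurable_itv.
by rewrite !setTI; apply/seteqP; split => x /=; rewrite /cone/= in_itv.
Qed.

Let cone_measure0 : cone_measure set0 = 0%E.
Proof.
rewrite /cone_measure (_ : cone _ = set0) ?measure0//.
by apply/seteqP; split => x // [].
Qed.

Let cone_measure_ge0 A : (0 <= cone_measure A)%E.
Proof. exact: measure_ge0. Qed.

Let cone_measure_sigma_additive : semi_sigma_additive cone_measure.
Proof.
move=> F mF tF mUF; rewrite /cone_measure.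
have -> : cone (\bigcup_n F n) = \bigcup_n cone (F n).
  apply/seteqP; split => x [].
    by move=> x1 [k _ Fk]; exists k.
  by move=> k _ [x1 Fk]; split => //; exists k.
apply: measure_semi_sigma_additive.
- by move=> k; exact: measurable_cone.
- apply/trivIsetP => /= i j _ _ ij; rewrite -subset0 => x [[_ Fi] [_ Fj]].
  by move/trivIsetP : tF => /(_ _ _ I I ij); rewrite -subset0 => /(_ (normalize x)); apply.
- by apply: bigcupT_measurable => k; exact: measurable_cone.
Qed.

HB.instance Definition _ := isMeasure.Build _ _ _ cone_measure
  cone_measure0 cone_measure_ge0 cone_measure_sigma_additive.

End euclid.

Section sphere_measure.
Context {R : realType}.

Let cube n : set 'rV[R]_n := [set x | forall i, x ord0 i \in `[-1, 1]].

Let mcube n : measurable (@cube n).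
Proof.
rewrite (_ : @cube n = \bigcap_(i in [set: 'I_n]) (setT `&` row_coord i @^-1` `[-1, 1])).
  apply: fin_bigcap_measurable => // i _.
  by apply: measurable_row_coord => //; exact: measurable_itv.
apply/seteqP; split => x /=; first by move=> Cx i _; split => //; exact: Cx.
by move=> Cx i; have [] := Cx i I.
Qed.

Let lebesgue_cube_lty n : (lebesgue_row n (@cube n) < +oo)%E.
Proof.
elim: n => [|n IH] /=; first by rewrite diracE ltry.
rewrite /lebesgue_row_next /pushforward.
rewrite (_ : _ @^-1` _ = `[-1, 1]%classic `*` @cube n).
  rewrite /prod_measure product_measure1E//=; last exact: mcube.
  rewrite lebesgue_measure_itv/=.
  by rewrite lte_mul_pinfty//; case: ifPn => // _; rewrite -EFinB.
apply/seteqP; split => -[x y] /=.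
  move=> h; split; first by have := h ord0; rewrite mxE unlift_none.
  by move=> j; have := h (lift ord0 j); rewrite mxE liftK.
move=> [x1 Cy] i; rewrite mxE; case: unliftP => [j _|_] //=; exact: Cy.
Qed.

Let cone_measure_fin n : fin_num_fun (@cone_measure R n).
Proof.
move=> A mA; rewrite ge0_fin_numE//.
apply: le_lt_trans (lebesgue_cube_lty n).
apply: le_measure; rewrite ?inE.
- exact: measurable_cone.
- exact: mcube.
- move=> x [/andP[_ x1] _] i; rewrite in_itv/= -ler_norml.
  apply: le_trans (ltW x1); rewrite -sqrtr_sqr ler_wsqrtr// /dot (bigD1 i)//= -expr2.
  by rewrite lerDl; apply: sumr_ge0 => j _; exact: sqr_ge0.
Qed.

HB.instance Definition _ n := Measure_isFinite.Build _ _ _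
  (@cone_measure R n) (@cone_measure_fin n).

Definition sphere_measure n : {finite_measure set 'rV[R]_n -> \bar R} :=
  mscale n%:R%:nng (@cone_measure R n).

End sphere_measure.

Section hausdorff.
Context {R : realType} {n : nat}.
Implicit Types (A C : set 'rV[R]_n) (s : nat).
Local Open Scope ereal_scope.

Definition diam C : \bar R :=
  ereal_sup [set (enorm (x - y))%:E | x in C & y in C].

(* omega_s (diam C / 2)^s, with omega_s the volume of the unit ball of R^s *)
Definition hausdorff_gauge s C : \bar R :=
  if C == set0 then 0
  else lebesgue_row s (eball 0 1) * (diam C * (2^-1)%:E) ^+ s.

Definition hausdorff_pre s (delta : R) A : \bar R :=
  ereal_inf [set \sum_(k <oo) hausdorff_gauge s (F k) | F in
    [set F : (set 'rV[R]_n)^nat |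
      (forall k, diam (F k) <= delta%:E) /\ A `<=` \bigcup_k F k]].

Definition hausdorff s A : \bar R :=
  ereal_sup [set hausdorff_pre s delta A | delta in [set d | (0 < d)%R]].

Lemma hausdorff_gauge_ge0 s C : 0 <= hausdorff_gauge s C.
Proof.
rewrite /hausdorff_gauge; case: ifPn => // /set0P[x Cx].
apply: mule_ge0 => //; apply: expe_ge0; apply: mule_ge0 => //.
apply: ereal_sup_ubound; exists x => //; exists x => //.
by rewrite /enorm /dot subrr big1 ?sqrtr0// => i _; rewrite mxE mul0r.
Qed.

(* The covers by sets of diameter <= delta are turned into arbitrary covers by
   giving the other sets the gauge +oo, so that [mu_ext] applies. *)
Let discrete := g_sigma_algebraType [set: set 'rV[R]_n].

Let cut s (delta : R) (C : set discrete) : \bar R :=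
  if diam C <= delta%:E then hausdorff_gauge s C else +oo.

Let cut_ge0 s delta C : 0 <= cut s delta C.
Proof. by rewrite /cut; case: ifPn => // _; exact: hausdorff_gauge_ge0. Qed.

Let cut0 s delta : cut s delta set0 = 0.
Proof.
rewrite /cut /diam [X in ereal_sup X](_ : _ = set0) ?ereal_sup0 ?leNye; last first.
  by apply/seteqP; split => x // [].
by rewrite /hausdorff_gauge eqxx.
Qed.

Let hausdorff_preE s delta A : hausdorff_pre s delta A = mu_ext (cut s delta) A.
Proof.
apply/eqP; rewrite eq_le; apply/andP; split.
  apply: le_ereal_inf_tmp => _ [F [_ AF] <-].
  have [[k kF]|] := pselect (exists k, ~~ (diam (F k) <= delta%:E)).
    rewrite (@eseries_pinfty _ _ _ k) ?leey// /cut ?(negbTE kF)//.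
    by move=> m _; rewrite gt_eqF// (lt_le_trans _ (cut_ge0 _ _ _))// ltNy0.
  move=> /forallNP dF; apply: ereal_inf_lbound; exists F.
    by split => // k; apply/negPn/negP/dF.
  by apply: eq_eseriesr => k _; rewrite /cut ifT//; apply/negPn/negP/dF.
apply: le_ereal_inf_tmp => _ [F [dF AF] <-]; apply: ereal_inf_lbound; exists F.
  by split => // k; exact: sub_sigma_algebra.
by apply: eq_eseriesr => k _; rewrite /cut dF.
Qed.

Let hausdorff0 s : hausdorff s set0 = 0.
Proof.
apply/eqP; rewrite eq_le; apply/andP; split.
  by apply: ge_ereal_sup => _ [d d0 <-]; rewrite hausdorff_preE mu_ext0.
by apply: ereal_sup_ubound; exists 1%R => //=; rewrite hausdorff_preE mu_ext0.
Qed.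

Let hausdorff_ge0 s A : 0 <= hausdorff s A.
Proof.
apply: (@le_trans _ _ (hausdorff_pre s 1 A)).
  by rewrite hausdorff_preE mu_ext_ge0.
by apply: ereal_sup_ubound; exists 1%R => //=.
Qed.

Let le_hausdorff s : {homo hausdorff s : A B / A `<=` B >-> A <= B}.
Proof.
move=> A B AB; apply: ge_ereal_sup => _ [d d0 <-].
apply: (@le_trans _ _ (hausdorff_pre s d B)).
  by rewrite !hausdorff_preE; exact: le_mu_ext.
by apply: ereal_sup_ubound; exists d.
Qed.

Let hausdorff_sigma_subadditive s : sigma_subadditive (hausdorff s).
Proof.
move=> F; apply: ge_ereal_sup => _ [d d0 <-].
apply: (@le_trans _ _ (\sum_(i <oo) hausdorff_pre s d (F i))).
  rewrite hausdorff_preE; apply: le_trans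
    (@mu_ext_sigma_subadditive _ discrete R (cut s d) (cut_ge0 s d) F) _.
  by rewrite (eq_eseriesr (fun i _ => esym (hausdorff_preE s d (F i)))).
apply: lee_nneseries => [i _ _|i _]; first by rewrite hausdorff_preE mu_ext_ge0.
by apply: ereal_sup_ubound; exists d.
Qed.

HB.instance Definition _ s := isOuterMeasure.Build R _ (hausdorff s)
  (hausdorff0 s) (hausdorff_ge0 s) (@le_hausdorff s)
  (@hausdorff_sigma_subadditive s).

End hausdorff.

Section function_spaces.
Context d (T : measurableType d) (R : realType) (mu : {measure set T -> \bar R}).
Implicit Types (D : set T) (f : T -> R).

(* L^infty(D) for D a subset of T: elements are represented by functions on T of
   which only the values on D, up to a mu-null set, matter. *)
Definition Linf D f : Prop :=
  exists2 g, g \in Lfun mu +oo%E & f = g %[ae mu in D].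

Definition Linf_norm D f : \bar R := 'N[mu]_+oo[EFin \o (f \_ D)]%E.

End function_spaces.

Section differentiability.
Context {R : realType}.

(* C^k on an open set O of a finite-dimensional space. *)
Fixpoint Ck (V : normedModType R) (k : nat) (O : set V) (f : V -> R) : Prop :=
  {in O, continuous f} /\
  if k is k'.+1 then
    forall v, (forall x, O x -> derivable f x v) /\ Ck k' O (fun x => 'D_v f x)
  else True.

Definition smooth (V : normedModType R) (O : set V) (f : V -> R) : Prop :=
  forall k, Ck k O f.

(* C^1 on a subset A that need not be open, such as R^n x R^n x S^(n-1). *)
Definition C1_ext (V : normedModType R) (A : set V) (f : V -> R) : Prop :=
  exists O f', [/\ open O, A `<=` O, Ck 1 O f' & {in A, f' =1 f}].

Definition grad n (f : 'rV[R]_n -> R) (x : 'rV[R]_n) : 'rV[R]_n :=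
  \row_i 'D_(delta_mx ord0 i) f x.

End differentiability.

Section boltzmann.
Context {R : realType} {n : nat}.
Local Notation V := 'rV[R]_n.
Implicit Types (Om : set V) (T : R) (D : set (V * V)) (K : R * V * V * V * V -> R)
  (f g F : R * V * V -> R) (h : V * V -> R) (x v u w : V) (t : R).

(* Functions of (t, x, v), of (x, v) and of (t, x, v, u, w) are total functions on
   R * V * V, V * V and R * V * V * V * V; only their values at the points of the
   relevant domains are ever used. *)

Definition boundary Om : set V := closure Om `\` interior Om.

Definition local_defining_function Om (W : set V) (rho : V -> R) : Prop :=
  [/\ open W, smooth W rho, forall x, W x -> grad rho x != 0 &
      Om `&` W = [set x | rho x < 0] `&` W].

Definition smooth_boundary Om : Prop := forall x, boundary Om x ->
  exists W rho, W x /\ local_defining_function Om W rho.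

Definition is_outer_normal Om x : set V := [set nu | exists W rho,
  [/\ W x, local_defining_function Om W rho & nu = normalize (grad rho x)]].

Definition outer_normal Om x : V := xget 0 (is_outer_normal Om x).

Definition phase_space Om : set (V * V) := Om `*` setT.

Definition Gamma_minus Om : set (V * V) :=
  [set z | boundary Om z.1 /\ dot z.2 (outer_normal Om z.1) < 0].

Definition Gamma_plus Om : set (V * V) :=
  [set z | boundary Om z.1 /\ 0 < dot z.2 (outer_normal Om z.1)].

Definition cylinder T D : set (R * V * V) :=
  [set z | 0 < z.1.1 < T /\ D (z.1.2, z.2)].

Definition dxdv : {sigma_finite_measure set (V * V)%type -> \bar R} :=
  prod_measure (lebesgue_row n) (lebesgue_row n).

Definition dt : {sigma_finite_measure set (measurableTypeR R) -> \bar R} :=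
  lebesgue_measure.

Definition dtdxdv :
    {sigma_finite_measure set (measurableTypeR R * V * V)%type -> \bar R} :=
  prod_measure (prod_measure dt (lebesgue_row n)) (lebesgue_row n).

Definition dtdxdvdudw :
    {sigma_finite_measure set (measurableTypeR R * V * V * V * V)%type -> \bar R} :=
  prod_measure (prod_measure dtdxdv (lebesgue_row n)) (sphere_measure n).

(* The surface measure of boundary Om is the (n-1)-dimensional Hausdorff measure, on
   the sigma-algebra of its Caratheodory-measurable sets.  It is not sigma-finite on
   all of R^n; dt \x^ S only needs dt to be sigma-finite, as it is the measure
   A |-> \int[S]_x dt {t | A (t, x)}. *)
Definition surface_outer : {outer_measure set V -> \bar R} := @hausdorff R n n.-1.

Local Notation surface := (caratheodory_type surface_outer).

Definition surface_measure : {measure set surface -> \bar R} := surface_outer.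

Definition dtdSdv : {measure set (measurableTypeR R * surface * V)%type -> \bar R} :=
  ((dt \x^ surface_measure) \x lebesgue_row n)%E.

Definition post_u v u w : V := u - dot (u - v) w *: w.
Definition post_v v u w : V := v + dot (u - v) w *: w.

Definition Q K F1 F2 : R * V * V -> R := fun '(t, x, v) =>
  \int[lebesgue_row n]_u \int[sphere_measure n]_(w in sphere)
    (K (t, x, v, u, w) *
      (F1 (t, x, post_u v u w) * F2 (t, x, post_v v u w) -
       F1 (t, x, u) * F2 (t, x, v))).

(* tau_minus x 0 = +oo for x in Om. *)
Definition tau_minus Om x v : \bar R :=
  ereal_sup [set s%:E | s in [set s : R | 0 <= s /\ Om (x - s *: v)]].

(* The value at 0 is irrelevant: in [transport] it is attained on null sets only. *)
Definition heaviside (y : \bar R) : R := if (0 < y)%E then 1 else 0.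

(* The solution formula of d_t F + v . grad_x F = f with data g and h. *)
Definition transport Om f g h : R * V * V -> R := fun '(t, x, v) =>
  let tau := tau_minus Om x v in
  g (t - fine tau, x - fine tau *: v, v) * heaviside (t%:E - tau)%E +
  h (x - t *: v, v) * heaviside (tau - t%:E)%E +
  \int[lebesgue_measure]_(s in `]0, t[)
    (f (t - s, x - s *: v, v) * heaviside (tau - s%:E)%E).

Definition is_solution Om T K g h F : Prop :=
  Linf dtdxdv (cylinder T (phase_space Om)) F /\
  F = transport Om (Q K F F) g h %[ae dtdxdv in cylinder T (phase_space Om)].

Definition data_norm Om T g h : \bar R :=
  (Linf_norm dtdSdv (cylinder T (Gamma_minus Om)) g +
   Linf_norm dxdv (phase_space Om) h)%E.

Definition small_data Om T (kappa : R) : set ((R * V * V -> R) * (V * V -> R)) :=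
  [set gh | [/\ Linf dtdSdv (cylinder T (Gamma_minus Om)) gh.1,
                Linf dxdv (phase_space Om) gh.2 &
                (data_norm Om T gh.1 gh.2 <= kappa%:E)%E]].

Definition well_posed Om T K (kappa : R) : Prop :=
  exists2 C : R, 0 < C & forall g h, small_data Om T kappa (g, h) ->
    exists F, [/\ is_solution Om T K g h F,
      (Linf_norm dtdxdv (cylinder T (phase_space Om)) F <= C%:E * data_norm Om T g h)%E &
      forall F', is_solution Om T K g h F' ->
        F' = F %[ae dtdxdv in cylinder T (phase_space Om)]].

(* A representative of the solution class, unique under [well_posed]. *)
Definition solution Om T K g h : R * V * V -> R :=
  xget (fun=> 0) [set F | is_solution Om T K g h F].

(* (F on Gamma_+^T, F at time T), the traces being given by the solution formula;
   equality of the results in L^infty(Gamma_+^T) x L^infty(U) is [eq_measurement]. *)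
Definition measurement Om T K (gh : (R * V * V -> R) * (V * V -> R)) :
    (R * V * V -> R) * (V * V -> R) :=
  let F := solution Om T K gh.1 gh.2 in
  let trace := transport Om (Q K F F) gh.1 gh.2 in
  (trace, fun '(x, v) => trace (T, x, v)).

Definition eq_measurement Om T (a b : (R * V * V -> R) * (V * V -> R)) : Prop :=
  (a.1 : _ -> R) = b.1 %[ae dtdSdv in cylinder T (Gamma_plus Om)] /\
  (a.2 : _ -> R) = b.2 %[ae dxdv in phase_space Om].

Definition kernel_domain Om T : set (R * V * V * V * V) :=
  cylinder T (phase_space Om) `*` setT `*` sphere.

(* Strong measurability as a map from U_T to L^1(R^n x S^(n-1)) amounts to the
   existence of a jointly measurable representative. *)
Definition measurable_kernel Om T K : Prop :=
  exists2 K', measurable_fun setT K' & K = K' %[ae dtdxdvdudw in kernel_domain Om T].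

Definition kernel_norm Om T K : \bar R :=
  'N[dtdxdv]_+oo[(fun z => \int[lebesgue_row n]_u
     \int[sphere_measure n]_(w in sphere) `|K (z, u, w)|%:E) \_
     (cylinder T (phase_space Om))]%E.

(* The set of admissible kernels, for scalar and for vector-valued kernels. *)
Definition admissible Om T (M : R) K : Prop :=
  measurable_kernel Om T K /\ (kernel_norm Om T K < M%:E)%E.

Definition admissible_vec Om T (M : R) (G : R * V * V * V * V -> V) : Prop :=
  (forall i, measurable_kernel Om T (fun z => G z ord0 i)) /\
  (kernel_norm Om T (fun z => enorm (G z)) < M%:E)%E.

(* With total functions these gradients are meaningful at (t, x) in the open set
   (0,T) x Om; for kernels of the form [product_kernel] they are a priori undefined
   at v = 0, a null set. *)
Definition grad_x K : R * V * V * V * V -> V :=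
  fun '(t, x, v, u, w) => grad (fun y => K (t, y, v, u, w)) x.

Definition grad_v K : R * V * V * V * V -> V :=
  fun '(t, x, v, u, w) => grad (fun y => K (t, x, y, u, w)) v.

Definition sup_norm (D : set (R * V)) (f : R * V -> R) : \bar R :=
  ereal_sup [set `|f z|%:E | z in D].

(* Support of f : D -> R; its closure in the whole space is compact and contained in
   D exactly when the support relative to D is compact. *)
Definition supp (D : set (R * V)) (f : R * V -> R) : set (R * V) :=
  closure [set z | D z /\ f z != 0].

Definition time_space Om T : set (R * V) := `]0, T[ `*` Om.

Definition Phi_domain Om T : set (R * V * R) :=
  time_space Om T `*` [set r | 0 < r].

Definition product_kernel (Phi : R * V * R -> R) (Psi : V * V * V -> R) :
    R * V * V * V * V -> R :=
  fun '(t, x, v, u, w) => Phi (t, x, enorm v) * Psi (v, u, w).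

End boltzmann.

(* Main.v *)
(* The data are g = h = e phi(v) with phi the indicator of |v - v1| > 1/2.  The solutions
   are e phi + O(e^2) almost everywhere, hence the collision terms are
   e^2 Q_l(phi, phi) + O(e^3), and Q_1(phi, phi) - Q_2(phi, phi) is
   (Phi_1 - Phi_2)(t, x, |v|) w(v) with w > 0 near v1: there phi vanishes at v, while both
   postcollisional velocities may be far from v1.  Equality of the traces at order e^2
   makes the integrals of Phi_1 - Phi_2 along almost all rays (t - s, x - s v) vanish, for
   v near v1.  Here "almost all" needs care, as the rays start at the boundary: over a
   graph, null sets of the surface measure project to null sets, and almost every line of
   small slope through the graph meets a given null set in a null set.

   By Baire's theorem the support of Phi_1 - Phi_2 is uniformly compact for |v| in some
   interval, so that the ray integrals depend continuously on the ray and vanish for all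
   rays with v near v1.  For fixed |v|, integrating this against powers of xi . (x - t v)
   gives polynomials in xi . v that vanish on an interval; their coefficients are moments
   of Phi_1 - Phi_2.  So all of its moments vanish, and it is zero by Landau's version of
   the Weierstrass theorem. *)

Require Import Defs.
From HB Require Import structures.
From mathcomp Require Import all_boot all_order all_algebra.
From mathcomp Require Import all_classical all_reals all_analysis.
From mathcomp Require Import measurable_realfun ess_sup_inf ring lra.
Import Order.TTheory GRing.Theory Num.Theory.
Import numFieldNormedType.Exports.
Local Open Scope classical_set_scope.
Local Open Scope ring_scope.
Set Implicit Arguments. Unset Strict Implicit. Unset Printing Implicit Defensive.

(** * Borel measurability of open sets *)

Section borel_base.

(** Constant data would be useless, since Q(c, c) = 0; data that vanish near v1 leave only the gain
    term there, which has a sign. Elements of L^infinity and the choice made by [solution] give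
    representatives that need not be measurable. All identities are therefore carried almost
    everywhere to measurable truncated representatives, and null sets must be followed along rays
    and through collisions. Velocities are restricted to a narrow cone about the first axis
    ([transverse]), tied to the Lipschitz constant of the upper boundary graph: a ray from a deep
    point then leaves through that graph, never tangentially, over a point well inside the shadow of
    the domain. The supports are controlled for each r separately; the uniformity won by Baire makes
    the extension of Phi_1 - Phi_2 by zero continuous across the boundary and gives every relevant
    ray a point of fixed depth. As the potentials see v only through |v|, velocities on one arc of a
    sphere |v| = r1 all test the same function of (t, x). *)

Definition borel_base (T : topologicalType) (M : set (set T)) :=
  exists2 B : nat -> set T, forall k, M (B k) &
    forall x U, nbhs x U -> exists2 k, B k x & B k `<=` U.

(** The sets of the base need not be open and M need not be a sigma-algebra: U is the countable
    union of those [B k] that it contains. *)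
Lemma borel_base_open (T : topologicalType) (M : set (set T)) (U : set T) :
  M set0 -> (forall F : nat -> set T, (forall k, M (F k)) -> M (\bigcup_k F k)) ->
  borel_base M -> open U -> M U.
Proof.
move=> M0 MU [B MB Bb] oU.
rewrite (_ : U = \bigcup_k (if `[< B k `<=` U >] then B k else set0)).
  by apply: MU => k; case: asboolP.
apply/seteqP; split => [x Ux|x [k _]]; last by case: asboolP => // BU /BU.
have /Bb[k Bkx BkU] : nbhs x U by apply: open_nbhs_nbhs.
by exists k => //; rewrite asboolT.
Qed.

Lemma borel_base_prod (T1 T2 : topologicalType) M1 M2 (M : set (set (T1 * T2))) :
  borel_base M1 -> borel_base M2 ->
  (forall A B, M1 A -> M2 B -> M (A `*` B)) -> borel_base M.
Proof.
move=> [B1 MB1 b1] [B2 MB2 b2] M12.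
(* Codes that are not codes of a pair only need some member of M. *)
exists (fun k => if unpickle k is Some (i, j) then B1 i `*` B2 j else B1 k `*` B2 k).
  by move=> k; case: unpickle => [[i j]|]; apply: M12.
move=> [x y] U [[P Q] /= [/b1[i Bix BiP] /b2[j Bjy BjQ]] PQU].
exists (pickle (i, j)); rewrite pickleK//.
by move=> [u v] [/= Biu Bjv]; apply: PQU; split; [exact: BiP|exact: BjQ].
Qed.

Variable R : realType.

Lemma rat_itv_base (x : R) (U : set R) : nbhs x U ->
  exists q : rat * rat, (ratr q.1 < x < ratr q.2) /\
    (`](ratr q.1 : R), ratr q.2[%classic : set R) `<=` U.
Proof.
move=> /nbhs_ballP[e /= e0 xeU].
have [q1 q1x] := @rat_in_itvoo R (x - e) x ltac:(by rewrite ltrBlDr ltrDl).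
have [q2 q2x] := @rat_in_itvoo R x (x + e) ltac:(by rewrite ltrDl).
move: q1x q2x; rewrite !in_itv/= => /andP[q1l q1r] /andP[q2l q2r].
exists (q1, q2); split; first by rewrite /= q1r q2l.
move=> y; rewrite /= in_itv/= => /andP[y1 y2]; apply: xeU.
by rewrite /ball/= ltr_norml ltrBlDr ltrBrDl; apply/andP; split; lra.
Qed.

Lemma borel_base_R : @borel_base R (@measurable _ (measurableTypeR R)).
Proof.
exists (fun k => if unpickle k is Some (q1, q2) then
    (`](ratr q1 : R), ratr q2[%classic : set R) else setT).
  by move=> k; case: unpickle => [[q1 q2]|]; [exact: measurable_itv|exact: measurableT].
move=> x U /rat_itv_base[[q1 q2] [/= xq qU]].
by exists (pickle (q1, q2)); rewrite pickleK.
Qed.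

Lemma borel_base_row n : @borel_base 'rV[R]_n (@measurable _ 'rV[R]_n).
Proof.
pose box (q : {ffun 'I_n -> rat * rat}) : set 'rV[R]_n :=
  [set x | forall i, ratr (q i).1 < x ord0 i < ratr (q i).2].
exists (fun k => if unpickle k is Some q then box q else setT).
  move=> k; case: unpickle => [q|]; last exact: measurableT.
  rewrite (_ : box q = \bigcap_(i in [set: 'I_n])
      (setT `&` row_coord i @^-1` (`](ratr (q i).1 : R), ratr (q i).2[%classic : set R))).
    apply: fin_bigcap_measurable => // i _.
    by apply: measurable_row_coord => //; exact: measurable_itv.
  apply/seteqP; split => x /=; first by move=> Cx i _; split => //; exact: Cx.
  by move=> Cx i; have [] := Cx i I.
move=> x U [P xP PU].
have /choice[q qP] : forall i, exists q : rat * rat, (ratr q.1 < x ord0 i < ratr q.2) /\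
    (`](ratr q.1 : R), ratr q.2[%classic : set R) `<=` P ord0 i.
  by move=> i; apply: rat_itv_base; exact: xP.
exists (pickle [ffun i => q i]); rewrite pickleK.
  by move=> i; rewrite ffunE; have [] := qP i.
move=> y yq; apply: PU => i j; rewrite (ord1 i); have [_] := qP j; apply.
by have := yq j; rewrite ffunE.
Qed.

End borel_base.

Section open_measurable.
Variable R : realType.
Local Notation V n := 'rV[R]_n.

(** The map e separates the measurable from the topological structure of one space; in its uses here
    it is the identity, with [measurableTypeR R] on one side and R on the other. *)
Lemma measurable_open_of_base d (T : measurableType d) (T' : topologicalType)
  (e : T -> T') : @borel_base T' [set A | measurable (e @^-1` A)] ->
  forall U : set T', open U -> measurable (e @^-1` U).
Proof.
move=> b U; apply: borel_base_open b => /=; first by rewrite preimage_set0.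
by move=> F mF; rewrite preimage_bigcup; exact: bigcupT_measurable.
Qed.

Lemma open_measurable_row n (U : set (V n)) : open U -> measurable U.
Proof.
exact: (@measurable_open_of_base _ (V n) (V n) (fun x => x) (@borel_base_row R n) U).
Qed.

Lemma borel_base_Rrow n : @borel_base (R * V n)%type
  (@measurable _ (measurableTypeR R * V n)%type).
Proof.
apply: borel_base_prod (borel_base_R R) (borel_base_row R n) _.
by move=> A B mA mB; exact: measurableX.
Qed.

Lemma open_measurable_RrowR n (U : set (R * V n * R)) : open U ->
  @measurable _ (measurableTypeR R * V n * measurableTypeR R)%type U.
Proof.
apply: (@measurable_open_of_base _ (measurableTypeR R * V n * measurableTypeR R)%type
  (R * V n * R)%type (fun x => x)  _ U).
apply: borel_base_prod (@borel_base_Rrow n) (borel_base_R R) _.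
by move=> A B mA mB; exact: measurableX.
Qed.

Lemma open_measurable_row3 n (U : set (V n * V n * V n)) : open U -> measurable U.
Proof.
apply: (@measurable_open_of_base _ (V n * V n * V n)%type (V n * V n * V n)%type
  (fun x => x)  _ U).
have b2 : @borel_base (V n * V n)%type (@measurable _ (V n * V n)%type).
  apply: borel_base_prod (borel_base_row R n) (borel_base_row R n) _.
  by move=> A B mA mB; exact: measurableX.
apply: borel_base_prod b2 (borel_base_row R n) _.
by move=> A B mA mB; exact: measurableX.
Qed.

Lemma measurable_patch_open d (T : measurableType d) (T' : topologicalType)
    (e : T -> T') (O : set T') (f : T' -> R) :
  (forall U : set T', open U -> measurable (e @^-1` U)) ->
  open O -> {in O, continuous f} -> measurable_fun setT ((f \_ O) \o e).
Proof.
move=> me oO cf.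
apply: (measurability _ (RGenOInfty.measurableE R)).
move=> /= _ [_ [a ->] <-]; rewrite setTI.
set B := `]a, +oo[%classic.
(* Inside O the preimage of a half-line is open by continuity; outside O the function is 0, so
   either everything or nothing belongs to it. *)
rewrite (_ : _ @^-1` _ = e @^-1` (O `&` f @^-1` B) `|`
   ((e @^-1` (~` O)) `&` [set _ | B 0])); last first.
  apply/seteqP; split => x; rewrite /preimage /= /patch.
    by case: ifPn; rewrite ?inE ?notin_setE => Ox Bx; [left|right].
  by case: ifPn; rewrite ?inE ?notin_setE => Ox [[]|[]].
apply: measurableU; last first.
  apply: measurableI.
    by rewrite preimage_setC; apply: measurableC; exact: me.
  by have [B0|nB0] := pselect (B 0);
    [rewrite (_ : [set _ | _] = setT)|rewrite (_ : [set _ | _] = set0)] => //;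
    apply/seteqP; split.
apply: me; rewrite openE => x [Ox Bx]; apply: filterI.
  exact: open_nbhs_nbhs.
apply: (cf x); first by rewrite inE.
by apply: open_nbhs_nbhs; split => //; exact: interval_open.
Qed.

End open_measurable.

(** * Almost everywhere statements on products *)

Lemma aeS d (T : measurableType d) (R : realType) (mu : {measure set T -> \bar R})
    (P Q : T -> Prop) :
  (forall x, P x -> Q x) -> (\forall x \ae mu, P x) -> \forall x \ae mu, Q x.
Proof. by move=> PQ; apply: filterS. Qed.
Arguments aeS {d T R mu} P {Q}.

Lemma aeI d (T : measurableType d) (R : realType) (mu : {measure set T -> \bar R})
    (P1 P2 Q : T -> Prop) :
  (forall x, P1 x -> P2 x -> Q x) ->
  (\forall x \ae mu, P1 x) -> (\forall x \ae mu, P2 x) -> \forall x \ae mu, Q x.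
Proof. by move=> PQ; apply: filterS2. Qed.
Arguments aeI {d T R mu} P1 P2 {Q}.
Lemma aeAnd d (T : measurableType d) (R : realType) (mu : {measure set T -> \bar R})
    (P1 P2 : T -> Prop) :
  (\forall x \ae mu, P1 x) -> (\forall x \ae mu, P2 x) ->
  \forall x \ae mu, P1 x /\ P2 x.
Proof. exact: aeI. Qed.

Section ae_product.
Context d1 d2 (T1 : measurableType d1) (T2 : measurableType d2) (R : realType).

(** The product measure is by definition the integral of the section measures, so almost every
    section of a null set is null. Only m2 is sigma-finite because the first factor may be
    [dt \x^ surface_measure], which is not. *)
Lemma ae_xsection (m1 : {measure set T1 -> \bar R})
    (m2 : {sigma_finite_measure set T2 -> \bar R}) (P : T1 * T2 -> Prop) :
  (\forall z \ae (m1 \x m2)%E, P z) ->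
  \forall x \ae m1, \forall y \ae m2, P (x, y).
Proof.
move=> [N [mN N0 PN]].
have := N0; rewrite /product_measure1 => I0.
have /(ae_eq_integral_abs m1 measurableT) : measurable_fun setT (m2 \o xsection N).
  exact: measurable_fun_xsection.
move=> [+ _]; rewrite -[X in X = _ -> _]/(\int[m1]_x `|(m2 \o xsection N) x|)%E.
under eq_integral do rewrite gee0_abs//.
move=> /(_ I0); apply: filterS => x /(_ I) /= Nx.
exists (xsection N x); split => //; first exact: measurable_xsection.
by move=> y /= nP; rewrite /xsection /= inE; apply: PN.
Qed.

Lemma ae_ysection (m1 : {sigma_finite_measure set T1 -> \bar R})
    (m2 : {measure set T2 -> \bar R}) (P : T1 * T2 -> Prop) :
  (\forall z \ae (m1 \x^ m2)%E, P z) ->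
  \forall y \ae m2, \forall x \ae m1, P (x, y).
Proof.
move=> [N [mN N0 PN]].
have := N0; rewrite /product_measure2 => I0.
have /(ae_eq_integral_abs m2 measurableT) : measurable_fun setT (m1 \o ysection N).
  exact: measurable_fun_ysection.
move=> [+ _]; rewrite -[X in X = _ -> _]/(\int[m2]_x `|(m1 \o ysection N) x|)%E.
under eq_integral do rewrite gee0_abs//.
move=> /(_ I0); apply: filterS => x /(_ I) /= Nx.
exists (ysection N x); split => //; first exact: measurable_ysection.
by move=> y /= nP; rewrite /ysection /= inE; apply: PN.
Qed.

(** Measurability of P is essential: a non-measurable set can have null sections without being null.
    Properties are therefore first shrunk by [ae_measurable_sub]. *)
Lemma ae_prod (m1 : {measure set T1 -> \bar R})
    (m2 : {sigma_finite_measure set T2 -> \bar R}) (P : set (T1 * T2)) :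
  measurable P -> (\forall x \ae m1, \forall y \ae m2, P (x, y)) ->
  \forall z \ae (m1 \x m2)%E, P z.
Proof.
move=> mP aeP; exists (~` P); split => //; first exact: measurableC.
rewrite /product_measure1.
have mx : measurable_fun setT (m2 \o xsection (~` P)).
  by apply: measurable_fun_xsection; exact: measurableC.
have [_] := ae_eq_integral_abs m1 measurableT mx.
under eq_integral do rewrite gee0_abs//.
apply; apply: filterS aeP => x aeP _ /=.
apply: measure_negligible; first by apply: measurable_xsection; exact: measurableC.
by rewrite /xsection/=; apply: negligibleS aeP => y /=; rewrite inE.
Qed.

Lemma ae_swap (m1 : {sigma_finite_measure set T1 -> \bar R})
    (m2 : {sigma_finite_measure set T2 -> \bar R}) (P : set (T1 * T2)) :
  measurable P ->
  (\forall x \ae m1, \forall y \ae m2, P (x, y)) <->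
  (\forall y \ae m2, \forall x \ae m1, P (x, y)).
Proof.
move=> mP; have mnP := measurableC mP.
have E : (m1 \x m2)%E (~` P) = (m1 \x^ m2)%E (~` P).
  have := indic_fubini_tonelli m1 m2 mnP.
  by rewrite indic_fubini_tonelli_FE// indic_fubini_tonelli_GE.
split => aeP.
  apply: ae_ysection.
  have [N [mN N0 PN]] := ae_prod mP aeP.
  exists (~` P); split => //; rewrite -E.
  by apply/eqP; rewrite -measure_le0 -N0 le_measure ?inE.
apply: ae_xsection; exists (~` P); split => //; rewrite E /product_measure2.
have mx : measurable_fun setT (m1 \o ysection (~` P)).
  by apply: measurable_fun_ysection.
have [_] := ae_eq_integral_abs m2 measurableT mx.
under eq_integral do rewrite gee0_abs//.
apply; apply: filterS aeP => x aeP _ /=.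
apply: measure_negligible; first by apply: measurable_ysection.
by rewrite /ysection/=; apply: negligibleS aeP => y /=; rewrite inE.
Qed.

End ae_product.

(** * Changes of variables and null sets *)

(** The covers for e = 1/(m+1) are intersected, which yields a measurable null set containing X. *)
Lemma negligible_small_covers d (T : measurableType d) (R : realType)
    (mu : {measure set T -> \bar R}) (X : set T) :
  (forall e : R, 0 < e -> exists C : nat -> set T, [/\ forall k, measurable (C k),
     X `<=` \bigcup_k C k & (\sum_(k <oo) mu (C k) <= e%:E)%E]) ->
  mu.-negligible X.
Proof.
move=> H.
have {H} /choice[C HC] : forall m : nat, exists C : nat -> set T, [/\ forall k, measurable (C k),
     X `<=` \bigcup_k C k & (\sum_(k <oo) mu (C k) <= (m.+1%:R^-1)%:E)%E].
  by move=> m; apply: H; rewrite invr_gt0.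
have mU m : measurable (\bigcup_k C m k).
  by apply: bigcupT_measurable; have [] := HC m.
have mN : measurable (\bigcap_m \bigcup_k C m k) by exact: bigcapT_measurable.
exists (\bigcap_m \bigcup_k C m k); split => //; last first.
  by move=> x Xx m _; have [_ + _] := HC m; apply.
apply/eqP; rewrite -measure_le0; apply/lee_addgt0Pr => e e0; rewrite add0e.
have [m me] : exists m : nat, m.+1%:R^-1 <= e.
  by exists (Num.truncn e^-1); rewrite invf_ple ?posrE// ltW// truncnS_gt.
have [mC _ Cm] := HC m.
apply: (@le_trans _ _ (mu (\bigcup_k C m k))).
  by apply: le_measure; rewrite ?inE//; exact: bigcap_inf.
apply: (le_trans (generalized_Boole_inequality mu mC (mU m))).
by apply: (le_trans Cm); rewrite lee_fin.
Qed.

Section expanding.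
Variable R : realType.
Notation mu := (@lebesgue_measure R).

(** [lebesgue_measure] is constructed as an infimum over covers by half-open intervals, so a value
    below e comes with such a cover. *)
Lemma lebesgue_null_cover (E : set R) (e : R) : mu.-negligible E -> 0 < e ->
  exists ab : nat -> R * R, [/\ forall k, (ab k).1 <= (ab k).2,
    E `<=` \bigcup_k (`](ab k).1, (ab k).2]%classic) &
    (\sum_(k <oo) ((ab k).2 - (ab k).1)%:E <= e%:E)%E].
Proof.
move=> [N [mN N0 EN]] e0.
have : (mu N < e%:E)%E by rewrite N0 lte_fin.
move=> /ereal_inf_lt[_ [A [mA NA] <-] Ae].
have /choice[ab Hab] : forall k, exists p : R * R, p.1 <= p.2 /\ A k = `]p.1, p.2]%classic.
  move=> k; have [[a b] _ <-] := mA k => /=.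
  have [ab|ba] := leP a b; first by exists (a, b).
  exists (0, 0); split => //=; rewrite !set_itv_ge// bnd_simp -leNgt //.
  exact: ltW.
exists ab; split => [k||]; first by have [] := Hab k.
  by move=> x /EN /NA[k _ Akx]; exists k => //; have [_ <-] := Hab k.
apply: ltW; apply: le_lt_trans Ae; apply: lee_nneseries => k _.
  by rewrite lee_fin subr_ge0; have [] := Hab k.
have [ab1 ->] := Hab k.
by have := @wlength_itv_bnd R idfun _ _ false false ab1; rewrite /= => ->.
Qed.

(** Within A, an interval of length l pulls back to a set of diameter at most l / c, hence into an
    interval of length 2 l / c about any of its points. A cover of E is pulled back interval by
    interval. *)
Lemma negligible_expanding (E A : set R) (psi : R -> R) (c : R) : 0 < c ->
  (forall s s', A s -> A s' -> c * `|s - s'| <= `|psi s - psi s'|) ->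
  mu.-negligible E -> mu.-negligible (A `&` psi @^-1` E).
Proof.
move=> c0 cA E0; apply: negligible_small_covers => e e0.
(* The factor c / 2 compensates the stretching by 2 / c. *)
have [|ab [abl Eab abe]] := @lebesgue_null_cover E (c * e / 2) E0.
  by rewrite divr_gt0// mulr_gt0.
pose B k := A `&` psi @^-1` (`](ab k).1, (ab k).2]%classic).
pose d k := ((ab k).2 - (ab k).1) / c.
have d0 k : 0 <= d k by rewrite divr_ge0 ?subr_ge0// ltW.
pose p k := xget 0 (B k).
exists (fun k => `[p k - d k, p k + d k]%classic); split => //.
  move=> s [As /Eab[k _ sk]]; exists k => //.
  have Bs : B k s by [].
  have [Ap pk] : B k (p k) by rewrite /p; case: xgetP => [y ->//|/(_ s)].
  have := cA _ _ As Ap; rewrite mulrC -ler_pdivlMr//.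
  have : `|psi s - psi (p k)| <= (ab k).2 - (ab k).1.
    move: sk pk; rewrite /= !in_itv/= => /andP[? ?] /andP[? ?].
    by rewrite ler_norml; apply/andP; split; lra.
  move=> h1 h2; rewrite /= in_itv/= -ler_distl.
  by apply: (le_trans h2); rewrite /d ler_wpM2r// invr_ge0 ltW.
have EI k : lebesgue_measure (`[p k - d k, p k + d k]%classic : set R) =
    ((2 / c)%:E * ((ab k).2 - (ab k).1)%:E)%E.
  rewrite lebesgue_measure_itv/= lte_fin; case: ifPn => [_|].
    by rewrite -EFinB -EFinM /d; congr EFin; field; rewrite gt_eqF.
  rewrite -leNgt => h; have : d k = 0 by apply/eqP; rewrite eq_le d0 andbT; have := d0 k; lra.
  rewrite /d => /eqP; rewrite mulf_eq0 invr_eq0 (gt_eqF c0) orbF => /eqP ->.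
  by rewrite mule0.
rewrite (eq_eseriesr (fun k _ => EI k)).
rewrite nneseriesZl//=; last by move=> k _; rewrite lee_fin subr_ge0.
apply: (@le_trans _ _ ((2 / c)%:E * (c * e / 2)%:E)%E).
  by rewrite lee_pmul2l// lte_fin divr_gt0.
by rewrite -EFinM lee_fin le_eqVlt; apply/orP; left; apply/eqP; field; rewrite gt_eqF.
Qed.

End expanding.

Section measurable_row_ops.
Context {R : realType} {n : nat} d (T : measurableType d).
Local Notation V := 'rV[R]_n.
Implicit Types f g : T -> V.

Lemma measurable_rowcoord f i : measurable_fun setT f ->
  measurable_fun setT (fun x => f x ord0 i).
Proof. by move=> mf; exact: measurableT_comp (measurable_row_coord i) mf. Qed.

Lemma measurable_rowD f g : measurable_fun setT f -> measurable_fun setT g ->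
  measurable_fun setT (fun x => f x + g x).
Proof.
move=> mf mg; apply: measurable_fun_rowP => i.
rewrite (_ : _ \o _ = (fun x => f x ord0 i + g x ord0 i)).
  by apply: measurable_funD; exact: measurable_rowcoord.
by apply/funext => x; rewrite /row_coord /= mxE.
Qed.

Lemma measurable_rowZ (a : T -> R) f : measurable_fun setT a -> measurable_fun setT f ->
  measurable_fun setT (fun x => a x *: f x).
Proof.
move=> mf mg; apply: measurable_fun_rowP => i.
rewrite (_ : _ \o _ = (fun x => a x * f x ord0 i)).
  by apply: measurable_funM => //; exact: measurable_rowcoord.
by apply/funext => x; rewrite /row_coord /= mxE.
Qed.

Lemma measurable_rowN f : measurable_fun setT f -> measurable_fun setT (fun x => - f x).
Proof.
move=> mf; rewrite (_ : (fun _ => _) = (fun x => (-1) *: f x)).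
  exact: measurable_rowZ.
by apply/funext => x; rewrite scaleN1r.
Qed.

Lemma measurable_rowB f g : measurable_fun setT f -> measurable_fun setT g ->
  measurable_fun setT (fun x => f x - g x).
Proof. by move=> mf mg; apply: measurable_rowD => //; exact: measurable_rowN. Qed.

Lemma measurable_dot f g : measurable_fun setT f -> measurable_fun setT g ->
  measurable_fun setT (fun x => dot (f x) (g x)).
Proof.
move=> mf mg; apply: (@measurable_sum _ _ R setT _ _
  (fun i x => f x ord0 i * g x ord0 i)) => i.
by apply: measurable_funM; exact: measurable_rowcoord.
Qed.

End measurable_row_ops.

(** * Translation invariance of Lebesgue measure *)

Section translation.
Variable R : realType.
Notation leb := (@dt R).
Local Notation V n := 'rV[R]_n.

Lemma measurable_shift1 (a : R) :
  measurable_fun setT ((fun x => x + a) : measurableTypeR R -> measurableTypeR R).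
Proof. exact: measurable_funD. Qed.

Lemma lebesgue_measure_shift (a : R) (A : set R) : measurable A ->
  pushforward leb ((fun x => x + a) : _ -> measurableTypeR R) A = leb A.
Proof.
move=> mA; apply/esym/lebesgue_measure_unique => //=.
  exact: measurable_shift1.
move=> mf _ [[x y]] _ <-; rewrite /pushforward.
rewrite (_ : _ @^-1` _ = `]x - a, y - a]%classic).
  rewrite !lebesgue_measure_itv/= !lte_fin ltrD2r.
  by rewrite -!EFinB opprB addrA subrK.
by apply/seteqP; split => z /=; rewrite !in_itv/= ltrBlDr lerBrDr.
Qed.

Lemma ge0_integral_shift1 (a : R) (f : R -> \bar R) :
  measurable_fun setT f -> (forall x, 0 <= f x)%E ->
  (\int[leb]_x f (x + a)%R = \int[leb]_x f x)%E.
Proof.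
move=> mf f0; have := @ge0_integral_pushforward _ _ (measurableTypeR R)
  (measurableTypeR R) R _ (measurable_shift1 a) leb setT f measurableT mf.
rewrite preimage_setT => /(_ (fun x _ => f0 x)) <-.
apply: (eq_measure_integral leb) => [|mm A mA _]; first exact: measurable_shift1.
exact: lebesgue_measure_shift.
Qed.

Lemma row_consE n (x : V n.+1) : row_cons (x ord0 ord0, \row_j x ord0 (lift ord0 j)) = x.
Proof.
by apply/rowP => i; rewrite mxE; case: (unliftP ord0 i) => [j|] -> //=; rewrite mxE.
Qed.

Lemma row_consK n (z : R) (y : V n) : \row_j row_cons (z, y) ord0 (lift ord0 j) = y.
Proof. by apply/rowP => i; rewrite !mxE liftK. Qed.

Lemma row_cons0 n (z : R) (y : V n) : row_cons (z, y) ord0 ord0 = z.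
Proof. by rewrite mxE unlift_none. Qed.

Lemma row_consS n (z : R) (y : V n) j : row_cons (z, y) ord0 (lift ord0 j) = y ord0 j.
Proof. by rewrite mxE liftK. Qed.

Lemma row_consD n (z : R) (y : V n) (b : V n.+1) : row_cons (z, y) + b =
  row_cons (z + b ord0 ord0, y + \row_j b ord0 (lift ord0 j)).
Proof.
rewrite -[LHS]row_consE; congr row_cons; congr pair.
  by rewrite mxE row_cons0.
by apply/rowP => j; rewrite !mxE liftK.
Qed.

Lemma lebesgue_row_shift n (b : V n) (A : set (V n)) : measurable A ->
  lebesgue_row n ((fun x => x + b) @^-1` A) = lebesgue_row n A.
Proof.
elim: n b A => [|n IH] b A mA.
  congr (lebesgue_row 0 _); apply/seteqP.
  by split => x /=; rewrite (_ : x + b = x)//; apply/rowP => -[].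
rewrite /= /lebesgue_row_next /pushforward /prod_measure /product_measure1.
pose B := @row_cons R n @^-1` A.
have mB : measurable B.
  by rewrite -[X in measurable X]setTI; exact: measurable_row_cons.
pose b' : V n := \row_j b ord0 (lift ord0 j).
have E z : xsection (row_cons (m:=n) @^-1` ((fun x => x + b) @^-1` A)) z =
    (fun y => y + b') @^-1` xsection B (z + b ord0 ord0).
  by apply/seteqP; split => y; rewrite /xsection /= !inE /B /= row_consD.
transitivity (\int[leb]_x (lebesgue_row n \o xsection B) (x + b ord0 ord0)%R)%E.
  apply: eq_integral => z _ /=; rewrite E IH//; exact: measurable_xsection.
by rewrite ge0_integral_shift1//; exact: measurable_fun_xsection.
Qed.

Lemma measurable_shift_row n (b : V n) (A : set (V n)) : measurable A ->
  measurable ((fun x => x + b) @^-1` A).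
Proof. by move=> mA; rewrite -[X in measurable X]setTI; exact: measurable_rowD. Qed.

Lemma ge0_integral_shift_row n (b : V n) (f : V n -> \bar R) :
  measurable_fun setT f -> (forall x, 0 <= f x)%E ->
  (\int[lebesgue_row n]_x f (x + b)%R = \int[lebesgue_row n]_x f x)%E.
Proof.
move=> mf f0.
have mb : measurable_fun setT (fun x : V n => x + b) by exact: measurable_rowD.
have := @ge0_integral_pushforward _ _ (V n) (V n) R _ mb (lebesgue_row n) setT f
  measurableT mf.
rewrite preimage_setT => /(_ (fun x _ => f0 x)) <-.
by apply: (eq_measure_integral (lebesgue_row n)) => A mA _; exact: lebesgue_row_shift.
Qed.

Lemma ae_shift_row n (b : V n) (P : V n -> Prop) :
  (\forall x \ae lebesgue_row n, P x) -> \forall x \ae lebesgue_row n, P (x + b).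
Proof.
move=> [N [mN N0 PN]]; exists ((fun x => x + b) @^-1` N); split.
- exact: measurable_shift_row.
- by rewrite lebesgue_row_shift.
- by move=> x /= ?; apply: PN.
Qed.

Lemma ae_expanding (A : set R) (psi : R -> R) (c : R) (P : R -> Prop) : 0 < c ->
  (forall s s', A s -> A s' -> c * `|s - s'| <= `|psi s - psi s'|) ->
  (\forall s \ae leb, P s) -> \forall s \ae leb, A s -> P (psi s).
Proof.
move=> c0 cA aeP.
have := negligible_expanding c0 cA aeP; apply: negligibleS.
by move=> s /= /not_implyP[].
Qed.

Lemma ae_affine (a b : R) (P : R -> Prop) : a != 0 ->
  (\forall s \ae leb, P s) -> \forall s \ae leb, P (a * s + b).
Proof.
move=> a0 aeP.
have aP s s' : [set: R] s -> [set: R] s' ->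
    `|a| * `|s - s'| <= `|(a * s + b) - (a * s' + b)|.
  by move=> _ _; rewrite opprD addrACA subrr addr0 -mulrBr normrM.
have a1 : 0 < `|a| by rewrite normr_gt0.
by apply: aeS (ae_expanding a1 aP aeP) => s; exact.
Qed.

Lemma ae_row_cons n (P : V n.+1 -> Prop) :
  (\forall x \ae lebesgue_row n.+1, P x) ->
  \forall z \ae leb, \forall y \ae lebesgue_row n, P (row_cons (z, y)).
Proof.
move=> [N [mN N0 PN]].
apply: (@ae_xsection _ _ _ _ R leb (lebesgue_row n) (fun p => P (row_cons p))).
exists (@row_cons R n @^-1` N); split => //.
  by rewrite -[X in measurable X]setTI; exact: measurable_row_cons.
by move=> p /= ?; apply: PN.
Qed.

Lemma ae_of_row_cons n (P : set (V n.+1)) : measurable P ->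
  (\forall z \ae leb, \forall y \ae lebesgue_row n, P (row_cons (z, y))) ->
  \forall x \ae lebesgue_row n.+1, P x.
Proof.
move=> mP aeP.
have mP' : measurable (@row_cons R n @^-1` P).
  by rewrite -[X in measurable X]setTI; exact: measurable_row_cons.
have [N [mN N0 PN]] := @ae_prod _ _ _ _ R leb (lebesgue_row n) _ mP' aeP.
exists (~` P); split => //; first exact: measurableC.
rewrite /= /lebesgue_row_next /pushforward.
apply: (@subset_measure0 _ _ R _ _ _ _ mN) => //.
by rewrite preimage_setC; exact: measurableC.
Qed.

End translation.

(** * The sup norm and the Euclidean norm *)

Section row_norms.
Context {R : realType} {n : nat}.
Local Notation V := 'rV[R]_n.
Implicit Types x y : V.

Lemma row_norm_leP x (e : R) : 0 <= e -> (`|x| <= e) <-> forall i, `|x ord0 i| <= e.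
Proof.
move=> e0; split => [xe i|xe].
  apply: le_trans xe; rewrite [`|x|]mx_normrE.
  by apply: (@le_bigmax _ _ _ _ (fun ij : 'I_1 * 'I_n => `|x ij.1 ij.2|) (ord0, i)).
rewrite [`|x|]mx_normrE; apply: bigmax_le => // -[i j] _ /=.
by rewrite (ord1 i).
Qed.

Lemma coord_le_norm x i : `|x ord0 i| <= `|x|.
Proof. by have /row_norm_leP := lexx `|x|; apply. Qed.

Lemma coord_le_enorm x i : `|x ord0 i| <= enorm x.
Proof.
rewrite -sqrtr_sqr ler_wsqrtr// /dot (bigD1 i)//= -expr2 lerDl.
by apply: sumr_ge0 => j _; exact: sqr_ge0.
Qed.

Lemma norm_le_enorm x : `|x| <= enorm x.
Proof. by apply/row_norm_leP; [exact: sqrtr_ge0|exact: coord_le_enorm]. Qed.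

Lemma enorm_ge0 x : 0 <= enorm x. Proof. exact: sqrtr_ge0. Qed.

Lemma enorm_gt0 x : x != 0 -> 0 < enorm x.
Proof. by move=> x0; apply: lt_le_trans (norm_le_enorm x); rewrite normr_gt0. Qed.

Lemma cvg_coord (T : Type) (F : set_system T) {FF : Filter F} (f : T -> V) (a : V) :
  (forall i, (fun t => f t ord0 i) @ F --> a ord0 i) -> f @ F --> a.
Proof.
move=> H; apply/cvgrPdist_le => e e0.
have /filter_forall : forall i, \forall t \near F, `|a ord0 i - f t ord0 i| <= e.
  by move=> i; have /cvgrPdist_le := H i; exact.
by apply: filterS => t ft; apply/row_norm_leP; [exact: ltW|move=> i; rewrite !mxE].
Qed.

Lemma coord_cvg (T : Type) (F : set_system T) {FF : Filter F} (f : T -> V) (a : V) i :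
  f @ F --> a -> (fun t => f t ord0 i) @ F --> a ord0 i.
Proof. by move=> fa; exact: (cvg_comp _ _ fa (@coord_continuous _ _ _ ord0 i a)). Qed.

Lemma cvg_dot (T : Type) (F : set_system T) {FF : Filter F} (f g : T -> V) (a b : V) :
  f @ F --> a -> g @ F --> b -> (fun t => dot (f t) (g t)) @ F --> dot a b.
Proof.
move=> fa gb; apply: cvg_big => [|i _]; first exact: add_continuous.
by apply: cvgM; exact: coord_cvg.
Qed.

Lemma cvg_enorm (T : Type) (F : set_system T) {FF : Filter F} (f : T -> V) (a : V) :
  f @ F --> a -> (fun t => enorm (f t)) @ F --> enorm a.
Proof.
by move=> fa; exact: (cvg_comp _ _ (cvg_dot fa fa) (@sqrt_continuous R _)).
Qed.

Lemma enorm_continuous : continuous (@enorm R n).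
Proof. move=> x. have := (@cvg_enorm _ (nbhs x) _ (fun y => y) x cvg_id). exact. Qed.

Lemma dotDl (x y z : V) : dot (x + y) z = dot x z + dot y z.
Proof. by rewrite /dot -big_split /=; apply: eq_bigr => i _; rewrite mxE mulrDl. Qed.

Lemma dotDr (x y z : V) : dot z (x + y) = dot z x + dot z y.
Proof. by rewrite /dot -big_split /=; apply: eq_bigr => i _; rewrite mxE mulrDr. Qed.

End row_norms.

(** * Volumes of boxes and projections of Hausdorff null sets *)

Section volume.
Variable R : realType.
Local Notation V n := 'rV[R]_n.

Definition box n (x : V n) (d : R) : set (V n) := [set y | forall i, `|y ord0 i - x ord0 i| <= d].

Lemma measurable_box n (x : V n) d : measurable (box x d).
Proof.
rewrite (_ : box x d = \bigcap_(i in [set: 'I_n])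
    (setT `&` row_coord i @^-1` `[x ord0 i - d, x ord0 i + d])).
  apply: fin_bigcap_measurable => // i _.
  by apply: measurable_row_coord => //; exact: measurable_itv.
apply/seteqP; split => y /= By i; first by split => //; rewrite /preimage/= in_itv/= -ler_distl; exact: By.
by have [//|_] := By i; rewrite /preimage/= in_itv/= -ler_distl; exact.
Qed.

Lemma lebesgue_row_box n (x : V n) d : 0 <= d ->
  lebesgue_row n (box x d) = ((2 * d) ^+ n)%:E.
Proof.
move=> d0; elim: n x => [|n IH] x /=.
  by rewrite diracE mem_set// => -[].
rewrite /lebesgue_row_next /pushforward.
rewrite (_ : _ @^-1` _ = `[x ord0 ord0 - d, x ord0 ord0 + d]%classic `*`
    box (\row_j x ord0 (lift ord0 j)) d).
  rewrite /prod_measure product_measure1E//=; last exact: measurable_box.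
  rewrite IH lebesgue_measure_itv/= lte_fin.
  have -> : (if x ord0 ord0 - d < x ord0 ord0 + d then
    ((x ord0 ord0 + d)%:E - (x ord0 ord0 - d)%:E)%E else 0%E) = (2 * d)%:E.
    case: ifPn => [_|]; first by rewrite -EFinB; congr EFin; ring.
    by rewrite -leNgt => h; congr EFin; lra.
  by rewrite -EFinM exprS.
apply/seteqP; split => -[z y] /=.
  move=> h; split; first by have := h ord0; rewrite row_cons0 /= in_itv/= -ler_distl.
  by move=> j; have := h (lift ord0 j); rewrite row_consS mxE.
move=> [/= xz By] i; case: (unliftP ord0 i) => [j|] ->.
  by rewrite row_consS; have := By j; rewrite mxE.
by rewrite row_cons0; move: xz; rewrite in_itv/= -ler_distl.
Qed.

Lemma open_box n (U : set (V n)) x : open U -> U x -> exists2 d, 0 < d & box x d `<=` U.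
Proof.
move=> oU Ux; have /nbhs_ballP[e /= e0 eU] : nbhs x U by apply: open_nbhs_nbhs.
exists (e / 2); first by rewrite divr_gt0.
move=> y By; apply: eU; rewrite mx_norm_ball /ball_ /=.
apply: (@le_lt_trans _ _ (e / 2)); last by rewrite ltr_pdivrMr// ltr_pMr// ltr1n.
apply/row_norm_leP; first by rewrite ltW// divr_gt0.
by move=> i; rewrite !mxE distrC.
Qed.

Lemma lebesgue_row_open_gt0 n (U : set (V n)) : open U -> U !=set0 ->
  (0 < lebesgue_row n U)%E.
Proof.
move=> oU [x Ux]; have [d d0 dU] := open_box oU Ux.
apply: (@lt_le_trans _ _ (lebesgue_row n (box x d))).
  by rewrite lebesgue_row_box ?ltW// lte_fin exprn_gt0// mulr_gt0.
by apply: le_measure; rewrite ?inE//; [exact: measurable_box|exact: open_measurable_row].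
Qed.

Lemma ae_row_meets n (U : set (V n)) (P : V n -> Prop) :
  open U -> U !=set0 -> (\forall x \ae lebesgue_row n, P x) -> exists2 x, U x & P x.
Proof.
move=> oU U0 [N [mN N0 PN]]; apply: contrapT => nUP.
have : (0 < lebesgue_row n U)%E by exact: lebesgue_row_open_gt0.
rewrite (@subset_measure0 _ _ _ _ U N)//; first by rewrite ltxx.
  exact: open_measurable_row.
by move=> x Ux; apply: PN => /= Px; apply: nUP; exists x.
Qed.

Lemma ae_itv_meets (a b : R) (P : R -> Prop) : a < b ->
  (\forall x \ae (@dt R), P x) -> exists2 x, a < x < b & P x.
Proof.
move=> ab [N [mN N0 PN]]; apply: contrapT => nUP.
have : (0 < @dt R `]a, b[%classic)%E.
  by rewrite /dt /= lebesgue_measure_itv/= lte_fin ab -EFinB lte_fin subr_gt0.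
rewrite (@subset_measure0 _ _ _ _ _ N)//; first by rewrite ltxx.
by move=> x; rewrite /= in_itv/= => Ux; apply: PN => /= Px; apply: nUP; exists x.
Qed.

Lemma enorm0 n : enorm (0 : V n) = 0.
Proof. by rewrite /enorm /dot big1 ?sqrtr0// => i _; rewrite mxE mul0r. Qed.

(** A covering set of diameter D projects into a box of half-side D, whose volume is at most a fixed
    multiple of the Hausdorff gauge of the set. *)
Lemma hausdorff_null_proj m (Z : set (V m.+2)) : hausdorff m.+1 Z = 0%E ->
  (lebesgue_row m.+1).-negligible [set y | exists z, Z (row_cons (z, y))].
Proof.
move=> Z0; apply: negligible_small_covers => e e0.
have [r r0 rB] : exists2 r : R, 0 < r & box (0 : V m.+1) r `<=` eball 0 1.
  apply: open_box; last by rewrite /eball/= subrr enorm0.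
  rewrite (_ : eball 0 1 = enorm @^-1` [set x | x < 1]).
    by apply: open_comp => // x _; exact: enorm_continuous.
  by apply/seteqP; split => x; rewrite /eball /= subr0.
pose w := (2 * r) ^+ m.+1; have w0 : 0 < w by rewrite exprn_gt0// mulr_gt0.
have wB : (w%:E <= lebesgue_row m.+1 (eball (0 : V m.+1) 1))%E.
  rewrite -(lebesgue_row_box 0 (ltW r0)); apply: le_measure; rewrite ?inE//.
    exact: measurable_box.
  apply: open_measurable_row; rewrite (_ : eball 0 1 = enorm @^-1` [set x | x < 1]).
    by apply: open_comp => // x _; exact: enorm_continuous.
  by apply/seteqP; split => x; rewrite /eball /= subr0.
(* Chosen so that c (2 D)^(m+1) = w (D / 2)^(m+1), which is at most the gauge, since w is a lower
   bound for the volume of the unit ball. Covers with diameters at most 1 are used, so all diameters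
   are finite. *)
pose c := w / 4 ^+ m.+1; have c0 : 0 < c by rewrite divr_gt0// exprn_gt0.
have : (hausdorff_pre m.+1 1 Z < (c * e)%:E)%E.
  apply: (@le_lt_trans _ _ 0%E); last by rewrite lte_fin mulr_gt0.
  by rewrite -[leRHS]Z0; apply: ereal_sup_ubound; exists 1 => //=.
move=> /ereal_inf_lt[_ [F [dF ZF] <-] Fe].
pose C k : set (V m.+1) := if pselect (F k !=set0) is left h then
   box (\row_j (projT1 (cid h)) ord0 (lift ord0 j)) (fine (diam (F k))) else set0.
have diamF k x y : F k x -> F k y -> enorm (x - y) <= fine (diam (F k)).
  move=> Fx Fy; rewrite -lee_fin fineK.
    by apply: ereal_sup_ubound; exists x => //; exists y.
  rewrite ge0_fin_numE ?(le_lt_trans (dF k)) ?ltry//.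
  apply: ereal_sup_ubound; exists x => //; exists x => //.
  by rewrite subrr enorm0.
exists C; split.
- by move=> k; rewrite /C; case: pselect => // h; exact: measurable_box.
- move=> y [z /ZF[k _ Fk]]; exists k => //; rewrite /C; case: pselect; last first.
    by case; exists (row_cons (z, y)).
  move=> h; case: cid => x /= Fx i; rewrite mxE -(row_consS z).
  apply: le_trans (diamF k _ _ Fk Fx); apply: le_trans (coord_le_enorm _ (lift ord0 i)).
  by rewrite !mxE.
- rewrite -(@lee_pmul2l _ c%:E) ?lte_fin//.
  rewrite -nneseriesZl//= -EFinM; apply: ltW; apply: le_lt_trans Fe.
  apply: lee_nneseries => [k _ _|k _]; first by rewrite mule_ge0// lee_fin ltW.
  rewrite /C; case: pselect => [h|_]; last first.
    by rewrite measure0 mule0; exact: hausdorff_gauge_ge0.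
  have [x0 Fx0] := h.
  have d0 : 0 <= fine (diam (F k)).
    by apply: le_trans (diamF k _ _ Fx0 Fx0); exact: enorm_ge0.
  rewrite lebesgue_row_box// /hausdorff_gauge ifF; last first.
    by apply/negbTE/set0P.
  have dE : diam (F k) = (fine (diam (F k)))%:E.
    rewrite fineK// ge0_fin_numE ?(le_lt_trans (dF k)) ?ltry//.
    apply: ereal_sup_ubound; exists x0 => //; exists x0 => //.
    by rewrite subrr enorm0.
  move: (fine _) dE d0 => D -> D0.
  have -> : ((D%:E * (2^-1)%:E) ^+ m.+1 = ((D * 2^-1) ^+ m.+1)%:E)%E.
    by rewrite EFin_expe EFinM.
  apply: (@le_trans _ _ (w%:E * ((D * 2^-1) ^+ m.+1)%:E)%E); last first.
    by apply: lee_wpmul2r => //; rewrite lee_fin exprn_ge0// divr_ge0.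
  rewrite -[leRHS]EFinM -[leLHS]EFinM lee_fin /c le_eqVlt; apply/orP; left; apply/eqP.
  rewrite !exprMn exprVn (_ : 4 = 2 * 2 :> R) ?exprMn; last by rewrite -natrM.
  by field; rewrite expf_neq0.
Qed.

End volume.

(** * Null sets along rays and through collisions *)

Lemma ae_measurable_sub d (T : measurableType d) (R : realType)
    (mu : {measure set T -> \bar R}) (P : T -> Prop) :
  (\forall x \ae mu, P x) ->
  exists Q : set T, [/\ measurable Q, Q `<=` P & \forall x \ae mu, Q x].
Proof.
move=> [N [mN N0 PN]]; exists (~` N); split; first exact: measurableC.
- by move=> x nNx; apply: contrapT => nPx; apply: nNx; exact: PN.
- by exists N; split => // x /= /contrapT.
Qed.

(** The set is the zero set of the measure of the sections of the complement, a measurable function.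
    This allows [ae_prod] and [ae_swap] to act on properties that themselves contain an
    almost-everywhere quantifier. *)
Lemma measurable_ae_section d1 d2 (T1 : measurableType d1) (T2 : measurableType d2)
    (R : realType) (m2 : {sigma_finite_measure set T2 -> \bar R}) (S : set (T1 * T2)) :
  measurable S -> measurable [set x | \forall y \ae m2, S (x, y)].
Proof.
move=> mS; have mnS := measurableC mS.
rewrite (_ : [set _ | _] = (m2 \o xsection (~` S)) @^-1` [set 0%E]).
  rewrite -[X in measurable X]setTI.
  by apply: measurable_fun_xsection => //; exact: emeasurable_set1.
have E x : ~` [set y | S (x, y)] = xsection (~` S) x.
  by apply/seteqP; split => y; rewrite /xsection/= inE.
apply/seteqP; split => x /=.
  rewrite /almost_everywhere /prop_near1 /= /nbhs /= E => /negligibleP; apply.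
  exact: measurable_xsection.
move=> h; rewrite /prop_near1 /nbhs /= /almost_everywhere E; apply/negligibleP => //.
exact: measurable_xsection.
Qed.

Lemma measurable_pre d1 d2 (T1 : measurableType d1) (T2 : measurableType d2)
   (f : T1 -> T2) (A : set T2) :
  measurable_fun setT f -> measurable A -> measurable (f @^-1` A).
Proof. by move=> mf mA; rewrite -[X in measurable X]setTI; exact: mf. Qed.

Section lines.
Variable R : realType.
Notation leb := (@dt R).
Local Notation V n := 'rV[R]_n.
Local Notation TR := (measurableTypeR R).

Lemma ae_shift1 (a : R) (P : R -> Prop) :
  (\forall s \ae leb, P s) -> \forall s \ae leb, P (s + a).
Proof.
move=> aeP; have := @ae_affine R 1 a P (oner_neq0 _) aeP.
by apply: aeS => s; rewrite mul1r.
Qed.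

Lemma ae_shift_Rrow n (a : R) (b : V n) (P : TR * V n -> Prop) :
  (\forall p \ae (leb \x lebesgue_row n)%E, P p) ->
  \forall p \ae (leb \x lebesgue_row n)%E, P (p.1 + a, p.2 + b).
Proof.
move=> /ae_measurable_sub[Q [mQ QP aeQ]].
have mQ' : measurable ((fun p : TR * V n => (p.1 + a : TR, p.2 + b)) @^-1` Q).
  apply: measurable_pre => //; apply/measurable_fun_pairP; split => /=.
    exact: measurable_funD.
  exact: measurable_rowD.
have := @ae_prod _ _ _ _ R leb (lebesgue_row n) _ mQ'.
move=> H; apply: aeS (H _) => [p|]; first exact: QP.
have := ae_shift1 a (ae_xsection aeQ).
by apply: aeS => t; exact: ae_shift_row.
Qed.

Lemma ae_vsection n (P : TR * V n * V n -> Prop) :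
  (\forall z \ae (@dtdxdv R n), P z) ->
  exists Q : set (TR * V n * V n), [/\ measurable Q, Q `<=` P &
    \forall v \ae lebesgue_row n, \forall p \ae (leb \x lebesgue_row n)%E, Q (p, v)].
Proof.
move=> /ae_measurable_sub[Q [mQ QP aeQ]]; exists Q; split => //.
by apply/(@ae_swap _ _ _ _ R (prod_measure leb (lebesgue_row n)) (lebesgue_row n)) => //;
  exact: ae_xsection aeQ.
Qed.

Lemma measurable_line n d (X : measurableType d) (t s : X -> TR) (x v : X -> V n) :
  measurable_fun setT t -> measurable_fun setT s -> measurable_fun setT x ->
  measurable_fun setT v ->
  measurable_fun setT (fun p => (t p - s p : TR, x p - s p *: v p, v p)).
Proof.
move=> mt ms mx mv; apply/measurable_fun_pairP; split => //=.
apply/measurable_fun_pairP; split => /=; first exact: measurable_funB.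
by apply: measurable_rowB => //; exact: measurable_rowZ.
Qed.

(** For fixed s and v the map (t, x) to (t - s, x - s v) is a translation. The statement is thus
    clear with the quantifiers in the order s, v, (t, x), and measurability of S lets them be
    exchanged. *)
Lemma ae_line_interior n (P : TR * V n * V n -> Prop) :
  (\forall z \ae (@dtdxdv R n), P z) ->
  \forall z \ae (@dtdxdv R n), \forall s \ae leb,
    P (z.1.1 - s, z.1.2 - s *: z.2, z.2).
Proof.
move=> /ae_vsection[Q [mQ QP aeQ]].
pose S : set (TR * (TR * V n * V n)) := (fun p => (p.2.1.1 - p.1 : TR,
  p.2.1.2 - (p.1 : R) *: p.2.2, p.2.2)) @^-1` Q.
have mS : measurable S.
  apply: measurable_pre => //; apply: measurable_line => //.
  - by do 2 apply: measurableT_comp => //.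
  - by do 2 apply: measurableT_comp => //.
  - by apply: measurableT_comp => //.
suff H : \forall s \ae leb, \forall z \ae @dtdxdv R n, S (s, z).
  have /ae_swap : measurable S by [].
  move=> /(_ R leb (@dtdxdv R n))[/(_ H)+ _].
  by apply: aeS => z; apply: aeS => s; exact: QP.
apply: aeW => s.
have mSs : measurable [set z | S (s, z)].
  by have := measurable_xsection s mS; rewrite xsectionE.
apply: (@ae_prod _ _ _ _ R (prod_measure leb (lebesgue_row n)) (lebesgue_row n)
  [set z | S (s, z)] mSs).
apply/(@ae_swap _ _ _ _ R (prod_measure leb (lebesgue_row n)) (lebesgue_row n) _ mSs).
by move: aeQ; apply: aeS => v /(ae_shift_Rrow (- s) (- (s *: v))).
Qed.

(** The points with t = T form a null set, but for fixed v the pair (x, s) is a coordinate system of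
    (t, x)-space: s gives the time T - s by a reflection, and for fixed s the dependence on x is a
    translation. *)
Lemma ae_line_top n (T : R) (P : TR * V n * V n -> Prop) :
  (\forall z \ae (@dtdxdv R n), P z) ->
  \forall p \ae (@dxdv R n), \forall s \ae leb,
    P (T - s, p.1 - s *: p.2, p.2).
Proof.
move=> /ae_vsection[Q [mQ QP aeQ]].
pose S : set (V n * V n * TR) := (fun p => (T - p.2 : TR,
  p.1.1 - (p.2 : R) *: p.1.2, p.1.2)) @^-1` Q.
have mS : measurable S.
  apply: measurable_pre => //; apply: (@measurable_line _ _ _ (cst T)) => //.
  - exact: (measurableT_comp measurable_fst measurable_fst).
  - exact: (measurableT_comp measurable_snd measurable_fst).
suff H : \forall p \ae @dxdv R n, \forall s \ae leb, S (p, s).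
  by move: H; apply: aeS => p; apply: aeS => s; exact: QP.
have mS' := measurable_ae_section (@dt R) mS.
apply: (@ae_prod _ _ _ _ R (lebesgue_row n) (lebesgue_row n) _ mS').
apply/(@ae_swap _ _ _ _ R (lebesgue_row n) (lebesgue_row n) _ mS').
move: aeQ; apply: aeS => v aeQ.
have mSv : measurable [set p : V n * TR | S (p.1, v, p.2)].
  apply: (measurable_pre (f := fun p : V n * TR => (p.1, v, p.2)) _ mS).
  apply/measurable_fun_pairP; split => /=; last exact: measurable_snd.
  by apply/measurable_fun_pairP; split => /=; [exact: measurable_fst|exact: measurable_cst].
apply/(@ae_swap _ _ _ _ R (lebesgue_row n) leb _ mSv).
have := @ae_affine R (-1) T _ _ (ae_xsection aeQ).
rewrite oppr_eq0 oner_neq0 => /(_ isT).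
by apply: aeS => s; rewrite mulN1r addrC => /(ae_shift_row (- (s *: v))).
Qed.

End lines.

(** * Collisions respect null sets *)

Section collisions.
Variable R : realType.
Notation leb := (@dt R).
Local Notation V n := 'rV[R]_n.
Local Notation TR := (measurableTypeR R).

Definition dudw {n} : {sigma_finite_measure set (V n * V n)%type -> \bar R} :=
  prod_measure (lebesgue_row n) (sphere_measure n).

Section measurability.
Context {n : nat} d (X : measurableType d) (v u w : X -> V n).
Hypotheses (mv : measurable_fun setT v) (mu : measurable_fun setT u)
  (mw : measurable_fun setT w).

Let mc : measurable_fun setT (fun p => dot (u p - v p) (w p)).
Proof. by apply: measurable_dot => //; exact: measurable_rowB. Qed.

Lemma measurable_post_u : measurable_fun setT (fun p => post_u (v p) (u p) (w p)).
Proof. by apply: measurable_rowB => //; exact: measurable_rowZ. Qed.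

Lemma measurable_post_v : measurable_fun setT (fun p => post_v (v p) (u p) (w p)).
Proof. by apply: measurable_rowD => //; exact: measurable_rowZ. Qed.

End measurability.

(* In the variables (a, v) with a = u - v the postcollisional velocity is, for fixed
   a and w, a translate v + c a w of v. *)
Lemma ae_collision n (c : V n -> V n -> V n) (q : V n -> V n -> V n -> V n)
    (P : V n -> Prop) :
  (forall v u w, q v u w = v + c (u - v) w) ->
  measurable_fun setT (fun p : V n * (V n * V n) => q p.1 p.2.1 p.2.2) ->
  (\forall v \ae lebesgue_row n, P v) ->
  \forall v \ae lebesgue_row n, \forall p \ae (@dudw n), P (q v p.1 p.2).
Proof.
move=> qE mq /ae_measurable_sub[Q [mQ QP aeQ]].
pose S : set (V n * (V n * V n)) := [set p | Q (q p.1 p.2.1 p.2.2)].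
have mS : measurable S by exact: (measurable_pre mq mQ).
suff H : \forall v \ae lebesgue_row n, \forall p \ae (@dudw n), S (v, p).
  by move: H; apply: aeS => v; apply: aeS => p; exact: QP.
have Hw w : \forall v \ae lebesgue_row n, \forall u \ae lebesgue_row n, S (v, (u, w)).
  have m1 : measurable [set p : V n * V n | Q (p.2 + c p.1 w)].
    have mf : measurable_fun setT (fun p : V n * V n => (p.2, (p.1 + p.2, w))).
      apply/measurable_fun_pairP; split => /=; first exact: measurable_snd.
      apply/measurable_fun_pairP; split => /=; last exact: measurable_cst.
      by apply: measurable_rowD; [exact: measurable_fst|exact: measurable_snd].
    have := measurable_pre mf mS; congr (measurable _).
    by apply/seteqP; split => -[a v]; rewrite /S /= qE addrK.
  have H1 : \forall a \ae lebesgue_row n, \forall v \ae lebesgue_row n, Q (v + c a w).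
    by apply: aeW => a; exact: ae_shift_row.
  have /(ae_swap (lebesgue_row n) (lebesgue_row n) m1) := H1.
  apply: aeS => v /(ae_shift_row (- v)); apply: aeS => u.
  by rewrite /S /= qE.
pose S' : set (V n * (V n * V n)) := [set p | S (p.2.1, (p.2.2, p.1))].
have mS' : measurable S'.
  apply: (measurable_pre (f := fun p : V n * (V n * V n) => (p.2.1, (p.2.2, p.1))) _ mS).
  have m21 : measurable_fun setT (fun p : V n * (V n * V n) => p.2.1).
    exact: (measurableT_comp measurable_fst measurable_snd).
  have m22 : measurable_fun setT (fun p : V n * (V n * V n) => p.2.2).
    exact: (measurableT_comp measurable_snd measurable_snd).
  apply/measurable_fun_pairP; split => //=.
  by apply/measurable_fun_pairP; split => //=; exact: measurable_fst.
have H2 : \forall w \ae sphere_measure n,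
    \forall p \ae prod_measure (lebesgue_row n) (lebesgue_row n), S' (w, p).
  apply: aeW => w.
  have mw : measurable [set p | S' (w, p)].
    by have := measurable_xsection w mS'; rewrite xsectionE.
  by apply: (@ae_prod _ _ _ _ R (lebesgue_row n) (lebesgue_row n) _ mw); exact: Hw.
have /(ae_swap (sphere_measure n) (prod_measure (lebesgue_row n) (lebesgue_row n)) mS') := H2.
move=> /(ae_xsection (m1 := lebesgue_row n) (m2 := lebesgue_row n)).
apply: aeS => v H3.
have mv : measurable [set p | S (v, p)].
  by have := measurable_xsection v mS; rewrite xsectionE.
by apply: (@ae_prod _ _ _ _ R (lebesgue_row n) (sphere_measure n) _ mv).
Qed.

(** The velocities u, u' and v' all have the form v + c (u - v) w required by [ae_collision], with c
    a w equal to a, to a - (a . w) w and to (a . w) w. *)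
Lemma ae_post n (P : TR * V n * V n -> Prop) :
  (\forall z \ae (@dtdxdv R n), P z) ->
  \forall z \ae (@dtdxdv R n), \forall p \ae (@dudw n),
    [/\ P z, P (z.1, p.1), P (z.1, post_u z.2 p.1 p.2) & P (z.1, post_v z.2 p.1 p.2)].
Proof.
move=> /ae_measurable_sub[Q [mQ QP aeQ]].
pose S : set (TR * V n * V n * (V n * V n)) := [set p : TR * V n * V n * (V n * V n) |
  [/\ Q p.1, Q (p.1.1, p.2.1), Q (p.1.1, post_u p.1.2 p.2.1 p.2.2) &
      Q (p.1.1, post_v p.1.2 p.2.1 p.2.2)]].
have m11 : measurable_fun setT (fun p : TR * V n * V n * (V n * V n) => p.1.1).
  exact: (measurableT_comp measurable_fst measurable_fst).
have m12 : measurable_fun setT (fun p : TR * V n * V n * (V n * V n) => p.1.2).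
  exact: (measurableT_comp measurable_snd measurable_fst).
have m21 : measurable_fun setT (fun p : TR * V n * V n * (V n * V n) => p.2.1).
  exact: (measurableT_comp measurable_fst measurable_snd).
have m22 : measurable_fun setT (fun p : TR * V n * V n * (V n * V n) => p.2.2).
  exact: (measurableT_comp measurable_snd measurable_snd).
have mS : measurable S.
  rewrite (_ : S = (fst @^-1` Q `&` (fun p => (p.1.1, p.2.1)) @^-1` Q) `&`
    ((fun p => (p.1.1, post_u p.1.2 p.2.1 p.2.2)) @^-1` Q `&`
     (fun p => (p.1.1, post_v p.1.2 p.2.1 p.2.2)) @^-1` Q)); last first.
    by apply/seteqP; split => p; [case|move=> [[] + + []]].
  apply: measurableI; apply: measurableI; apply: (measurable_pre _ mQ);
    try exact: measurable_fst; apply/measurable_fun_pairP; split => //=.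
    exact: measurable_post_u.
  exact: measurable_post_v.
suff H : \forall z \ae (@dtdxdv R n), \forall p \ae (@dudw n), S (z, p).
  move: H; apply: aeS => z; apply: aeS => p [] /=; case: z => z1 z2 /=.
  by split; exact: QP.
have mS' := measurable_ae_section (@dudw n) mS.
apply: (@ae_prod _ _ _ _ R (prod_measure leb (lebesgue_row n)) (lebesgue_row n) _ mS').
have aeQ' : \forall z \ae (prod_measure leb (lebesgue_row n)),
  \forall v \ae lebesgue_row n, Q (z, v) by exact: (ae_xsection aeQ).
move: aeQ'; apply: aeS => z aeQz.
have mv : measurable_fun setT (fun p : V n * (V n * V n) => p.1) by exact: measurable_fst.
have mu : measurable_fun setT (fun p : V n * (V n * V n) => p.2.1).
  exact: (measurableT_comp measurable_fst measurable_snd).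
have mw : measurable_fun setT (fun p : V n * (V n * V n) => p.2.2).
  exact: (measurableT_comp measurable_snd measurable_snd).
have h1 : \forall v \ae @lebesgue_row R n, \forall p \ae (@dudw n), Q (z, p.1).
  exact: (@ae_collision n (fun a w => a) (fun v u w => u) (fun v => Q (z, v))
    (fun v u w => esym (subrKC _ _)) mu aeQz).
have h2 : \forall v \ae lebesgue_row n, \forall p \ae (@dudw n),
    Q (z, post_u v p.1 p.2).
  apply: (@ae_collision n (fun a w => a - dot a w *: w) (@post_u R n) (fun v => Q (z, v)) _
    (measurable_post_u mv mu mw) aeQz) => v u w.
  by rewrite /post_u addrA subrKC.
have h3 : \forall v \ae lebesgue_row n, \forall p \ae (@dudw n),
    Q (z, post_v v p.1 p.2).
  exact: (@ae_collision n (fun a w => dot a w *: w) (@post_v R n) (fun v => Q (z, v))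
    (fun v u w => erefl) (measurable_post_v mv mu mw) aeQz).
apply: aeS (aeAnd aeQz (aeAnd h1 (aeAnd h2 h3))) => v [Qv [{}h1 [{}h2 {}h3]]].
by apply: aeS (aeAnd h1 (aeAnd h2 h3)) => p [? [? ?]]; split.
Qed.

End collisions.

(** * Rays starting on a Lipschitz graph *)

Section side.
Variable R : realType.
Notation leb := (@dt R).
Local Notation V n := 'rV[R]_n.
Local Notation TR := (measurableTypeR R).

(* In the coordinates (w_0, w') given by y = (w_0, w' + w_0 a'/a_0) only w_0 is moved
   by y |-> y - gam y a, and it is moved by a 1/2-expanding map. *)
Lemma ae_shear_graph m (gam : V m.+1 -> R) (A : set (V m.+1)) (a : V m.+1) (L : R)
    (P : V m.+1 -> Prop) :
  measurable_fun setT gam -> measurable A -> 0 <= L ->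
  (forall y y', A y -> A y' -> `|gam y - gam y'| <= L * `|y - y'|) ->
  a ord0 ord0 != 0 -> L * `|a| <= 1/2 ->
  (\forall y \ae lebesgue_row m.+1, P y) ->
  \forall y \ae lebesgue_row m.+1, A y -> P (y - gam y *: a).
Proof.
move=> mgam mA L0 AL a0 La /ae_measurable_sub[Q [mQ QP aeQ]].
pose c : V m := \row_j (a ord0 (lift ord0 j) / a ord0 ord0).
pose sh (w : R) (y : V m) : V m.+1 := row_cons (w, y + w *: c).
have msh : measurable_fun setT (fun p : TR * V m => sh p.1 p.2).
  apply: measurableT_comp; first exact: measurable_row_cons.
  apply/measurable_fun_pairP; split => /=; first exact: measurable_fst.
  apply: measurable_rowD; first exact: measurable_snd.
  by apply: measurable_rowZ => //; exact: measurable_fst.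
have shE w y : a = a ord0 ord0 *: sh 1 0 /\ sh w y = row_cons (0, y) + w *: sh 1 0.
  split; apply/rowP => i; case: (unliftP ord0 i) => [j|] ->;
    rewrite !mxE ?liftK ?unlift_none /= ?mxE /=.
  - by field.
  - by rewrite mulr1.
  - by rewrite add0r mul1r.
  - by rewrite add0r mulr1.
have shift w y l : sh w y - l *: a = sh (w - l * a ord0 ord0) y.
  rewrite [in LHS](shE w y).1 [LHS]/= (shE w y).2 (shE (w - _) y).2.
  by rewrite scalerA -addrA -scalerBl.
have H1 : \forall w \ae leb, \forall y \ae lebesgue_row m, Q (sh w y).
  by move: (ae_row_cons aeQ); apply: aeS => w; exact: ae_shift_row.
have m1 : measurable [set p : TR * V m | Q (sh p.1 p.2)] by exact: (measurable_pre msh mQ).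
have /(ae_swap leb (lebesgue_row m) m1) H2 := H1.
pose S : set (V m.+1) := [set y | A y -> Q (y - gam y *: a)].
have mS : measurable S.
  rewrite (_ : S = ~` A `|` (fun y => y - gam y *: a) @^-1` Q).
    apply: measurableU; first exact: measurableC.
    apply: (measurable_pre _ mQ); apply: measurable_rowB => //.
    by apply: measurable_rowZ.
  apply/seteqP; split => y; rewrite /S /=.
    by have [Ay /(_ Ay)|nAy _] := pselect (A y); [right|left].
  by case.
have H3 : \forall y \ae lebesgue_row m, \forall w \ae leb, S (sh w y).
  move: H2; apply: aeS => y H2.
  pose B := [set w | A (sh w y)].
  (* When s varies, [sh s y] moves along a / a_0, so [gam] times a_0 is Lipschitz in s with constant
     L |a| <= 1/2; subtracted from the identity it leaves an expansion by at least 1/2. *)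
  have exB s s' : B s -> B s' -> 1/2 * `|s - s'| <=
      `|(s - gam (sh s y) * a ord0 ord0) - (s' - gam (sh s' y) * a ord0 ord0)|.
    move=> Bs Bs'; have := AL _ _ Bs Bs'.
    rewrite (shE s y).2 (shE s' y).2 opprD addrACA subrr add0r -scalerBl.
    rewrite -(shE s y).2 -(shE s' y).2.
    set g := gam _; set g' := gam _ => gL.
    have na : `|a| = `|a ord0 ord0| * `|sh 1 0| by rewrite {1}(shE 0 0).1 normrZ.
    have a0' : 0 < `|a ord0 ord0| by rewrite normr_gt0.
    have : `|(g - g') * a ord0 ord0| <= 1/2 * `|s - s'|.
      rewrite normrM; apply: (@le_trans _ _ (L * `|(s - s') *: sh 1 0| * `|a ord0 ord0|)).
        by rewrite ler_wpM2r.
      rewrite normrZ (_ : _ * _ * _ = L * `|a| * `|s - s'|); last by rewrite na; ring.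
      by rewrite ler_wpM2r.
    have := ler_normB (s - s') ((g - g') * a ord0 ord0).
    have := lerB_normD (s - s') (- ((g - g') * a ord0 ord0)).
    rewrite normrN.
    rewrite (_ : s - s' - (g - g') * a ord0 ord0 =
       s - g * a ord0 ord0 - (s' - g' * a ord0 ord0)); last by ring.
    move=> h1 h2 h3; lra.
  have half : 0 < 1/2 :> R by rewrite divr_gt0.
  have := ae_expanding half exB H2; apply: aeS => w h Aw.
  by rewrite shift; exact: h.
have m3 : measurable [set p : TR * V m | S (sh p.1 p.2)] by exact: (measurable_pre msh mS).
have /(ae_swap leb (lebesgue_row m) m3) H4 := H3.
suff H5 : \forall y \ae lebesgue_row m.+1, S y.
  by move: H5; apply: aeS => y Sy Ay; exact/QP/Sy.
apply: ae_of_row_cons => //; move: H4; apply: aeS => w.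
by move/(ae_shift_row (- (w *: c))); apply: aeS => y; rewrite /= /sh addrNK.
Qed.

(** A cone about the first axis that is narrow relative to graphs of Lipschitz constant L. The
    second coordinate must not vanish because it becomes the nonzero leading coordinate of the shear
    direction in [ae_shear_graph]. *)
Definition transverse m (L : R) (v : V m.+2) :=
  [/\ 0 < v ord0 ord0, v ord0 (lift ord0 ord0) != 0 &
      forall j, L * `|v ord0 (lift ord0 j)| <= 1/2 * v ord0 ord0].

(** Replace s by the height h = gam y - s v_0. With a = v' / v_0 the point of the line is (h, y -
    gam y a + h a), and for fixed h this is the shear of [ae_shear_graph] followed by a
    translation. *)
Lemma ae_graph_lines m (gam : V m.+1 -> R) (A : set (V m.+1)) (v : V m.+2) (L : R)
    (P : V m.+2 -> Prop) :
  measurable_fun setT gam -> measurable A -> 0 <= L ->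
  (forall y y', A y -> A y' -> `|gam y - gam y'| <= L * `|y - y'|) ->
  transverse L v ->
  (\forall x \ae lebesgue_row m.+2, P x) ->
  \forall y \ae lebesgue_row m.+1, A y -> \forall s \ae leb,
    P (row_cons (gam y, y) - s *: v).
Proof.
move=> mgam mA L0 AL [v0 v1 Lv] /ae_measurable_sub[Q [mQ QP aeQ]].
pose a : V m.+1 := (v ord0 ord0)^-1 *: \row_j v ord0 (lift ord0 j).
have a0 : a ord0 ord0 != 0 by rewrite !mxE mulf_neq0// invr_neq0// gt_eqF.
have La : L * `|a| <= 1/2.
  have [->|L1] := eqVneq L 0; first by rewrite mul0r divr_ge0.
  have {L1} L1 : 0 < L by rewrite lt_neqAle eq_sym L1.
  rewrite mulrC -ler_pdivlMr//; apply/row_norm_leP => [|j].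
    by rewrite !divr_ge0// ltW.
  rewrite !mxE normrM normfV (gtr0_norm v0) mulrC ler_pdivrMr//.
  by rewrite mulrAC ler_pdivlMr// mulrC.
have H1 := ae_row_cons aeQ.
pose S : set (TR * V m.+1) :=
  [set p | A p.2 -> Q (row_cons (p.1, p.2 - gam p.2 *: a + p.1 *: a))].
have mS : measurable S.
  have mf : measurable_fun setT (fun p : TR * V m.+1 =>
      row_cons (p.1, p.2 - gam p.2 *: a + p.1 *: a)).
    apply: measurableT_comp; first exact: measurable_row_cons.
    apply/measurable_fun_pairP; split => /=; first exact: measurable_fst.
    apply: measurable_rowD; last first.
      by apply: measurable_rowZ; [exact: measurable_fst|exact: measurable_cst].
    apply: measurable_rowB; first exact: measurable_snd.
    apply: measurable_rowZ; last exact: measurable_cst.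
    by apply: measurableT_comp => //; exact: measurable_snd.
  have -> : S = ~` (snd @^-1` A) `|` (fun p : TR * V m.+1 =>
      row_cons (p.1, p.2 - gam p.2 *: a + p.1 *: a)) @^-1` Q.
    apply/seteqP; split => p; rewrite /S /=.
      by have [Ay /(_ Ay)|nAy _] := pselect (A p.2); [right|left].
    by case.
  apply: measurableU; last exact: measurable_pre mQ.
  by apply: measurableC; apply: (measurable_pre _ mA); exact: measurable_snd.
have H2 : \forall h \ae leb, \forall y \ae lebesgue_row m.+1, S (h, y).
  move: H1; apply: aeS => h /(ae_shift_row (h *: a)).
  move/(ae_shear_graph mgam mA L0 AL a0 La); apply: aeS => y H Ay.
  exact: H.
have /(ae_swap leb (lebesgue_row m.+1) mS) H3 := H2.
move: H3; apply: aeS => y H3 Ay.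
have := @ae_affine R (- v ord0 ord0) (gam y) _ _ H3.
rewrite oppr_eq0 gt_eqF// => /(_ isT); apply: aeS => s /(_ Ay) /QP.
congr P; apply/rowP => i; case: (unliftP ord0 i) => [j|] ->;
  rewrite !mxE ?liftK ?unlift_none /= ?mxE /=; last by ring.
by field; rewrite gt_eqF.
Qed.

Lemma ae_line_side m (gam : V m.+1 -> R) (A : set (V m.+1)) (D : set (V m.+2)) (L : R)
    (P : TR * V m.+2 * V m.+2 -> Prop) :
  measurable_fun setT gam -> measurable A -> measurable D -> 0 <= L ->
  (forall y y', A y -> A y' -> `|gam y - gam y'| <= L * `|y - y'|) ->
  (forall v, D v -> transverse L v) ->
  (\forall z \ae (@dtdxdv R m.+2), P z) ->
  \forall y \ae lebesgue_row m.+1, \forall t \ae leb,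
  \forall v \ae lebesgue_row m.+2, A y -> D v -> \forall s \ae leb,
    P (t - s, row_cons (gam y, y) - s *: v, v).
Proof.
move=> mgam mA mD L0 AL DL /ae_vsection[Q [mQ QP aeQ]].
pose X y := row_cons (gam y, y).
have mX : measurable_fun setT (X : V m.+1 -> V m.+2).
  apply: measurableT_comp; first exact: measurable_row_cons.
  by apply/measurable_fun_pairP; split => /=; [exact: mgam|exact: measurable_id].
(* parameters (((y, t), v), s) *)
pose S : set (V m.+1 * TR * V m.+2 * TR) :=
  [set p | A p.1.1.1 -> D p.1.2 -> Q (p.1.1.2 - p.2, X p.1.1.1 - (p.2 : R) *: p.1.2, p.1.2)].
pose PT := (V m.+1 * TR * V m.+2 * TR)%type.
have my : measurable_fun setT (fun p : PT => p.1.1.1).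
  exact: (measurableT_comp measurable_fst (measurableT_comp measurable_fst measurable_fst)).
have mt : measurable_fun setT (fun p : PT => p.1.1.2).
  exact: (measurableT_comp measurable_snd (measurableT_comp measurable_fst measurable_fst)).
have mv : measurable_fun setT (fun p : PT => p.1.2).
  exact: (measurableT_comp measurable_snd measurable_fst).
have ms : measurable_fun setT (fun p : PT => p.2) by exact: measurable_snd.
have mS : measurable S.
  have -> : S = ~` ((fun p : PT => p.1.1.1) @^-1` A) `|` ~` ((fun p : PT => p.1.2) @^-1` D) `|`
     (fun p : PT => (p.1.1.2 - p.2, X p.1.1.1 - (p.2 : R) *: p.1.2, p.1.2)) @^-1` Q.
    apply/seteqP; split => p; rewrite /S /=.
      have [Ay /(_ Ay)|nAy _] := pselect (A p.1.1.1); last by left; left.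
      by have [Dv /(_ Dv)|nDv _] := pselect (D p.1.2); [right|left; right].
    by case=> [[]|].
  apply: measurableU.
    by apply: measurableU; apply: measurableC; apply: measurable_pre.
  by apply: (measurable_pre _ mQ); apply: measurable_line => //; exact: measurableT_comp mX my.
suff H : \forall y \ae lebesgue_row m.+1, \forall t \ae leb,
    \forall v \ae lebesgue_row m.+2, \forall s \ae leb, S (((y, t), v), s).
  move: H; apply: aeS => y; apply: aeS => t; apply: aeS => v H Ay Dv.
  by move: H; apply: aeS => s /(_ Ay Dv) /QP.
have mS1 : measurable [set p | \forall s \ae leb, S (p, s)] := measurable_ae_section (@dt R) mS.
suff H : \forall v \ae lebesgue_row m.+2, \forall y \ae lebesgue_row m.+1,
    \forall t \ae leb, \forall s \ae leb, S (((y, t), v), s).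
  have [_ H'] := ae_swap (prod_measure (lebesgue_row m.+1) leb) (lebesgue_row m.+2) mS1.
  have /(ae_xsection (m1 := lebesgue_row m.+1) (m2 := leb)) : 
    \forall p \ae prod_measure (lebesgue_row m.+1) leb,
    \forall v \ae lebesgue_row m.+2, \forall s \ae leb, S (p, v, s).
    apply: H'; move: H; apply: aeS => v Hv.
    have mSv : measurable [set p | \forall s \ae leb, S (p, v, s)].
      by have := measurable_ysection v mS1; rewrite ysectionE.
    exact: (@ae_prod _ _ _ _ R (lebesgue_row m.+1) leb _ mSv).
  exact.
move: aeQ; apply: aeS => v Qv.
have [Dv|nDv] := pselect (D v); last first.
  apply: aeW => y; apply: aeW => t; apply: aeW => s.
  by rewrite /S /=.
have mst (f : V m.+1 * TR * TR -> PT) : measurable_fun setT f ->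
  measurable (f @^-1` S) by move=> mf; exact: (measurable_pre mf mS).
have H1 : \forall t \ae leb, \forall y \ae lebesgue_row m.+1, A y ->
    \forall s \ae leb, Q (t, X y - s *: v, v).
  by move: (ae_xsection Qv); apply: aeS => t; exact: (ae_graph_lines mgam mA L0 AL (DL _ Dv)).
(* The time in W is that of the point on the ray. With s in front of it, the boundary time t is
   recovered at the end by a translation. *)
pose W : set (TR * (V m.+1 * TR)) :=
  [set p | A p.2.1 -> Q (p.1, X p.2.1 - (p.2.2 : R) *: v, v)].
have mW : measurable W.
  have -> : W = ~` ((fun p : TR * (V m.+1 * TR) => p.2.1) @^-1` A) `|`
     (fun p : TR * (V m.+1 * TR) => (p.1, X p.2.1 - (p.2.2 : R) *: v, v)) @^-1` Q.
    apply/seteqP; split => p; rewrite /W /=.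
      by have [Ay /(_ Ay)|nAy _] := pselect (A p.2.1); [right|left].
    by case.
  have m21 : measurable_fun setT (fun p : TR * (V m.+1 * TR) => p.2.1).
    exact: (measurableT_comp measurable_fst measurable_snd).
  have m22 : measurable_fun setT (fun p : TR * (V m.+1 * TR) => p.2.2).
    exact: (measurableT_comp measurable_snd measurable_snd).
  apply: measurableU; first by apply: measurableC; exact: (measurable_pre m21 mA).
  apply: (measurable_pre _ mQ).
  apply/measurable_fun_pairP; split => /=; last exact: measurable_cst.
  apply/measurable_fun_pairP; split => /=; first exact: measurable_fst.
  apply: measurable_rowB; first exact: measurableT_comp mX m21.
  by apply: measurable_rowZ => //; exact: measurable_cst.
have H2 : \forall t \ae leb, \forall p \ae prod_measure (lebesgue_row m.+1) leb, W (t, p).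
  move: H1; apply: aeS => t H1.
  have mWt : measurable [set p | W (t, p)].
    by have := measurable_xsection t mW; rewrite xsectionE.
  apply: (@ae_prod _ _ _ _ R (lebesgue_row m.+1) leb _ mWt).
  move: H1; apply: aeS => y H1; rewrite /W /=.
  have [Ay|nAy] := pselect (A y); last by apply: aeW.
  by move: (H1 Ay); apply: aeS.
have /(ae_swap leb (prod_measure (lebesgue_row m.+1) leb) mW) H3 := H2.
have H4 : \forall y \ae lebesgue_row m.+1, \forall s \ae leb, \forall t \ae leb, W (t, (y, s)).
  exact: (ae_xsection (m1 := lebesgue_row m.+1) (m2 := leb) H3).
move: H4; apply: aeS => y H4.
have mSy : measurable [set p : TR * TR | S (y, p.1, v, p.2)].
  apply: (measurable_pre (f := fun p : TR * TR => (y, p.1, v, p.2)) _ mS).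
  apply/measurable_fun_pairP; split => /=; last exact: measurable_snd.
  apply/measurable_fun_pairP; split => /=; last exact: measurable_cst.
  by apply/measurable_fun_pairP; split => /=; [exact: measurable_cst|exact: measurable_fst].
apply/(ae_swap leb leb mSy); move: H4; apply: aeS => s /(ae_shift1 (- s)).
by apply: aeS => t; rewrite /W /S /= => H Ay _; exact: H.
Qed.

End side.

(** * The collision integral *)

(* The library's congruence of integrals almost everywhere asks for measurable
   integrands; representatives of elements of L^oo need not be measurable. *)
Section integral_congruence.
Context d (T : measurableType d) (R : realType) (mu : {measure set T -> \bar R}).

Import HBNNSimple.

Let ge0_le_integral_ae (f g : T -> \bar R) :
  (forall x, 0 <= f x)%E -> (forall x, 0 <= g x)%E ->
  (\forall x \ae mu, f x = g x) -> (\int[mu]_x f x <= \int[mu]_x g x)%E.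
Proof.
move=> f0 g0 [N [mN N0 fgN]].
have mNc := measurableC mN.
rewrite !ge0_integralTE//; apply: ge_ereal_sup => _ [h hf <-].
(* Setting h to 0 on the null set does not change its integral and puts it below g everywhere. *)
pose h' := mul_nnsfun h (indic_nnsfun R mNc).
have h'E x : h' x = h x * \1_(~` N) x by [].
have -> : sintegral mu h = sintegral mu h'.
  rewrite -!integralT_nnsfun; apply: ae_eq_integral => //.
  - by apply/measurable_EFinP.
  - by apply/measurable_EFinP.
  - exists N; split => // x /= h1; apply: contrapT => nNx; apply: h1 => _.
    by rewrite -[RHS]/((h x * \1_(~` N) x)%:E) indicE mem_set// mulr1.
apply: ereal_sup_ubound; exists h' => // x.
rewrite h'E indicE; have [Nx|nNx] := pselect (N x).
  by rewrite memNset ?mulr0// => /(_ Nx).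
rewrite mem_set// mulr1; apply: (le_trans (hf x)).
by rewrite le_eqVlt; apply/orP; left; apply/eqP; apply: contrapT => fgx; apply: nNx; exact: fgN.
Qed.

Lemma ge0_integral_ae (f g : T -> \bar R) :
  (forall x, 0 <= f x)%E -> (forall x, 0 <= g x)%E ->
  (\forall x \ae mu, f x = g x) -> (\int[mu]_x f x = \int[mu]_x g x)%E.
Proof.
move=> f0 g0 fg; apply/eqP; rewrite eq_le !ge0_le_integral_ae//.
by move: fg; apply: aeS => x ->.
Qed.

Lemma integral_ae (D : set T) (f g : T -> \bar R) :
  (\forall x \ae mu, D x -> f x = g x) ->
  (\int[mu]_(x in D) f x = \int[mu]_(x in D) g x)%E.
Proof.
move=> fg; rewrite (integral_mkcond D f) (integral_mkcond D g).
have E : \forall x \ae mu, (f \_ D) x = (g \_ D) x.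
  by move: fg; apply: aeS => x; rewrite /patch; case: ifPn => //; rewrite inE => Dx; exact.
rewrite integralE [RHS]integralE; congr (_ - _)%E; apply: ge0_integral_ae => //.
  by move: E; apply: aeS => x E; rewrite !funeposE E.
by move: E; apply: aeS => x E; rewrite !funenegE E.
Qed.

Lemma Rintegral_ae (D : set T) (f g : T -> R) :
  (\forall x \ae mu, D x -> f x = g x) ->
  \int[mu]_(x in D) f x = \int[mu]_(x in D) g x.
Proof.
move=> fg; congr fine; apply: integral_ae.
by move: fg; apply: aeS => x /[swap] Dx ->.
Qed.

End integral_congruence.

Section integral_bounds.
Context d (T : measurableType d) (R : realType) (mu : {measure set T -> \bar R}).

Lemma integrable_weight (k h : T -> R) (c : R) :
  mu.-integrable setT (EFin \o k) -> measurable_fun setT h ->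
  (forall x, `|h x| <= c) ->
  mu.-integrable setT (EFin \o (fun x => k x * h x)).
Proof.
move=> ik mh hc.
have mk : measurable_fun setT k by apply/measurable_EFinP; exact: measurable_int ik.
apply: (@le_integrable _ _ _ mu setT measurableT _ (fun x => c%:E * (k x)%:E)%E).
- by apply/measurable_EFinP; exact: measurable_funM.
- move=> x _ /=; rewrite lee_fin !normrM mulrC ler_wpM2r//.
  by apply: (le_trans (hc x)); exact: ler_norm.
- exact: integrableZl.
Qed.

Lemma le_Rintegral_weight (k h : T -> R) (c M : R) :
  mu.-integrable setT (EFin \o k) -> measurable_fun setT h ->
  0 <= c -> (forall x, `|h x| <= c) -> (\int[mu]_x `|k x|%:E <= M%:E)%E ->
  `| \int[mu]_x (k x * h x) | <= c * M.
Proof.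
move=> ik mh c0 hc kM.
have mk : measurable_fun setT k by apply/measurable_EFinP; exact: measurable_int ik.
have i1 := integrable_weight ik mh hc.
rewrite -lee_fin EFin_normr_Rintegral//.
apply: (le_trans (le_abse_integral mu measurableT (measurable_int _ i1))) => /=.
apply: (@le_trans _ _ (\int[mu]_x (c%:E * `|k x|%:E))%E).
  apply: ge0_le_integral => //.
  - by apply/measurable_EFinP; apply: measurableT_comp => //; exact: measurable_funM.
  - by apply: measurable_funeM; apply/measurable_EFinP; exact: measurableT_comp.
  - by move=> x _; rewrite -EFinM lee_fin normrM mulrC ler_wpM2r.
rewrite ge0_integralZl_EFin//; last by apply/measurable_EFinP; exact: measurableT_comp.
by rewrite EFinM lee_wpmul2l.
Qed.

Lemma Rintegral_ae_bound (D : set T) (f : T -> R) (c : R) :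
  measurable D -> (mu D < +oo)%E -> measurable_fun setT f -> 0 <= c ->
  (\forall x \ae mu, D x -> `|f x| <= c) ->
  mu.-integrable D (EFin \o f) /\ `| \int[mu]_(x in D) f x | <= c * fine (mu D).
Proof.
move=> mD muD mf c0 fc.
have mDf : measurable_fun D (EFin \o f).
  by apply/measurable_EFinP; exact: measurable_funTS.
have b : (\int[mu]_(x in D) `|(f x)%:E| <= c%:E * mu D)%E.
  by apply: integral_le_bound.
have muDf : mu D \is a fin_num by rewrite ge0_fin_numE.
have i : mu.-integrable D (EFin \o f).
  apply/integrableP; split => //; apply: (le_lt_trans b).
  by rewrite -(fineK muDf) -EFinM ltry.
split => //; rewrite -lee_fin EFin_normr_Rintegral//.
by apply: (le_trans (le_abse_integral mu mD mDf)); rewrite EFinM fineK.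
Qed.

End integral_bounds.

Section Rfubini.
Context d1 d2 (T1 : measurableType d1) (T2 : measurableType d2) (R : realType)
  (m1 : {sigma_finite_measure set T1 -> \bar R})
  (m2 : {sigma_finite_measure set T2 -> \bar R}).

Lemma Rintegral_fubini (k : T1 * T2 -> R) :
  (prod_measure m1 m2).-integrable setT (EFin \o k) ->
  \int[m1]_x \int[m2]_y k (x, y) = \int[prod_measure m1 m2]_p k p.
Proof.
move=> ik; rewrite /Rintegral; congr fine.
have /= <- := @integral12_prod_meas1 _ _ _ _ R m1 m2 (EFin \o k) ik.
apply: integral_ae; have := @ae_integrable1 _ _ _ _ R m1 m2 (EFin \o k) ik.
apply: aeS => x ix _; rewrite fineK//.
exact: (integrable_fin_num measurableT ix).
Qed.

End Rfubini.

Lemma Lnorm_oo_le d (T : measurableType d) (R : realType) (mu : {measure set T -> \bar R})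
    (f : T -> \bar R) (y : \bar R) :
  ('N[mu]_+oo[f] <= y)%E -> \forall x \ae mu, (`|f x| <= y)%E.
Proof.
rewrite unlock; case: ifPn => [_ /ess_supP//|]; rewrite -leNgt measure_le0 => /eqP mu0 _.
exact: measure0_ae.
Qed.

Lemma Linf_norm_ae d (T : measurableType d) (R : realType) (mu : {measure set T -> \bar R})
    (D : set T) (f : T -> R) (c : R) :
  (Linf_norm mu D f <= c%:E)%E -> \forall x \ae mu, D x -> `|f x| <= c.
Proof.
move=> /Lnorm_oo_le; apply: aeS => x; rewrite /= /patch => + Dx.
by rewrite mem_set// lee_fin.
Qed.

Lemma Linf_norm_le d (T : measurableType d) (R : realType) (mu : {measure set T -> \bar R})
    (D : set T) (f : T -> R) (c : R) : 0 <= c ->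
  (forall x, D x -> `|f x| <= c) -> (Linf_norm mu D f <= c%:E)%E.
Proof.
move=> c0 fc; rewrite /Linf_norm unlock; case: ifPn => [_|]; last by rewrite lee_fin.
apply/ess_supP; apply: aeW => x; rewrite /= /patch lee_fin.
by case: ifPn => [|_]; rewrite ?normr0// inE => /fc.
Qed.

Lemma Linf_bounded d (T : measurableType d) (R : realType) (mu : {measure set T -> \bar R})
    (D : set T) (f : T -> R) (c : R) : measurable_fun setT f ->
  (forall x, `|f x| <= c) -> Linf mu D f.
Proof.
move=> mf fc; exists f; last exact: aeW.
rewrite inE /=; apply/andP; split; rewrite inE //=.
have c0 : 0 <= `|c| by [].
have := @Linf_norm_le _ T R mu setT f `|c| c0 (fun x _ => le_trans (fc x) (ler_norm c)).
rewrite /Linf_norm patch_setT /finite_norm => h.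
by apply: le_lt_trans h _; rewrite ltry.
Qed.

Section collision_integral.
Context {R : realType} {n : nat}.
Local Notation V := 'rV[R]_n.
Local Notation TR := (measurableTypeR R).
Local Notation Z := (TR * V * V)%type.
Local Notation muw := (@dudw R n).

Lemma ae_row_neq0 : (0 < n)%N -> \forall v \ae @lebesgue_row R n, v != 0.
Proof.
move=> n0; exists (box 0 0); split; first exact: measurable_box.
  by rewrite lebesgue_row_box// mulr0 expr0n gtn_eqF.
move=> v /= /negP; rewrite negbK => /eqP -> i.
by rewrite subrr normr0.
Qed.

Definition coll (G : Z -> R) (z : Z) (p : V * V) : R :=
  G (z.1, post_u z.2 p.1 p.2) * G (z.1, post_v z.2 p.1 p.2) - G (z.1, p.1) * G z.

(** A single integral against the product measure takes the place of the iterated integral in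
    [Q]. *)
Definition qint (kh : Z * (V * V) -> R) (G : Z -> R) (z : Z) : R :=
  \int[muw]_p (kh (z, p) * coll G z p).

(** As [kh] vanishes off the sphere, the integration over the sphere extends to the whole space; as
    it vanishes off the cylinder, rays may be continued beyond the boundary. The velocity 0 is
    excluded because the potentials are given only for r > 0. *)
Definition kernel_rep (Om : set V) (T : R) (K : R * V * V * V * V -> R)
    (kh : Z * (V * V) -> R) :=
  [/\ measurable_fun setT kh,
    forall z p, cylinder T (phase_space Om) z -> z.2 != 0 -> sphere p.2 ->
      kh (z, p) = K (z, p.1, p.2),
    forall z p, ~ sphere p.2 -> kh (z, p) = 0 &
    forall z p, ~ cylinder T (phase_space Om) z -> kh (z, p) = 0].

Definition kernel_mass_le (kh : Z * (V * V) -> R) (M : R) :=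
  \forall z \ae @dtdxdv R n, (\int[muw]_p `|kh (z, p)|%:E <= M%:E)%E.

Lemma measurable_coll G : measurable_fun setT G ->
  measurable_fun setT (fun zp : Z * (V * V) => coll G zp.1 zp.2).
Proof.
move=> mG.
pose ZP := (Z * (V * V))%type.
have m11 : measurable_fun setT (fun p : ZP => p.1.1).
  exact: (measurableT_comp measurable_fst measurable_fst).
have m12 : measurable_fun setT (fun p : ZP => p.1.2).
  exact: (measurableT_comp measurable_snd measurable_fst).
have m21 : measurable_fun setT (fun p : ZP => p.2.1).
  exact: (measurableT_comp measurable_fst measurable_snd).
have m22 : measurable_fun setT (fun p : ZP => p.2.2).
  exact: (measurableT_comp measurable_snd measurable_snd).
have mGv (f : ZP -> V) : measurable_fun setT f ->
    measurable_fun setT (fun p : ZP => G (p.1.1, f p)).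
  by move=> mf; apply: measurableT_comp => //; apply/measurable_fun_pairP; split.
apply: measurable_funB; apply: measurable_funM.
- by apply: mGv; exact: measurable_post_u.
- by apply: mGv; exact: measurable_post_v.
- exact: mGv.
- by apply: measurableT_comp => //; exact: measurable_fst.
Qed.

Lemma measurable_Rintegral2 (k : Z * (V * V) -> R) : measurable_fun setT k ->
  measurable_fun setT (fun z => \int[muw]_p k (z, p)).
Proof.
move=> mk.
have mke : measurable_fun setT (EFin \o k) by exact/measurable_EFinP.
rewrite /Rintegral; apply: measurableT_comp => //.
rewrite (_ : (fun _ => _) = (fun z => \int[muw]_p ((EFin \o k)^\+ (z, p)) -
   \int[muw]_p ((EFin \o k)^\- (z, p)))%E); last first.
  apply/funext => z; rewrite integralE.
  by congr (_ - _)%E; apply: eq_integral => p _; rewrite ?funeposE ?funenegE.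
apply: emeasurable_funB.
  apply: (measurable_fun_fubini_tonelli_F (m2 := @dudw R n) ((EFin \o k)^\+)%E) => //.
  exact: measurable_funepos.
apply: (measurable_fun_fubini_tonelli_F (m2 := @dudw R n) ((EFin \o k)^\-)%E) => //.
exact: measurable_funeneg.
Qed.

Lemma measurable_qint kh G : measurable_fun setT kh -> measurable_fun setT G ->
  measurable_fun setT (qint kh G).
Proof.
move=> mk mG; apply: (@measurable_Rintegral2 (fun zp => kh zp * coll G zp.1 zp.2)).
by apply: measurable_funM => //; exact: measurable_coll.
Qed.

Lemma measurable_section1 d1 d2 d3 (T1 : measurableType d1) (T2 : measurableType d2)
    (T3 : measurableType d3) (f : T1 * T2 -> T3) x :
  measurable_fun setT f -> measurable_fun setT (fun y => f (x, y)).
Proof.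
by move=> mf; apply: measurableT_comp.
Qed.

Section rep.
Variables (Om : set V) (T : R) (K : R * V * V * V * V -> R) (kh : Z * (V * V) -> R) (M : R).
Hypothesis repK : kernel_rep Om T K kh.
Notation U := (cylinder T (phase_space Om)).

Lemma kernel_mass : (0 < n)%N -> 0 <= M -> (kernel_norm Om T K <= M%:E)%E ->
  kernel_mass_le kh M.
Proof.
move=> n0 M0 /Lnorm_oo_le H.
have [mk khK kh0 khU] := repK.
have v0 : \forall z \ae (@dtdxdv R n), z.2 != 0.
  have := @ae_prod _ _ _ _ R (prod_measure (@dt R) (lebesgue_row n)) (lebesgue_row n)
    [set z | z.2 != 0].
  apply; last by apply: aeW => z; exact: ae_row_neq0.
  rewrite (_ : [set _ | _] = snd @^-1` ~` (box 0 0)).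
    by apply: measurable_pre; [exact: measurable_snd|apply: measurableC; exact: measurable_box].
  apply/seteqP; split => z /= h.
    move=> b; move/eqP: h; apply; apply/rowP => i; have := b i.
    by rewrite !mxE subr0 normr_le0 => /eqP.
  by apply/eqP => z0; apply: h => i; rewrite z0 subrr normr0.
apply: aeS (aeAnd H v0) => z [{}H {}v0].
have [Uz|nUz] := pselect (U z); last first.
  rewrite integral0_eq ?lee_fin// => p _.
  by rewrite khU// normr0.
move: H; rewrite /patch mem_set//.
set A := (X in (`|X|%E <= _)%E -> _); set B := (X in _ -> (X <= _)%E).
suff -> : A = B by rewrite gee0_abs//; apply: integral_ge0 => p _.
rewrite /A /B.
have mkz : measurable_fun setT (fun p => kh (z, p)) by exact: measurable_section1.
have mk' : measurable_fun setT (fun p => `|kh (z, p)|%:E).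
  by apply/measurable_EFinP; apply: measurableT_comp.
have f0 p : (0 <= `|kh (z, p)|%:E)%E by rewrite lee_fin.
have E := @fubini_tonelli1 _ _ _ _ R (lebesgue_row n) (sphere_measure n) _ mk' f0.
apply: etrans (esym E).
apply: eq_integral => u _; rewrite /fubini_F [LHS]integral_mkcond.
apply: eq_integral => w _; rewrite /patch; case: ifPn.
  by rewrite inE => sw; rewrite khK.
by rewrite notin_setE => sw; rewrite kh0// normr0.
Qed.

(** F may fail to be measurable, so Fubini is applied to G, and the iterated integrals are then
    compared one variable at a time by [Rintegral_ae]. *)
Lemma Q_qint (F G : Z -> R) z : U z -> z.2 != 0 ->
  (\forall p \ae muw, coll F z p = coll G z p) ->
  muw.-integrable setT (EFin \o (fun p => kh (z, p) * coll G z p)) ->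
  Q K F F z = qint kh G z.
Proof.
move=> Uz z0 FG ik; have [mk khK kh0 khU] := repK.
rewrite /qint /dudw -(Rintegral_fubini ik).
case: z Uz z0 FG ik => -[t x] v Uz z0 FG ik; rewrite /Q.
apply: Rintegral_ae.
have := @ae_xsection _ _ _ _ R (lebesgue_row n) (sphere_measure n) _ FG.
apply: aeS => u {}FG _; rewrite Rintegral_mkcond; apply: Rintegral_ae.
move: FG; apply: aeS => w {}FG _; rewrite /patch; case: ifPn.
  by rewrite inE => sw; rewrite -FG khK.
by rewrite notin_setE => sw; rewrite kh0// mul0r.
Qed.

End rep.

Lemma coll_bound (G : Z -> R) (b : R) z p : (forall z, `|G z| <= b) ->
  `|coll G z p| <= 2 * b ^+ 2.
Proof.
move=> Gb; have b0 : 0 <= b by exact: le_trans (Gb z).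
apply: (le_trans (ler_normB _ _)); rewrite !normrM mulr_natl mulr2n expr2.
by apply: lerD; apply: ler_pM.
Qed.

Section qint_estimates.
Variables (kh : Z * (V * V) -> R) (M : R) (z : Z).
Implicit Types G : Z -> R.
Hypotheses (mk : measurable_fun setT kh)
  (kM : (\int[muw]_p `|kh (z, p)|%:E <= M%:E)%E).

Lemma kernel_integrable : muw.-integrable setT (EFin \o (fun p => kh (z, p))).
Proof.
apply/integrableP; split; last by rewrite (le_lt_trans kM)// ltry.
by apply/measurable_EFinP; exact: measurable_section1.
Qed.

Lemma measurable_coll1 G : measurable_fun setT G -> measurable_fun setT (coll G z).
Proof. by move=> /measurable_coll/(measurable_section1 z). Qed.

Lemma qint_integrable G b : measurable_fun setT G -> (forall z, `|G z| <= b) ->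
  muw.-integrable setT (EFin \o (fun p => kh (z, p) * coll G z p)).
Proof.
move=> mG Gb; apply: (integrable_weight (c := 2 * b ^+ 2)).
- exact: kernel_integrable.
- exact: measurable_coll1.
- by move=> p; exact: coll_bound.
Qed.

Lemma qint_bound G b : measurable_fun setT G -> 0 <= b -> (forall z, `|G z| <= b) ->
  `|qint kh G z| <= 2 * b ^+ 2 * M.
Proof.
move=> mG b0 Gb; apply: le_Rintegral_weight => //.
- exact: kernel_integrable.
- exact: measurable_coll1.
- by rewrite mulr_ge0// exprn_ge0.
- by move=> p; exact: coll_bound.
Qed.

(** A difference of products is (a - a') d + a' (d - d'), which is at most 2 b c; [coll] contains
    two products, whence the constant 4. *)
Lemma qint_close G1 G2 (b c : R) : measurable_fun setT G1 -> measurable_fun setT G2 ->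
  0 <= b -> 0 <= c ->
  (forall z, `|G1 z| <= b) -> (forall z, `|G2 z| <= b) ->
  (forall z, `|G1 z - G2 z| <= c) ->
  `|qint kh G1 z - qint kh G2 z| <= 4 * b * c * M.
Proof.
move=> m1 m2 b0 c0 G1b G2b G12.
have mc : measurable_fun setT (fun p => coll G1 z p - coll G2 z p).
  by apply: measurable_funB; exact: measurable_coll1.
have -> : qint kh G1 z - qint kh G2 z = \int[muw]_p (kh (z, p) * (coll G1 z p - coll G2 z p)).
  have i1 := qint_integrable m1 G1b; have i2 := qint_integrable m2 G2b.
  by rewrite /qint -(RintegralB measurableT i1 i2); apply: eq_Rintegral => p _; rewrite -mulrBr.
apply: le_Rintegral_weight => //.
- exact: kernel_integrable.
- by rewrite !mulr_ge0.
- move=> p; have prod (a a' d d' : R) : `|a| <= b -> `|d'| <= b -> `|a - a'| <= c ->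
      `|d - d'| <= c -> `|a'| <= b -> `|d| <= b -> `|a * d - a' * d'| <= 2 * b * c.
    move=> ab d'b aa dd a'b db.
    rewrite (_ : a * d - a' * d' = (a - a') * d + a' * (d - d')); last by ring.
    apply: (le_trans (ler_normD _ _)); rewrite !normrM.
    rewrite (_ : 2 * b * c = c * b + b * c); last by ring.
    by apply: lerD; apply: ler_pM.
  rewrite /coll (_ : _ - _ = (G1 (z.1, post_u z.2 p.1 p.2) * G1 (z.1, post_v z.2 p.1 p.2) -
    G2 (z.1, post_u z.2 p.1 p.2) * G2 (z.1, post_v z.2 p.1 p.2)) -
    (G1 (z.1, p.1) * G1 z - G2 (z.1, p.1) * G2 z)); last by ring.
  apply: (le_trans (ler_normB _ _)).
  rewrite (_ : 4 * b * c = 2 * b * c + 2 * b * c); last by ring.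
  by apply: lerD; apply: prod.
Qed.

Lemma qint_scale G b (e : R) : measurable_fun setT G -> (forall z, `|G z| <= b) ->
  qint kh (fun z => e * G z) z = e ^+ 2 * qint kh G z.
Proof.
move=> mG Gb; rewrite /qint -(RintegralZl _ measurableT (qint_integrable mG Gb)).
by apply: eq_Rintegral => p _; rewrite /coll; ring.
Qed.

End qint_estimates.

End collision_integral.

(** * Expansion of the solution for small data *)

Section convex_open.
Context {R : realType} {n : nat}.
Local Notation V := 'rV[R]_n.
Implicit Types (Om : set V) (x y v : V).

Lemma convex_combination Om x y (l : R) : convex_set Om -> 0 <= l -> l <= 1 ->
  Om x -> Om y -> Om (l *: x + (1 - l) *: y).
Proof.
move=> cO l0 l1 Ox Oy.
by have := cO x y (Itv01 l0 l1) (mem_set Ox) (mem_set Oy); rewrite inE.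
Qed.

(** Replace x by a point x' of Om so close to it that the error x - x', magnified by (1 - l) / l,
    can be absorbed by moving y inside Om. *)
Lemma convex_closure_segment Om x y (l : R) : open Om -> convex_set Om ->
  closure Om x -> Om y -> 0 < l -> l <= 1 -> Om (x + l *: (y - x)).
Proof.
move=> oO cO Cx Oy l0 l1.
have /nbhs_ballP[d /= d0 dO] : nbhs y Om by apply: open_nbhs_nbhs.
have [x' [Ox' /=]] := Cx _ (nbhsx_ballx x (l * d) (mulr_gt0 l0 d0)).
rewrite mx_norm_ball /ball_ /= => xx'.
have Oy' : Om (y + ((1 - l) / l) *: (x - x')).
  apply: dO; rewrite mx_norm_ball /ball_ /= opprD addrA subrr sub0r normrN normrZ.
  have l1' : 0 <= (1 - l) / l by rewrite divr_ge0 ?subr_ge0// ltW.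
  rewrite ger0_norm//.
  have [e|e] := eqVneq ((1 - l) / l) 0; first by rewrite e mul0r.
  apply: (@lt_le_trans _ _ ((1 - l) / l * (l * d))).
    by rewrite ltr_pM2l// lt_neqAle eq_sym e.
  rewrite mulrA divfK ?gt_eqF// -[leRHS]mul1r ler_wpM2r ?ltW//.
  by rewrite ltrBlDr ltrDl.
have := convex_combination cO (ltW l0) l1 Oy' Ox'; congr Om.
rewrite scalerDr scalerA mulrCA divff ?gt_eqF// mulr1 scalerBr.
apply/rowP => i; rewrite !mxE; ring.
Qed.

(** The point x may lie on the boundary, since rays are followed backwards from their exit
    points. *)
Lemma tau_minus_gt Om x v (s : R) : open Om -> convex_set Om -> closure Om x -> 0 < s ->
  (s%:E < tau_minus Om x v)%E <-> Om (x - s *: v).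
Proof.
move=> oO cO Cx s0; split.
  move=> /ereal_sup_gt[_ [s' [s'0 Os'] <-]]; rewrite lte_fin => ss'.
  have s'p : 0 < s' by exact: lt_trans ss'.
  have := @convex_closure_segment Om x (x - s' *: v) (s / s') oO cO Cx Os'.
  rewrite divr_gt0// ler_pdivrMr// mul1r ltW// => /(_ isT isT); congr Om.
  by rewrite addrAC subrr add0r scalerN scalerA divfK// gt_eqF.
move=> Os.
have /nbhs_ballP[d /= d0 dO] : nbhs (x - s *: v) Om by apply: open_nbhs_nbhs.
pose e := d / (1 + `|v|).
have e0 : 0 < e by rewrite divr_gt0// ltr_pwDl.
apply: (@lt_le_trans _ _ (s + e)%:E); first by rewrite lte_fin ltrDl.
apply: ereal_sup_ubound; exists (s + e) => //; split; first by rewrite addr_ge0// ltW.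
apply: dO; rewrite mx_norm_ball /ball_ /= (_ : _ - _ = e *: v); last first.
  by apply/rowP => i; rewrite !mxE; ring.
rewrite normrZ gtr0_norm//.
by rewrite /e mulrAC ltr_pdivrMr ?ltr_pwDl// ltr_pM2l// ltrDr.
Qed.

Lemma heaviside_inside Om x v (s : R) : open Om -> convex_set Om -> closure Om x -> 0 < s ->
  heaviside (tau_minus Om x v - s%:E)%E = if `[< Om (x - s *: v) >] then 1 else 0.
Proof.
move=> oO cO Cx s0; rewrite /heaviside; have := tau_minus_gt v oO cO Cx s0.
rewrite sube_gt0 => h.
by case: asboolP => [/h ->//|Os]; case: ifPn => // /h.
Qed.

(** The Heaviside factor cuts the ray where it leaves Om, and there q is 0 already. *)
Lemma transport_source Om (T t : R) x v (f q : R * V * V -> R) :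
  open Om -> convex_set Om -> closure Om x -> t <= T ->
  (\forall s \ae @dt R, cylinder T (phase_space Om) (t - s, x - s *: v, v) ->
    f (t - s, x - s *: v, v) = q (t - s, x - s *: v, v)) ->
  (forall z, ~ cylinder T (phase_space Om) z -> q z = 0) ->
  \int[lebesgue_measure]_(s in `]0, t[)
    (f (t - s, x - s *: v, v) * heaviside (tau_minus Om x v - s%:E)%E) =
  \int[dt]_(s in `]0, t[) q (t - s, x - s *: v, v).
Proof.
move=> oO cO Cx tT fq q0; apply: (@Rintegral_ae _ _ R (@dt R)).
move: fq; apply: aeS => s fq; rewrite /= in_itv/= => /andP[s0 st].
rewrite heaviside_inside//; case: asboolP => Os.
  rewrite mulr1 fq//; split => /=; last by split.
  by rewrite subr_gt0 st/=; lra.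
by rewrite mulr0 q0// => -[_ []].
Qed.

(** At t = tau both Heaviside factors are 0, so the data terms of [transport] disappear. For fixed
    (x, v) this concerns at most one t; B expresses it by countably many conditions on open sets,
    which makes it measurable. *)
Lemma ae_not_exit Om (T : R) : open Om -> convex_set Om ->
  \forall z \ae @dtdxdv R n, cylinder T (phase_space Om) z ->
    z.1.1%:E <> tau_minus Om z.1.2 z.2.
Proof.
move=> oO cO.
pose Z := (measurableTypeR R * V * V)%type.
(* As c 0 = 0, the condition for k = 0 says that x lies in Om. *)
pose c (k : nat) : R := 1 - k.+1%:R^-1.
pose B : set Z := [set z | [/\ 0 < z.1.1, ~ Om (z.1.2 - z.1.1 *: z.2) &
   forall k, Om (z.1.2 - (c k * z.1.1) *: z.2)]].
have m1 : measurable_fun setT (fun z : Z => z.1.1).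
  exact: (measurableT_comp measurable_fst measurable_fst).
have m2 : measurable_fun setT (fun z : Z => z.1.2).
  exact: (measurableT_comp measurable_snd measurable_fst).
have m3 : measurable_fun setT (fun z : Z => z.2) by exact: measurable_snd.
have mO (a : R) : measurable [set z : Z | Om (z.1.2 - (a * z.1.1) *: z.2)].
  apply: (@measurable_pre _ _ Z V (fun z => z.1.2 - (a * z.1.1) *: z.2)).
    by apply: measurable_rowB => //; apply: measurable_rowZ => //; exact: measurable_funM.
  exact: open_measurable_row.
have mB : measurable B.
  rewrite (_ : B = ((fun z : Z => z.1.1) @^-1` `]0, +oo[%classic `&`
     ~` [set z : Z | Om (z.1.2 - (1 * z.1.1) *: z.2)]) `&`
     \bigcap_k [set z : Z | Om (z.1.2 - (c k * z.1.1) *: z.2)]).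
    apply: measurableI; last exact: bigcapT_measurable.
    apply: measurableI; last exact: measurableC.
    by apply: measurable_pre => //; exact: measurable_itv.
  apply/seteqP; split => z; rewrite /B /= in_itv/= andbT.
    by move=> [h1 h2 h3]; rewrite mul1r; split=> [|k _]; [split|exact: h3].
  by rewrite mul1r => -[[h1 h2] h3]; split => // k; exact: h3.
have aeB : \forall z \ae @dtdxdv R n, ~ B z.
  have mnB := measurableC mB.
  apply: (@ae_prod _ _ _ _ R (prod_measure (@dt R) (lebesgue_row n)) (lebesgue_row n) (~` B) mnB).
  apply/(@ae_swap _ _ _ _ R (prod_measure (@dt R) (lebesgue_row n)) (lebesgue_row n) (~` B) mnB).
  apply: aeW => v.
  have mBv : measurable [set p | (~` B) (p, v)].
    by have := measurable_ysection v mnB; rewrite ysectionE.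
  apply: (@ae_prod _ _ _ _ R (@dt R) (lebesgue_row n) [set p | (~` B) (p, v)] mBv).
  apply/(@ae_swap _ _ _ _ R (@dt R) (lebesgue_row n) _ mBv).
  apply: aeW => x.
  pose E : set R := [set t | B (t, x, v)].
  have [[t0 Et0]|nE] := pselect (exists t, E t); last first.
    apply: aeW => t; rewrite /= => Bt. apply: nE. exists t. exact: Bt.
  (* For t1 < t2 the point x - t1 v, which is outside Om, would lie on a segment from x to some x -
     c k t2 v, both inside. *)
  have Elt t1 t2 : E t1 -> E t2 -> t1 < t2 -> False.
    move=> [/= t1p nO1 _] [/= t2p _ O2] t12.
    have [k kt] : exists k, t1 <= c k * t2.
      exists (Num.truncn ((t2 - t1)^-1 * t2)).
      rewrite /c mulrBl mul1r; set m := Num.truncn _.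
      rewrite lerBrDr -lerBrDl.
      by rewrite mulrC ler_pdivrMr// -ler_pdivrMl ?subr_gt0// ltW// truncnS_gt.
    have c0 : 0 < c k * t2 by exact: lt_le_trans kt.
    have l0 : 0 <= t1 / (c k * t2) by rewrite divr_ge0 ?ltW.
    have l1 : t1 / (c k * t2) <= 1 by rewrite ler_pdivrMr// mul1r.
    have := convex_combination cO l0 l1 (O2 k) (O2 0%N); apply: contra_not nO1.
    rewrite /c invr1 subrr mul0r scale0r subr0; congr Om.
    rewrite -/(c k); set a := t1 / _; rewrite scalerBr scalerA divfK ?gt_eqF// scalerBl scale1r.
    by rewrite addrC addrA subrK.
  exists [set t0]; split => //; first by rewrite /dt /= lebesgue_measure_set1.
  move=> t /= /contrapT Et; have [tt|tt|//] := ltgtP t t0.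
    by case: (Elt t t0).
  by case: (Elt t0 t).
move: aeB; apply: aeS => -[[t x] v] nB [/= /andP[t0 tT] [/= Ox _]] tE; apply: nB.
have Cx := subset_closure Ox.
split => //=; first by move/(tau_minus_gt v oO cO Cx t0); rewrite -tE ltxx.
move=> k; have [->|c0] := eqVneq (c k) 0; first by rewrite mul0r scale0r subr0.
have c0' : 0 < c k * t.
  by rewrite mulr_gt0// lt_neqAle eq_sym c0 subr_ge0 invf_le1// ler1n.
apply/(tau_minus_gt v oO cO Cx c0'); rewrite -tE lte_fin -[ltRHS]mul1r ltr_pM2r//.
by rewrite ltrBlDr ltrDl invr_gt0.
Qed.

End convex_open.

Section expansion.
Context {R : realType} {n : nat}.
Local Notation V := 'rV[R]_n.
Local Notation TR := (measurableTypeR R).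
Local Notation Z := (TR * V * V)%type.

(** Truncation turns an almost-everywhere bound on a measurable representative into a bound
    everywhere. *)
Definition clamp (a b x : R) : R := Num.max a (Num.min x b).

Lemma clamp_id (a b x : R) : a <= x -> x <= b -> clamp a b x = x.
Proof. by move=> ax xb; rewrite /clamp (min_idPl xb) (max_idPr ax). Qed.

Lemma clamp_ge (a b x : R) : a <= clamp a b x.
Proof. by rewrite /clamp le_max lexx. Qed.

Lemma clamp_le (a b x : R) : a <= b -> clamp a b x <= b.
Proof. by move=> ab; rewrite /clamp ge_max ab ge_min lexx orbT. Qed.

Lemma measurable_clamp d (X : measurableType d) (a b f : X -> R) :
  measurable_fun setT a -> measurable_fun setT b -> measurable_fun setT f ->
  measurable_fun setT (fun x => clamp (a x) (b x) (f x)).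
Proof.
move=> ma mb mf; apply: (@measurable_maxr _ _ _ setT a) => //.
exact: measurable_minr.
Qed.

Lemma ae_v_neq0 : (0 < n)%N -> \forall z \ae (@dtdxdv R n), z.2 != 0.
Proof.
move=> n0.
have := @ae_prod _ _ _ _ R (prod_measure (@dt R) (lebesgue_row n)) (lebesgue_row n)
  [set z | z.2 != 0].
apply; last by apply: aeW => z; exact: ae_row_neq0.
rewrite (_ : [set _ | _] = snd @^-1` ~` (box 0 0)).
  by apply: measurable_pre; [exact: measurable_snd|apply: measurableC; exact: measurable_box].
apply/seteqP; split => z /= h.
  move=> b; move/eqP: h; apply; apply/rowP => i; have := b i.
  by rewrite !mxE subr0 normr_le0 => /eqP.
by apply/eqP => z0; apply: h => i; rewrite z0 subrr normr0.
Qed.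

Variables (Om : set V) (T : R) (K : R * V * V * V * V -> R) (kh : Z * (V * V) -> R) (M : R).
Hypotheses (n0 : (0 < n)%N) (oO : open Om) (cO : convex_set Om) (T0 : 0 < T) (M0 : 0 <= M).
Hypotheses (repK : kernel_rep Om T K kh) (massK : kernel_mass_le kh M).
Notation U := (cylinder T (phase_space Om)).

Lemma Q_qint_ae (F G : Z -> R) (b : R) : measurable_fun setT G ->
  (forall z, `|G z| <= b) -> F = G %[ae @dtdxdv R n in U] ->
  \forall z \ae @dtdxdv R n, U z -> Q K F F z = qint kh G z.
Proof.
move=> mG Gb FG; have [mk _ _ _] := repK.
apply: aeS (aeAnd (ae_post FG) (aeAnd massK (ae_v_neq0 n0))) => z [FGz [kM z0]] Uz.
apply: (Q_qint repK) => //; last exact: (qint_integrable mk kM mG Gb).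
apply: aeS FGz => p [h1 h2 h3 h4].
have Uu u : U (z.1, u) by move: Uz => [? []].
by rewrite /coll h1// h2// h3// h4.
Qed.

Lemma qint_outside (G : Z -> R) z : ~ U z -> qint kh G z = 0.
Proof.
move=> nU; have [_ _ _ khU] := repK.
rewrite /qint /Rintegral integral0_eq// => p _.
by rewrite khU// mul0r.
Qed.

Variables (phi : V -> R) (e C : R).
Hypotheses (mphi : measurable_fun setT phi) (phi0 : forall v, 0 <= phi v)
  (phi1 : forall v, phi v <= 1) (e0 : 0 < e) (e1 : e <= 1) (C0 : 0 <= C).

Definition gdat : R * V * V -> R := fun z => e * phi z.2.
Definition hdat : V * V -> R := fun z => e * phi z.2.

Lemma transport_const (f : R * V * V -> R) (q : Z -> R) (t : R) x v :
  U (t, x, v) -> t%:E <> tau_minus Om x v ->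
  (\forall s \ae @dt R, U (t - s, x - s *: v, v) ->
    f (t - s, x - s *: v, v) = q (t - s, x - s *: v, v)) ->
  (forall z, ~ U z -> q z = 0) ->
  transport Om f gdat hdat (t, x, v) =
    e * phi v + \int[@dt R]_(s in `]0, t[) q (t - s, x - s *: v, v).
Proof.
move=> [/= /andP[t0 tT] [/= Ox _]] tne fq q0; rewrite /transport.
rewrite (transport_source oO cO (subset_closure Ox) (ltW tT) fq q0).
congr (_ + _); rewrite /gdat /hdat.
rewrite /heaviside ?EFinN !sube_gt0; case: (ltgtP (tau_minus Om x v) t%:E) => [| |E].
- by move=> _; ring.
- by move=> _; ring.
- by case: tne.
Qed.

Lemma line_integral_bound (q : Z -> R) (c t : R) x v : measurable_fun setT q ->
  0 <= c -> 0 < t ->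
  (\forall s \ae @dt R, `|q (t - s, x - s *: v, v)| <= c) ->
  (@dt R).-integrable `]0, t[ (EFin \o (fun s => q (t - s, x - s *: v, v))) /\
  `| \int[@dt R]_(s in `]0, t[) q (t - s, x - s *: v, v) | <= c * t.
Proof.
move=> mq c0 t0 qc.
have [|||i b] := @Rintegral_ae_bound _ _ R (@dt R) `]0, t[%classic
  (fun s => q (t - s, x - s *: v, v)) c (measurable_itv _) _ _ c0.
- by rewrite /dt /= lebesgue_measure_itv/= lte_fin t0 -EFinB ltry.
- by apply: measurableT_comp => //; apply: measurable_line => //; exact: measurable_cst.
- by apply: aeS qc => s.
split => //; apply: (le_trans b).
by rewrite /dt /= lebesgue_measure_itv/= lte_fin t0 -EFinB subr0.
Qed.

(** The solution formula is fed back once. From |F| <= C e the source is O(e^2), hence F = e phi +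
    O(e^2); with F truncated to that band, the Lipschitz estimate [qint_close] leaves an error
    O(e^3) in the source. *)
Lemma solution_expansion (F : R * V * V -> R) :
  let B := T * (2 * C ^+ 2 * M) in
  is_solution Om T K gdat hdat F ->
  (\forall z \ae @dtdxdv R n, U z -> `|F z| <= C * e) ->
  exists q : Z -> R, [/\ measurable_fun setT q,
    \forall z \ae @dtdxdv R n, U z -> Q K F F z = q z,
    forall z, ~ U z -> q z = 0,
    exists2 c, 0 <= c & \forall z \ae @dtdxdv R n, `|q z| <= c &
    \forall z \ae @dtdxdv R n,
      `|q z - e ^+ 2 * qint kh (fun z => phi z.2) z| <= 4 * (1 + B) * B * M * e ^+ 3].
Proof.
move=> B [[G0 mG0 FG0] Fsol] Fb.
have [mk _ _ _] := repK.
have B0 : 0 <= B by rewrite !mulr_ge0// ?ltW// exprn_ge0.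
have {}mG0 : measurable_fun setT G0.
  by move: mG0; rewrite inE /= => /andP[]; rewrite inE.
have Ce0 : 0 <= C * e by rewrite mulr_ge0// ltW.
pose G1 z := clamp (- (C * e)) (C * e) (G0 z).
have mG1 : measurable_fun setT G1 by apply: measurable_clamp => //; exact: measurable_cst.
have G1b z : `|G1 z| <= C * e.
  rewrite ler_norml clamp_ge clamp_le//; lra.
have FG1 : F = G1 %[ae @dtdxdv R n in U].
  apply: aeS (aeAnd FG0 Fb) => z [h1 h2] Uz; move: (h2 Uz); rewrite h1//.
  by rewrite ler_norml /G1 => /andP[? ?]; rewrite clamp_id.
have Q1 := Q_qint_ae mG1 G1b FG1.
pose b1 := 2 * (C * e) ^+ 2 * M.
have b10 : 0 <= b1 by apply: mulr_ge0 => //; apply: mulr_ge0 => //; exact: sqr_ge0.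
have q1b : \forall z \ae @dtdxdv R n, `|qint kh G1 z| <= b1.
  by apply: aeS massK => z kM; exact: (qint_bound mk kM mG1 Ce0 G1b).
(* B e^2 is the bound 2 (C e)^2 M of the source times the maximal length T of the time integral. *)
have F1 : \forall z \ae @dtdxdv R n, U z -> `|F z - e * phi z.2| <= B * e ^+ 2.
  apply: aeS (aeAnd Fsol (aeAnd (ae_not_exit T oO cO)
    (aeAnd (ae_line_interior Q1) (ae_line_interior q1b)))).
  move=> -[[t x] v] [Fz [tne [Qz qz]]] Uz.
  rewrite Fz// (transport_const Uz (tne Uz) Qz (qint_outside G1)) addrC addKr.
  have [/= /andP[t0 tT] _] := Uz.
  have [_] := line_integral_bound (measurable_qint mk mG1) b10 t0 qz.
  move/le_trans; apply; rewrite /b1 /B.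
  rewrite (_ : T * _ * _ = 2 * (C * e) ^+ 2 * M * T); last by ring.
  by rewrite ler_wpM2l// ltW.
pose Be := B * e ^+ 2; have Be0 : 0 <= Be by apply: mulr_ge0 => //; exact: sqr_ge0.
pose P (z : Z) : R := e * phi z.2.
have mP : measurable_fun setT P.
  apply: measurable_funM; first exact: measurable_cst.
  by apply: measurableT_comp => //; exact: measurable_snd.
pose G (z : Z) := clamp (P z - Be) (P z + Be) (G1 z).
have mG : measurable_fun setT G.
  by apply: measurable_clamp => //; [exact: measurable_funB|exact: measurable_funD].
have GP z : `|G z - P z| <= Be.
  by rewrite ler_distl clamp_ge clamp_le//; lra.
have P1 (z : Z) : `|P z| <= e.
  rewrite /P ger0_norm; last by apply: mulr_ge0 => //; exact: ltW.
  by rewrite -[leRHS]mulr1; apply: ler_wpM2l => //; exact: ltW.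
have FG : F = G %[ae @dtdxdv R n in U].
  apply: aeS (aeAnd FG1 F1) => z [h1 h2] Uz; move: (h2 Uz); rewrite h1//.
  by rewrite ler_distl /G => /andP[? ?]; rewrite clamp_id.
(* This bounds both e phi and its O(e^2) neighbourhood, as e <= 1. *)
pose b := e * (1 + B).
have eb : e <= b by rewrite /b mulrDr mulr1 lerDl mulr_ge0// ltW.
have b0 : 0 <= b by apply: le_trans eb; exact: ltW.
have Gb z : `|G z| <= b.
  rewrite -[G z](subrK (P z)); apply: (le_trans (ler_normD _ _)).
  rewrite /b mulrDr mulr1 addrC; apply: lerD => //; apply: (le_trans (GP z)).
  by rewrite /Be mulrC ler_wpM2r// expr2 -[leRHS]mulr1 ler_wpM2l// ltW.
exists (qint kh G); split.
- exact: measurable_qint.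
- exact: Q_qint_ae Gb FG.
- exact: qint_outside.
- exists (2 * b ^+ 2 * M); first by apply: mulr_ge0 => //; apply: mulr_ge0 => //; exact: sqr_ge0.
  by apply: aeS massK => z kM; exact: (qint_bound mk kM mG b0 Gb).
- apply: aeS massK => z kM.
  have mphi2 : measurable_fun setT (fun z : Z => phi z.2).
    by apply: measurableT_comp => //; exact: measurable_snd.
  have phib (w : Z) : `|phi w.2| <= 1 by rewrite ger0_norm.
  rewrite -(qint_scale mk kM e mphi2 phib).
  have := qint_close mk kM mG mP b0 Be0 Gb (fun z => le_trans (P1 z) eb) GP.
  move/le_trans; apply; rewrite /b /Be le_eqVlt; apply/orP; left; apply/eqP; ring.
Qed.

End expansion.

(** * Product kernels *)

Section product_kernels.
Context {R : realType} {n : nat}.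
Local Notation V := 'rV[R]_n.
Local Notation TR := (measurableTypeR R).
Local Notation Z := (TR * V * V)%type.
Local Notation muw := (@dudw R n).

Lemma measurable_sphere : measurable (@sphere R n).
Proof.
rewrite (_ : sphere = enorm @^-1` [set 1]).
  by apply: measurable_pre; [exact: measurable_enorm|exact: measurable_set1].
by apply/seteqP; split.
Qed.

(** O and f are meant to be the neighbourhood and the extension provided by [C1_ext]; the indicator
    restricts the result to the sphere again. *)
Definition psi_ext (O : set (V * V * V)) (f : V * V * V -> R) (q : V * (V * V)) : R :=
  (f \_ O) (q.1, q.2.1, q.2.2) * \1_sphere q.2.2.

Lemma measurable_psi_ext O f : open O -> {in O, continuous f} ->
  measurable_fun setT (psi_ext O f).
Proof.
move=> oO cf; apply: measurable_funM; last first.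
  apply: measurableT_comp; first exact: measurable_indic measurable_sphere.
  exact: (measurableT_comp measurable_snd measurable_snd).
pose e (q : V * (V * V)) := (q.1, q.2.1, q.2.2).
have me : measurable_fun setT e.
  apply/measurable_fun_pairP; split => /=; last first.
    exact: (measurableT_comp measurable_snd measurable_snd).
  apply/measurable_fun_pairP; split => /=; first exact: measurable_fst.
  exact: (measurableT_comp measurable_fst measurable_snd).
apply: (@measurable_patch_open R _ _ _ e O f) => // U oU.
exact: measurable_pre me (open_measurable_row3 oU).
Qed.

Definition phi_ext (Om : set V) (T : R) (Phi : R * V * R -> R) (z : Z) : R :=
  (Phi \_ (Phi_domain Om T)) (z.1.1, z.1.2, enorm z.2).

Lemma open_Phi_domain (Om : set V) (T : R) : open Om -> open (Phi_domain Om T).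
Proof.
move=> oO; have oX (T1 T2 : topologicalType) (A : set T1) (B : set T2) :
    open A -> open B -> open (A `*` B).
  move=> oA oB; rewrite openE => -[a b] [/= Aa Bb].
  by exists (A, B) => //; split; apply: open_nbhs_nbhs.
by apply: (oX); [apply: (oX) => //; exact: interval_open|exact: open_gt].
Qed.

Lemma measurable_phi_ext Om T Phi : open Om -> {in Phi_domain Om T, continuous Phi} ->
  measurable_fun setT (phi_ext Om T Phi).
Proof.
move=> oO cf.
pose e (z : Z) : TR * V * TR := (z.1, enorm z.2).
have me : measurable_fun setT e.
  apply/measurable_fun_pairP; split => /=; first exact: measurable_fst.
  exact: (measurableT_comp measurable_enorm measurable_snd).
have -> : phi_ext Om T Phi = (Phi \_ (Phi_domain Om T)) \o e.
  by apply/funext => -[[t x] v].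
apply: (@measurable_patch_open R _ _ (R * V * R)%type e) => // [U oU|].
  exact: measurable_pre me (open_measurable_RrowR oU).
exact: open_Phi_domain.
Qed.

Definition kernel_ext (phih : Z -> R) (psih : V * (V * V) -> R) (zp : Z * (V * V)) : R :=
  phih zp.1 * psih (zp.1.2, zp.2).

Lemma kernel_ext_rep Om T Phi Psi O f : open Om -> {in Phi_domain Om T, continuous Phi} ->
  open O -> {in O, continuous f} -> setT `*` setT `*` sphere `<=` O ->
  {in setT `*` setT `*` sphere, f =1 Psi} ->
  kernel_rep Om T (product_kernel Phi Psi)
    (kernel_ext (phi_ext Om T Phi) (psi_ext O f)).
Proof.
move=> oOm cPhi oO cf sO fPsi; split.
- apply: measurable_funM.
    by apply: measurableT_comp; [exact: measurable_phi_ext|exact: measurable_fst].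
  apply: measurableT_comp; first exact: measurable_psi_ext.
  apply/measurable_fun_pairP; split => /=; last exact: measurable_snd.
  exact: (measurableT_comp measurable_snd measurable_fst).
- move=> [[t x] v] [u w] [/= tT [/= Ox _]] v0 sw.
  have inA : (setT `*` setT `*` sphere) (v, u, w) by split => //; split.
  rewrite /kernel_ext /phi_ext /psi_ext /= /patch mem_set.
    rewrite mem_set; last exact: sO.
    by rewrite fPsi ?inE// indicE mem_set// mulr1.
  split => /=; last exact: enorm_gt0.
  by split => //=; rewrite in_itv.
- move=> z p nsp; rewrite /kernel_ext /psi_ext /= indicE memNset// !mulr0 //.
- move=> [[t x] v] p nU; rewrite /kernel_ext /phi_ext /patch /= memNset ?mul0r//.
  move=> [[/= tT Ox] _]; apply: nU; split; last by split.
  by move: tT; rewrite in_itv.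
Qed.

Variable phi : V -> R.
Hypotheses (mphi : measurable_fun setT phi) (phi0 : forall v, 0 <= phi v)
  (phi1 : forall v, phi v <= 1).

(** The factor w(v): the potentials do not depend on (u, w) and come out of the collision integral,
    leaving this one. *)
Definition weight (psih : V * (V * V) -> R) (v : V) : R :=
  \int[muw]_p (psih (v, p) * (phi (post_u v p.1 p.2) * phi (post_v v p.1 p.2) -
                              phi p.1 * phi v)).

Let phiz (z : Z) := phi z.2.

Let mphiz : measurable_fun setT phiz.
Proof. by apply: measurableT_comp => //; exact: measurable_snd. Qed.

Let phizb z : `|phiz z| <= 1.
Proof. by rewrite /phiz ger0_norm. Qed.

(** The potential can be taken out of the integral where Psi is integrable at v, and the mass bound
    yields this where one of the potentials is nonzero. If the two agree at z, both sides vanish;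
    otherwise one of them is nonzero. *)
Lemma qint_difference (psih : V * (V * V) -> R) (ph1 ph2 : Z -> R) (M : R) z :
  measurable_fun setT psih -> measurable_fun setT ph1 -> measurable_fun setT ph2 ->
  (\int[muw]_p `|kernel_ext ph1 psih (z, p)|%:E <= M%:E)%E ->
  (\int[muw]_p `|kernel_ext ph2 psih (z, p)|%:E <= M%:E)%E ->
  qint (kernel_ext ph1 psih) phiz z - qint (kernel_ext ph2 psih) phiz z =
    (ph1 z - ph2 z) * weight psih z.2 /\
  (ph1 z != ph2 z -> muw.-integrable setT (EFin \o (fun p => psih (z.2, p)))).
Proof.
move=> mpsi m1 m2 k1 k2.
have mk (ph : Z -> R) : measurable_fun setT ph -> measurable_fun setT (kernel_ext ph psih).
  move=> mph; apply: measurable_funM.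
    by apply: measurableT_comp => //; exact: measurable_fst.
  apply: measurableT_comp => //; apply/measurable_fun_pairP; split => /=.
    exact: (measurableT_comp measurable_snd measurable_fst).
  exact: measurable_snd.
have Ipsi (ph : Z -> R) : measurable_fun setT ph -> ph z != 0 ->
    (\int[muw]_p `|kernel_ext ph psih (z, p)|%:E <= M%:E)%E ->
    muw.-integrable setT (EFin \o (fun p => psih (z.2, p))).
  move=> mph ph0 kM; have i := kernel_integrable (mk _ mph) kM.
  have := integrableZl measurableT (ph z)^-1 i.
  apply: eq_integrable => // p _ /=.
  by rewrite -EFinM /kernel_ext /= mulrA mulVf// mul1r.
have [E|ne] := eqVneq (ph1 z) (ph2 z).
  split => //; rewrite E subrr mul0r; apply/eqP; rewrite subr_eq0; apply/eqP.
  by apply: eq_Rintegral => p _; rewrite /kernel_ext /= E.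
have I : muw.-integrable setT (EFin \o (fun p => psih (z.2, p))).
  have [z1|z1] := eqVneq (ph1 z) 0; last exact: (Ipsi _ m1 z1 k1).
  by apply: (Ipsi _ m2 _ k2); rewrite -z1 eq_sym.
split => //.
have qE (ph : Z -> R) : qint (kernel_ext ph psih) phiz z = ph z * weight psih z.2.
  have Iw := integrable_weight I (measurable_coll1 z mphiz) (fun p => coll_bound z p phizb).
  rewrite /weight -(RintegralZl _ measurableT Iw).
  by apply: eq_Rintegral => p _; rewrite /kernel_ext /= -mulrA.
by rewrite !qE mulrBl.
Qed.

End product_kernels.

(** * Positivity of the weight near the chosen velocity *)

Section weight_positive.
Context {R : realType} {m : nat}.
Local Notation n := m.+2.
Local Notation V := 'rV[R]_n.
Local Notation muw := (@dudw R n).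

Definition away (v1 y : V) : R := 1 - \1_(box v1 (1/2)) y.

Lemma measurable_away v1 : measurable_fun setT (away v1).
Proof.
apply: measurable_funB; first exact: measurable_cst.
exact: measurable_indic (measurable_box _ _).
Qed.

Lemma away_ge0 v1 y : 0 <= away v1 y.
Proof. by rewrite /away indicE; case: (y \in _); rewrite ?subrr ?subr0. Qed.

Lemma away_le1 v1 y : away v1 y <= 1.
Proof. by rewrite /away indicE; case: (y \in _); rewrite ?subrr ?subr0. Qed.

Lemma away_far v1 y : 1/2 < `|y - v1| -> away v1 y = 1.
Proof.
move=> h; rewrite /away indicE memNset ?subr0// => b.
have : `|y - v1| <= 1/2.
  by apply/row_norm_leP => [|i]; [rewrite divr_ge0|rewrite !mxE; exact: b].
by rewrite leNgt h.
Qed.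

Lemma away_near v1 y : `|y - v1| <= 1/2 -> away v1 y = 0.
Proof.
move=> h; rewrite /away indicE mem_set ?subrr// => i.
by apply: le_trans h; have := coord_le_norm (y - v1) i; rewrite !mxE.
Qed.

Let e0 : V := delta_mx ord0 ord0.
Let e1 : V := delta_mx ord0 (lift ord0 ord0).

Let dot_e (i j : 'I_n) : dot (delta_mx ord0 i : V) (delta_mx ord0 j) = (i == j)%:R.
Proof.
rewrite /dot (bigD1 i)//= big1 ?addr0 => [|k ki].
  by rewrite !mxE !eqxx /= mul1r.
by rewrite !mxE /= (negbTE ki) mul0r.
Qed.

Let norm_e (i : 'I_n) : 1/2 < `|delta_mx ord0 i : V|.
Proof.
apply: lt_le_trans (coord_le_norm _ i); rewrite !mxE !eqxx /= normr1.
lra.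
Qed.

Lemma cvg_post (F : set_system (V * V * V)) {FF : Filter F} (a : V * V * V) :
  F --> a ->
  (fun q => post_v q.1.1 q.1.2 q.2) @ F --> post_v a.1.1 a.1.2 a.2 /\
  (fun q => post_u q.1.1 q.1.2 q.2) @ F --> post_u a.1.1 a.1.2 a.2.
Proof.
move=> Fa.
have h11 : (fun q : V * V * V => q.1.1) @ F --> a.1.1.
  by apply: cvg_comp (cvg_comp _ _ Fa cvg_fst) cvg_fst.
have h12 : (fun q : V * V * V => q.1.2) @ F --> a.1.2.
  by apply: cvg_comp (cvg_comp _ _ Fa cvg_fst) cvg_snd.
have h2 : (fun q : V * V * V => q.2) @ F --> a.2.
  by apply: cvg_comp Fa cvg_snd.
have hd : (fun q : V * V * V => dot (q.1.2 - q.1.1) q.2 *: q.2) @ F -->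
    dot (a.1.2 - a.1.1) a.2 *: a.2.
  by apply: cvgZ => //; apply: cvg_dot => //; exact: cvgB.
by split; [exact: cvgD|exact: cvgB].
Qed.

(** The surface measure is a multiple of the volume of a cone, and the cone over C contains the open
    set G around e0 / 2. The half-space in G keeps away from the origin, where [normalize] is
    discontinuous. *)
Lemma sphere_measure_gt0 (C : set V) : open C -> C e0 -> (0 < sphere_measure n (C `&` sphere))%E.
Proof.
move=> oC C0; rewrite /sphere_measure /= /mscale /=.
apply: mule_gt0; first by rewrite lte_fin.
pose G : set V := [set x : V | 0 < x ord0 ord0] `&` [set x : V | enorm x < 1] `&`
  [set x : V | 0 < x ord0 ord0 /\ C (normalize x)].
have oG : open G.
  apply: openI.
    apply: openI.
      apply: (@open_comp _ _ (fun x : V => x ord0 ord0) [set r | 0 < r]).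
        by move=> x _; exact: coord_continuous.
      exact: open_gt.
    apply: (@open_comp _ _ enorm [set r | r < 1]); last exact: open_lt.
    by move=> x _; exact: enorm_continuous.
  rewrite openE => x [x0 Cx].
  have ex : 0 < enorm x.
    by apply: enorm_gt0; apply/eqP => xE; move: x0; rewrite xE mxE ltxx.
  apply: filterI.
    have := @coord_continuous R 1 n ord0 ord0 x [set r | 0 < r]; apply.
    by apply: open_nbhs_nbhs; split => //; exact: open_gt.
  have hi : (fun y : V => (enorm y)^-1) @ x --> (enorm x)^-1.
    exact: (cvgV (lt0r_neq0 ex) (@enorm_continuous _ _ x)).
  have hid : (fun y : V => y) @ x --> (x : V) by exact: cvg_id.
  have hn : normalize @ x --> normalize x by exact: (cvgZ hi hid).
  by apply: hn; apply: open_nbhs_nbhs.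
have : (0 < lebesgue_row n G)%E.
  apply: lebesgue_row_open_gt0 => //; exists (2^-1 *: e0).
  have ee : enorm (2^-1 *: e0) = 2^-1.
    rewrite /enorm (_ : dot _ _ = 2^-1 ^+ 2) ?sqrtr_sqr ?ger0_norm//.
    rewrite /dot (eq_bigr (fun i => 2^-1 ^+ 2 * (e0 ord0 i * e0 ord0 i))).
      by rewrite -mulr_sumr -/(dot e0 e0) dot_e eqxx mulr1.
    by move=> i _; rewrite !mxE; ring.
  have p0 : 0 < (2^-1 *: e0) ord0 ord0 by rewrite !mxE !eqxx /= mulr1.
  split; first by split => //=; rewrite ee invf_lt1// ltr1n.
  split => //; rewrite /normalize ee invrK scalerA divff// scale1r //.
move/lt_le_trans; apply; apply: le_measure; rewrite ?inE.
- exact: open_measurable_row.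
- apply: measurable_cone; apply: measurableI; [exact: open_measurable_row|].
  exact: measurable_sphere.
- move=> x [[x0 x1] [_ Cx]].
  have ex : 0 < enorm x.
    by apply: enorm_gt0; apply/eqP => xE; move: x0; rewrite /= xE mxE ltxx.
  split; first by rewrite ex.
  split => //; rewrite /sphere /= /enorm /normalize.
  rewrite (_ : dot _ _ = (enorm x)^-2 * dot x x).
    rewrite -[dot x x]sqr_sqrtr ?dot_ge0// -/(enorm x) mulVf ?sqrtr1//.
    by rewrite expf_neq0// gt_eqF.
  rewrite /dot mulr_sumr; apply: eq_bigr => i _; rewrite !mxE; rewrite -exprVn; ring.
Qed.

(* Near u = v1 + e0 + e1 and w = e0 both postcollisional velocities are far from v1. *)
Lemma weight_gt0 (psih : V * (V * V) -> R) (c0 : R) (v1 : V) : 0 < c0 ->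
  measurable_fun setT psih -> (forall v p, 0 <= psih (v, p)) ->
  (forall v u w, eball v 3 u -> sphere w -> c0 <= psih (v, (u, w))) ->
  \forall v \near v1, muw.-integrable setT (EFin \o (fun p => psih (v, p))) ->
    0 < weight (away v1) psih v.
Proof.
move=> c00 mpsi psi0 psic.
(* A collision in direction e0 exchanges the e0-components: v' = v1 + e0 and u' = v1 + e1, both at
   distance 1 from v1. The relative speed is the square root of 2, within the radius 3 of the lower
   bound on Psi. *)
pose u0 := v1 + e0 + e1.
have dw : dot (u0 - v1) e0 = 1.
  by rewrite /u0 addrAC [v1 + _]addrC addrK dotDl !dot_e eqxx /= addr0.
have pv : post_v v1 u0 e0 = v1 + e0 by rewrite /post_v dw scale1r.
have pu : post_u v1 u0 e0 = v1 + e1 by rewrite /post_u dw scale1r /u0 addrAC addrK.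
pose q0 : V * V * V := (v1, u0, e0).
have [cv cu] := @cvg_post (nbhs q0) _ q0 cvg_id.
have far (f : V * V * V -> V) i : f @ q0 --> v1 + delta_mx ord0 i ->
    \forall q \near q0, 1/2 < `|f q - v1|.
  move=> fc; have : (fun q => `|f q - v1|) @ q0 --> `|(v1 + delta_mx ord0 i) - v1|.
    by apply: cvg_norm; apply: cvgB => //; exact: cvg_cst.
  rewrite addrC addKr => /(_ [set r | 1/2 < r]); apply.
  by apply: open_nbhs_nbhs; split; [exact: open_gt|exact: norm_e].
have nball : \forall q \near q0, enorm (q.1.2 - q.1.1) < 3.
  have : (fun q : V * V * V => enorm (q.1.2 - q.1.1)) @ q0 --> enorm (u0 - v1).
    apply: cvg_enorm; apply: cvgB.
      by apply: cvg_comp cvg_fst cvg_snd.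
    by apply: cvg_comp cvg_fst cvg_fst.
  move=> /(_ [set r | r < 3]); apply.
  apply: open_nbhs_nbhs; split; first exact: open_lt.
  rewrite /= /u0 (_ : _ - v1 = e0 + e1); last by rewrite addrAC [v1 + _]addrC addrK.
  rewrite /enorm (_ : dot _ _ = 2).
    rewrite -[3]ger0_norm// -sqrtr_sqr ltr_sqrt; lra.
  by rewrite dotDl !dotDr !dot_e /=; ring.
have nE : \forall q \near q0, [/\ 1/2 < `|post_v q.1.1 q.1.2 q.2 - v1|,
    1/2 < `|post_u q.1.1 q.1.2 q.2 - v1| & enorm (q.1.2 - q.1.1) < 3].
  rewrite /= pv in cv; rewrite /= pu in cu.
  have h1 := far _ _ cv; have h2 := far _ _ cu.
  by apply: filterS3 h1 h2 nball => q.
have [[AB C] [/= [[A B] [/= nA nB] AB'] nC] ABC] := nE.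
have nA' : \forall v \near v1, `|v - v1| <= 1/2.
  have := nbhsx_ballx v1 (1/2) ltac:(lra); apply: filterS => v.
  by rewrite mx_norm_ball /ball_ /= distrC => /ltW.
apply: filterS2 nA nA' => v Av vv1 ipsi.
have phv : away v1 v = 0 by exact: away_near.
pose k p := psih (v, p) * (away v1 (post_u v p.1 p.2) * away v1 (post_v v p.1 p.2) -
   away v1 p.1 * away v1 v).
(* The loss term is zero because the data vanish at v. *)
have k0 p : 0 <= k p.
  by rewrite /k phv mulr0 subr0 !mulr_ge0// away_ge0.
have mk1 : measurable_fun setT (fun p : V * V => away v1 (post_u v p.1 p.2)).
  apply: measurableT_comp; first exact: measurable_away.
  by apply: measurable_post_u => //; exact: measurable_cst.
have mk2 : measurable_fun setT (fun p : V * V => away v1 (post_v v p.1 p.2)).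
  apply: measurableT_comp; first exact: measurable_away.
  by apply: measurable_post_v => //; exact: measurable_cst.
have mk3 : measurable_fun setT (fun p : V * V => away v1 p.1 * away v1 v).
  apply: measurable_funM; last exact: measurable_cst.
  by apply: measurableT_comp; [exact: measurable_away|exact: measurable_fst].
pose h (p : V * V) := away v1 (post_u v p.1 p.2) * away v1 (post_v v p.1 p.2) -
   away v1 p.1 * away v1 v.
have mh : measurable_fun setT h by apply: measurable_funB => //; exact: measurable_funM.
have hb p : `|h p| <= 1.
  rewrite /h phv mulr0 subr0 ger0_norm ?mulr_ge0 ?away_ge0//.
  by rewrite -[leRHS]mulr1; apply: ler_pM; rewrite ?away_ge0 ?away_le1.
have ik : muw.-integrable setT (EFin \o k) := integrable_weight ipsi mh hb.
pose E : set (V * V) := interior B `*` (interior C `&` sphere).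
have mE : measurable E.
  apply: measurableX; first by apply: open_measurable_row; exact: open_interior.
  apply: measurableI; last exact: measurable_sphere.
  by apply: open_measurable_row; exact: open_interior.
have kE p : E p -> c0 <= k p.
  case: p => u w [/= Bu [Cw sw]].
  have [|h1 h2 h3] := ABC (v, u, w).
    by split => /=; [apply: AB'; split => //=; exact: nbhs_singleton|exact: nbhs_singleton].
  rewrite /k phv mulr0 subr0 !away_far// !mulr1; exact: psic.
have P0 : (0 < \int[muw]_p (k p)%:E)%E.
  apply: (@lt_le_trans _ _ (\int[muw]_p (c0%:E * (\1_E p)%:E))%E).
    rewrite ge0_integralZl_EFin//; [|by apply/measurable_EFinP; exact: measurable_indic|exact: ltW].
    rewrite integral_indic// setIT mule_gt0 ?lte_fin//.
    have PE : ((lebesgue_row n \x sphere_measure n) E = lebesgue_row n (interior B) *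
        sphere_measure n (interior C `&` sphere))%E.
      apply: product_measure1E; first by apply: open_measurable_row; exact: open_interior.
      apply: measurableI; last exact: measurable_sphere.
      by apply: open_measurable_row; exact: open_interior.
    have : (0 < (lebesgue_row n \x sphere_measure n) E)%E.
      rewrite PE; apply: mule_gt0.
        by apply: lebesgue_row_open_gt0; [exact: open_interior|exists u0].
      by apply: sphere_measure_gt0; [exact: open_interior|].
    exact.
  apply: ge0_le_integral => //.
  - by move=> p _; rewrite mule_ge0// lee_fin ltW.
  - apply: measurable_funeM; apply/measurable_EFinP; exact: measurable_indic.
  - exact: (measurable_int _ ik).
  - move=> p _; rewrite -EFinM lee_fin indicE; have [Ep|nEp] := pselect (E p).
      by rewrite mem_set// mulr1; exact: kE.
    by rewrite memNset// mulr0.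
rewrite /weight /Rintegral fine_gt0// P0 /=.
exact: (integrable_lty measurableT ik).
Qed.

End weight_positive.

(** * The boundary as a graph *)

Section directional_derivatives.
Context {R : realType} {n : nat}.
Local Notation V := 'rV[R]_n.
Implicit Types (f : V -> R) (x e a : V).

Lemma is_derive_line f x e (s : R) : derivable f (x + s *: e) e ->
  is_derive s 1 (fun s => f (x + s *: e)) ('D_e f (x + s *: e)).
Proof.
move=> df.
have E : (fun h => h^-1 *: (((fun s => f (x + s *: e)) \o shift s) (h *: 1) - f (x + s *: e))) =
    (fun h => h^-1 *: ((f \o shift (x + s *: e)) (h *: e) - f (x + s *: e))).
  apply/funext => h /=; congr (_ *: (f _ - _)).
  by rewrite scaler1 scalerDl addrCA addrA.
by apply: DeriveDef; rewrite /derivable /derive E.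
Qed.

Lemma MVT_direction f (W : set V) x e (L : R) :
  (forall s, `|s| <= `|L| -> W (x + s *: e)) -> (forall y, W y -> derivable f y e) ->
  exists2 xi, `|xi| <= `|L| & f (x + L *: e) - f x = L * 'D_e f (x + xi *: e).
Proof.
move=> WL df; pose g s := f (x + s *: e).
have dg (s : R) : `|s| <= `|L| -> is_derive s 1 g ('D_e f (x + s *: e)).
  by move=> sL; apply: is_derive_line; exact/df/WL.
have cg (a b : R) : (forall s : R, s \in `[a, b] -> `|s| <= `|L|) -> {within `[a, b], continuous g}.
  move=> H; apply: derivable_within_continuous => s /H sL.
  by have := dg s sL => ?; exact: ex_derive.
have [L0|L0] := leP 0 L.
  have H (s : R) : s \in `[0, L] -> `|s| <= `|L|.
    by rewrite in_itv/= => /andP[s0 sL]; rewrite !ger0_norm.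
  have [|xi xiL] := @MVT_segment R g (fun s => 'D_e f (x + s *: e)) 0 L L0 _ (cg _ _ H).
    by move=> s sL; apply/dg/H; move: sL; rewrite !in_itv/= => /andP[/ltW -> /ltW ->].
  rewrite /g scale0r addr0 subr0 mulrC => ->; exists xi => //; exact: H.
have H (s : R) : s \in `[L, 0] -> `|s| <= `|L|.
  by rewrite in_itv/= => /andP[s0 sL]; rewrite !ler0_norm ?lerN2// ltW.
have [|xi xiL] := @MVT_segment R g (fun s => 'D_e f (x + s *: e)) L 0 (ltW L0) _ (cg _ _ H).
  by move=> s sL; apply/dg/H; move: sL; rewrite !in_itv/= => /andP[/ltW -> /ltW ->].
rewrite /g scale0r addr0 sub0r => h; exists xi; first exact: H.
by rewrite -[LHS]opprB h mulrN opprK mulrC.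
Qed.

(** [Ck] speaks of directional derivatives only. Their additivity follows from the mean value
    theorem along e, started at x + h a, and the continuity of D_e f at x. *)
Lemma derive_direction_add f (W : set V) x a e (c : R) : open W -> W x ->
  (forall v y, W y -> derivable f y v) -> {for x, continuous (fun y => 'D_e f y)} ->
  'D_(a + c *: e) f x = 'D_a f x + c * 'D_e f x.
Proof.
move=> oW Wx df ce.
have [d d0 dW] : exists2 d, 0 < d & forall y, `|y - x| <= d -> W y.
  have /nbhs_ballP[d /= d0 dW] : nbhs x W by apply: open_nbhs_nbhs.
  exists (d / 2); first by rewrite divr_gt0.
  move=> y yx; apply: dW; rewrite mx_norm_ball /ball_ /= distrC.
  by apply: (le_lt_trans yx); rewrite ltr_pdivrMr// ltr_pMr// ltr1n.
pose q v h := h^-1 *: ((f \o shift x) (h *: v) - f x).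
have qa : q a @ 0^' --> 'D_a f x by exact: df.
have qd : (fun h => q (a + c *: e) h - q a h) @ 0^' --> c * 'D_e f x.
  apply/cvgrPdist_le => eps eps0.
  have eps1 : 0 < eps / (1 + `|c|) by rewrite divr_gt0// ltr_pwDl.
  have /cvgrPdist_le/(_ _ eps1)/nbhs_ballP[d' /= d'0 d'P] := ce.
  pose k := `|a| + `|c| * `|e| + 1.
  have k0 : 0 < k by rewrite ltr_wpDl// addr_ge0// mulr_ge0.
  have near_h (b : R) : 0 < b -> \forall h \near 0^', `|h| * k < b.
    move=> b0; have bk : 0 < b / k by rewrite divr_gt0.
    apply: filterS (dnbhs0_lt bk) => h hb; by rewrite -ltr_pdivlMr.
  near=> h.
  have h0 : h != 0 by near: h; exact: nbhs_dnbhs_neq.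
  have hd : `|h| * k < d by near: h; exact: near_h.
  have hd' : `|h| * k < d' by near: h; exact: near_h.
  have est (s : R) : `|s| <= `|h * c| -> `|(x + h *: a + s *: e) - x| <= `|h| * k.
    move=> sh; rewrite -[X in X - x]addrA (addrC x) addrK; apply: (le_trans (ler_normD _ _)).
    rewrite !normrZ /k mulrDr mulr1 mulrDr -addrA lerD2l mulrA -normrM.
    by apply: (@le_trans _ _ (`|h * c| * `|e|)); [rewrite ler_wpM2r|rewrite lerDl].
  have [s sh|y|xi xih E] := @MVT_direction f W (x + h *: a) e (h * c).
  - by apply: dW; exact: le_trans (est _ sh) (ltW hd).
  - exact: df.
  have -> : q (a + c *: e) h - q a h = c * 'D_e f (x + h *: a + xi *: e).
    have Y : h *: (a + c *: e) + x = x + h *: a + (h * c) *: e.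
      by rewrite scalerDr scalerA addrC addrA.
    rewrite /q -scalerBr /= Y (addrC (h *: a)) opprB addrA subrK E.
    by rewrite /GRing.scale /= mulrA mulrA mulVf// mul1r.
  rewrite -mulrBr normrM.
  have : `|'D_e f x - 'D_e f (x + h *: a + xi *: e)| <= eps / (1 + `|c|).
    apply: d'P; rewrite mx_norm_ball /ball_ /= distrC.
    exact: le_lt_trans (est _ xih) hd'.
  move=> H; apply: (@le_trans _ _ (`|c| * (eps / (1 + `|c|)))); first by rewrite ler_wpM2l.
  rewrite mulrCA -[leRHS]mulr1; apply: ler_wpM2l; first exact: ltW.
  by rewrite ler_pdivrMr ?ltr_pwDl// mul1r lerDr.
have -> : 'D_(a + c *: e) f x = lim (q (a + c *: e) @ 0^') by [].
apply/cvg_lim => //; rewrite (_ : q _ = fun h => q a h + (q (a + c *: e) h - q a h)).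
  exact: cvgD qa qd.
by apply/funext => h; rewrite [RHS]addrC subrK.
Unshelve. all: by end_near. Qed.

Lemma derive_dot_grad f (W : set V) x v : open W -> W x ->
  (forall v y, W y -> derivable f y v) ->
  (forall v, {for x, continuous (fun y => 'D_v f y)}) ->
  'D_v f x = dot v (grad f x).
Proof.
move=> oW Wx df cf.
have D0 : 'D_0 f x = 0.
  rewrite /derive (_ : (fun _ => _) = fun=> 0) ?lim_cst//; apply/funext => h /=.
  by rewrite scaler0 add0r subrr scaler0.
suff H s : 'D_(\sum_(i <- s) v ord0 i *: delta_mx ord0 i) f x =
    \sum_(i <- s) v ord0 i * grad f x ord0 i.
  have vE : v = \sum_i v ord0 i *: delta_mx ord0 i.
    by rewrite [LHS]row_sum_delta.
  by rewrite {1}vE H.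
elim: s => [|i s IH]; first by rewrite !big_nil.
rewrite !big_cons addrC (derive_direction_add _ _ oW Wx df)// IH addrC.
by rewrite [grad _ _ _ _]mxE.
Qed.

End directional_derivatives.

(** * The upper boundary of a convex set as a concave graph *)

Section upper_graph.
Context {R : realType} {m : nat}.
Local Notation V := ('rV[R]_m.+2).
Local Notation W := ('rV[R]_m.+1).
Variables (Om : set V) (D : R).
Hypotheses (oO : open Om) (cO : convex_set Om) (bO : forall x, Om x -> `|x| <= D).

Lemma row_cons_add k (a b : R) (y z : 'rV[R]_k) :
  row_cons (a, y) + row_cons (b, z) = row_cons (a + b, y + z).
Proof. by rewrite row_consD row_cons0 row_consK. Qed.

Lemma row_cons_scale k (l a : R) (y : 'rV[R]_k) :
  l *: row_cons (a, y) = row_cons (l * a, l *: y).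
Proof.
by apply/rowP => i; case: (unliftP ord0 i) => [j|] ->; rewrite !mxE ?liftK ?unlift_none //= mxE.
Qed.

Lemma row_cons_norm k (a e : R) (y : 'rV[R]_k) : 0 <= e -> `|a| <= e -> `|y| <= e ->
  `|row_cons (a, y)| <= e.
Proof.
move=> e0 ae /(row_norm_leP _ e0) ye; apply/(row_norm_leP _ e0) => i.
by case: (unliftP ord0 i) => [j|] ->; rewrite !mxE ?liftK ?unlift_none //=.
Qed.

Definition shadow : set W := [set y | exists h, Om (row_cons (h, y))].

Definition height (y : W) : R := sup [set h | Om (row_cons (h, y))].

(** A concave function is Lipschitz only away from the boundary of its domain; [inner] measures this
    distance. *)
Definition inner (r : R) : set W := [set y | forall z, `|z - y| < r -> shadow z].

Let near_row h y : Om (row_cons (h, y)) -> exists2 d, 0 < d &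
  forall h' y', `|h' - h| <= d -> `|y' - y| <= d -> Om (row_cons (h', y')).
Proof.
move=> Oh; have /nbhs_ballP[d /= d0 dO] : nbhs (row_cons (h, y)) Om by apply: open_nbhs_nbhs.
exists (d / 2); first by rewrite divr_gt0.
move=> h' y' hh yy; apply: dO; rewrite mx_norm_ball /ball_ /= distrC.
apply: (@le_lt_trans _ _ (d / 2)); last by rewrite ltr_pdivrMr// ltr_pMr// ltr1n.
rewrite -scaleN1r row_cons_scale row_cons_add mulN1r scaleN1r.
by apply: row_cons_norm => //; rewrite divr_ge0// ltW.
Qed.

Let fiber_le h y : Om (row_cons (h, y)) -> `|h| <= D.
Proof.
by move=> /bO; apply: le_trans; have := coord_le_norm (row_cons (h, y)) ord0; rewrite row_cons0.
Qed.

Let has_sup_fiber y : shadow y -> has_sup [set h | Om (row_cons (h, y))].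
Proof.
move=> [h Oh]; split; first by exists h.
by exists D => h' /fiber_le; apply: le_trans; exact: ler_norm.
Qed.

Lemma height_gt h y : Om (row_cons (h, y)) -> h < height y.
Proof.
move=> Oh; have [d d0 dO] := near_row Oh.
apply: (@lt_le_trans _ _ (h + d)); first by rewrite ltrDl.
apply: sup_ubound; first by have [] := @has_sup_fiber y (ex_intro _ h Oh).
by apply: dO; [rewrite addrC addKr gtr0_norm|rewrite subrr normr0 ltW].
Qed.

Let row_convex h h' y y' (l : R) : 0 <= l -> l <= 1 -> Om (row_cons (h, y)) ->
  Om (row_cons (h', y')) -> Om (row_cons (l * h + (1 - l) * h', l *: y + (1 - l) *: y')).
Proof.
by move=> l0 l1 Oh Oh'; rewrite -row_cons_add -!row_cons_scale; exact: convex_combination.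
Qed.

Lemma height_approx c y : shadow y -> c < height y -> exists2 h, Om (row_cons (h, y)) & c < h.
Proof. by move=> Sy /sup_gt; exact. Qed.

Lemma height_between h h' y : Om (row_cons (h, y)) -> h <= h' -> h' < height y ->
  Om (row_cons (h', y)).
Proof.
move=> Oh hh' /(height_approx (ex_intro _ h Oh))[h'' Oh'' h'h''].
have hh : 0 < h'' - h by rewrite subr_gt0 (le_lt_trans hh').
pose l := (h'' - h') / (h'' - h).
have l0 : 0 <= l by rewrite divr_ge0 ?ltW// subr_gt0.
have l1 : l <= 1 by rewrite ler_pdivrMr// mul1r lerB.
have := row_convex l0 l1 Oh Oh''; congr (Om (row_cons (_, _))); first by rewrite /l; field; rewrite gt_eqF.
by rewrite -scalerDl addrC subrK scale1r.
Qed.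

Lemma height_notin y : ~ Om (row_cons (height y, y)).
Proof. by move=> /height_gt; rewrite ltxx. Qed.

Lemma height_closure y : shadow y -> closure Om (row_cons (height y, y)).
Proof.
move=> Sy B /nbhs_ballP[e /= e0 eB].
have [|h Oh hh] := @height_approx (height y - e / 2) y Sy; first by rewrite ltrBlDr ltrDl divr_gt0.
exists (row_cons (h, y)); split => //; apply: eB; rewrite mx_norm_ball /ball_ /=.
apply: (@le_lt_trans _ _ (e / 2)); last by rewrite ltr_pdivrMr// ltr_pMr// ltr1n.
rewrite -scaleN1r row_cons_scale row_cons_add mulN1r scaleN1r subrr.
have e2 : 0 <= e / 2 by rewrite divr_ge0// ltW.
apply: row_cons_norm; rewrite ?normr0//.
have := height_gt Oh => hy; rewrite ger0_norm; lra.
Qed.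

Lemma height_bound y : shadow y -> `|height y| <= D.
Proof.
move=> Sy; rewrite ler_norml; apply/andP; split.
  have [h Oh] := Sy; apply: le_trans (ltW (height_gt Oh)).
  by have := fiber_le Oh; rewrite ler_norml => /andP[].
apply: sup_le_ub; first by have [] := has_sup_fiber Sy.
by move=> h /fiber_le; apply: le_trans; exact: ler_norm.
Qed.

Lemma height_concave y z (l : R) : 0 <= l -> l <= 1 -> shadow y -> shadow z ->
  l * height y + (1 - l) * height z <= height (l *: y + (1 - l) *: z).
Proof.
move=> l0 l1 Sy Sz; rewrite leNgt; apply/negP => lt.
set e := l * height y + (1 - l) * height z - height (l *: y + (1 - l) *: z).
have e0 : 0 < e by rewrite subr_gt0.
have [|h Oh hh] := @height_approx (height y - e) y Sy; first by rewrite ltrBlDr ltrDl.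
have [|k Ok kk] := @height_approx (height z - e) z Sz; first by rewrite ltrBlDr ltrDl.
have := height_gt (row_convex l0 l1 Oh Ok).
have : l * (height y - e) <= l * h by rewrite ler_wpM2l// ltW.
have : (1 - l) * (height z - e) <= (1 - l) * k by rewrite ler_wpM2l ?subr_ge0// ltW.
by rewrite /e; lra.
Qed.

Lemma inner_sub (r : R) y : 0 < r -> inner r y -> shadow y.
Proof. by move=> r0; apply; rewrite subrr normr0. Qed.

Lemma inner_near (r s : R) y z : inner (r + s) y -> `|z - y| <= s -> inner r z.
Proof.
move=> Iy zy w wz; apply: Iy; rewrite -(subrK z w) -addrA.
by apply: (le_lt_trans (ler_normD _ _)); rewrite ltr_leD.
Qed.

(** Extend the segment from z to z' by r / 2 to a point w of the shadow. By concavity a descent from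
    z to z' continues to w at least as steeply, where the total drop is at most 2 D; the slope is
    thus at most 2 D / (r / 2). *)
Lemma height_lipschitz (r : R) y y' : 0 < r -> inner r y -> inner r y' ->
  `|height y - height y'| <= 4 * D / r * `|y - y'|.
Proof.
move=> r0.
suff H z z' : inner r z -> inner r z' -> height z - height z' <= 4 * D / r * `|z - z'|.
  move=> Iy Iy'; rewrite ler_norml H// andbT lerNl opprB distrC; exact: H.
move=> Iz Iz'; have [->|zz] := eqVneq z z'; first by rewrite !subrr normr0 mulr0.
set d := `|z - z'|; have d0 : 0 < d by rewrite normr_gt0 subr_eq0.
pose w := z' + (r / 2 / d) *: (z' - z).
have Sw : shadow w.
  apply: Iz'; rewrite /w addrC addKr normrZ distrC gtr0_norm ?divr_gt0// divfK ?gt_eqF//.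
  by rewrite ltr_pdivrMr// ltr_pMr// ltr1n.
pose l := d / (d + r / 2).
have dr : 0 < d + r / 2 by rewrite addr_gt0// divr_gt0.
have l0 : 0 <= l by rewrite divr_ge0// ltW.
have l1 : l <= 1 by rewrite ler_pdivrMr// mul1r lerDl divr_ge0// ltW.
have := height_concave l0 l1 Sw (inner_sub r0 Iz).
have -> : l *: w + (1 - l) *: z = z'.
  rewrite /w; apply/rowP => i; rewrite !mxE /l; field.
  by rewrite (gt_eqF d0) andbT gt_eqF//; lra.
have := height_bound Sw; have := height_bound (inner_sub r0 Iz).
rewrite !ler_norml => /andP[_ hz] /andP[hw _] H.
have : height z - height z' <= l * (2 * D).
  have := ler_wpM2l l0 (lerB hz hw); lra.
move/le_trans; apply; rewrite /l.
have D0 : 0 <= D by apply: le_trans (normr_ge0 _) (height_bound Sw).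
rewrite mulrC mulrA ler_pdivrMr// .
have -> : 4 * D / r * d * (d + r / 2) = 2 * D * d + 4 * D / r * d * d by field; rewrite gt_eqF.
by rewrite lerDl !mulr_ge0// ?invr_ge0 ltW.
Qed.

End upper_graph.

(** * Exit points of transverse rays *)

Section exit_points.
Context {R : realType} {m : nat}.
Local Notation V := ('rV[R]_m.+2).
Local Notation W := ('rV[R]_m.+1).
Variables (Om : set V) (D : R).
Hypotheses (oO : open Om) (cO : convex_set Om) (D0 : 0 < D) (bO : forall x, Om x -> `|x| <= D).

Definition tail (v : V) : W := \row_j v ord0 (lift ord0 j).

Definition top (y : W) : V := row_cons (height Om y, y).

Let open_ball (p : V) : Om p -> exists2 d, 0 < d & forall q, `|q - p| <= d -> Om q.
Proof.
move=> Op; have /nbhs_ballP[d /= d0 dO] : nbhs p Om by apply: open_nbhs_nbhs.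
exists (d / 2); first by rewrite divr_gt0.
move=> q qp; apply: dO; rewrite mx_norm_ball /ball_ /= distrC.
by apply: (le_lt_trans qp); rewrite ltr_pdivrMr// ltr_pMr// ltr1n.
Qed.

Lemma tail_norm (v : V) : `|tail v| <= `|v|.
Proof. by apply/row_norm_leP => // j; rewrite mxE; exact: coord_le_norm. Qed.

Lemma open_shadow : open (shadow Om).
Proof.
rewrite openE => y [h /open_ball[d d0 dO]].
apply/nbhs_ballP; exists d => // z; rewrite mx_norm_ball /ball_ /= => yz.
exists h; apply: dO; rewrite -scaleN1r row_cons_scale row_cons_add mulN1r scaleN1r subrr.
by apply: row_cons_norm; rewrite ?normr0 ?ltW// distrC.
Qed.

Lemma measurable_inner r : measurable (inner Om r).
Proof.
rewrite -[inner _ _]setCK; apply: measurableC; apply: open_measurable_row.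
rewrite openE => y /= /existsNP[z /not_implyP[zy nz]].
apply/nbhs_ballP; exists (r - `|z - y|); first by rewrite /= subr_gt0.
move=> y'; rewrite mx_norm_ball /ball_ /= => yy' H; apply: nz; apply: H.
rewrite -(subrK y z) -addrA; apply: (le_lt_trans (ler_normD _ _)).
by rewrite -ltrBrDl.
Qed.

(** On the shadow the height is lower semicontinuous because Om is open; off the shadow it is 0, the
    [sup] of the empty set. *)
Lemma measurable_height : measurable_fun setT (height Om).
Proof.
move=> mT; apply: (measurability _ (RGenOInfty.measurableE R)) => //.
move=> _ [_ [c ->] <-]; rewrite setTI.
have oc : open [set y | exists h, Om (row_cons (h, y)) /\ c < h].
  rewrite openE => y [h [/open_ball[d d0 dO] ch]].
  apply/nbhs_ballP; exists d => // z; rewrite mx_norm_ball /ball_ /= => yz.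
  exists h; split => //; apply: dO.
  rewrite -scaleN1r row_cons_scale row_cons_add mulN1r scaleN1r subrr.
  by apply: row_cons_norm; rewrite ?normr0 ?ltW// distrC.
have Ec y : shadow Om y -> (c < height Om y <-> exists h, Om (row_cons (h, y)) /\ c < h).
  move=> Sy; split; first by move=> /(height_approx Sy)[h Oh ch]; exists h.
  by move=> [h [Oh ch]]; exact: lt_trans (height_gt oO bO Oh).
have H0 y : ~ shadow Om y -> height Om y = 0.
  move=> nS; rewrite /height (_ : [set h | _] = set0) ?sup0//.
  by apply/seteqP; split => // h Oh; apply: nS; exists h.
have mS := open_measurable_row open_shadow.
rewrite (_ : _ @^-1` _ = [set y | exists h, Om (row_cons (h, y)) /\ c < h] `|`
   (~` shadow Om `&` [set y | c < 0])).
  apply: measurableU; first exact: open_measurable_row.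
  apply: measurableI; first exact: measurableC.
  by have [c0|c0] := ltP c 0; [rewrite (_ : [set _ | _] = setT)//; apply/seteqP; split|
    rewrite (_ : [set _ | _] = set0)//; apply/seteqP; split].
apply/seteqP; split => y; rewrite /= in_itv /= andbT.
  have [Sy|nS] := pselect (shadow Om y); first by move=> /(Ec _ Sy); left.
  by rewrite H0//; right.
case=> [[h [Oh ch]]|[nS c0]]; last by rewrite H0.
by apply/Ec; exists h.
Qed.

(** The first coordinate can grow by at most 2 D inside Om, and with slope at most d / (32 D) the
    ray moves sideways by at most d / 16 meanwhile. So it ends over points that the ball of radius d
    about p still projects onto, with room to spare. *)
Lemma exit_graph (p v : V) (d : R) : 0 < d -> (forall z, `|z - p| < d -> Om z) ->
  transverse (16 * D / d) v ->
  exists s y, [/\ 0 < s, p + s *: v = top y, inner Om (3 / 4 * d) y &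
    forall s', 0 <= s' -> s' < s -> Om (p + s' *: v)].
Proof.
move=> d0 dO [v0 v1 Lv].
pose S := [set s : R | 0 <= s /\ Om (p + s *: v)].
have Op : Om p by apply: dO; rewrite subrr normr0.
have S0 : S 0 by split => //; rewrite scale0r addr0.
have Sb s : S s -> s * v ord0 ord0 <= 2 * D.
  move=> [s0 /bO]; have /bO := Op.
  move=> /(le_trans (coord_le_norm _ ord0)) hp /(le_trans (coord_le_norm _ ord0)).
  by rewrite !mxE; move: hp; rewrite !ler_norml; lra.
have hS : has_sup S.
  split; first by exists 0.
  by exists (2 * D / v ord0 ord0) => s /Sb; rewrite ler_pdivlMr.
pose s1 := sup S.
have s1v : s1 * v ord0 ord0 <= 2 * D.
  rewrite -ler_pdivlMr//; apply: sup_le_ub; first by exists 0.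
  by move=> s /Sb; rewrite ler_pdivlMr.
have vn : v != 0 by apply: contraTneq v0 => ->; rewrite mxE ltxx.
have step s : 0 <= s -> Om (p + s *: v) -> s < s1.
  move=> s0 /open_ball[e e0 eO].
  apply: (@lt_le_trans _ _ (s + e / `|v|)); first by rewrite ltrDl divr_gt0// normr_gt0.
  apply: sup_ubound; first by have [] := hS.
  split; first by rewrite addr_ge0// divr_ge0// ltW.
  apply: eO; rewrite [X in `|X|](_ : _ = (e / `|v|) *: v); last first.
    by apply/rowP => i; rewrite !mxE; ring.
  rewrite normrZ.
  by rewrite gtr0_norm ?divr_gt0 ?normr_gt0// divfK// normr_eq0.
have s10 : 0 < s1 by apply: step; [|rewrite scale0r addr0].
have before s' : 0 <= s' -> s' < s1 -> Om (p + s' *: v).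
  move=> s'0 /(@sup_gt _ _ _)[|s [s0 Os] ss']; first by exists 0.
  have sp : 0 < s by exact: le_lt_trans ss'.
  have l1 : s' / s <= 1 by rewrite ler_pdivrMr// mul1r ltW.
  have := convex_combination cO (divr_ge0 s'0 s0) l1 Os Op; congr Om.
  by apply/rowP => i; rewrite !mxE; field; rewrite gt_eqF.
pose e := p + s1 *: v.
have nOe : ~ Om e by move=> /(step _ (ltW s10)); rewrite ltxx.
have Ce : closure Om e.
  move=> B /nbhs_ballP[eps /= eps0 eB].
  pose a := Num.min s1 (eps / 2 / `|v|).
  have a0 : 0 < a by rewrite lt_min s10 !divr_gt0// normr_gt0.
  exists (p + (s1 - a) *: v); split.
    by apply: before; [rewrite subr_ge0 ge_min lexx|rewrite ltrBlDr ltrDl].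
  apply: eB; rewrite mx_norm_ball /ball_ /=.
  rewrite (_ : _ - _ = a *: v); last by apply/rowP => i; rewrite !mxE; ring.
  rewrite normrZ gtr0_norm//; apply: (@le_lt_trans _ _ (eps / 2)).
    by rewrite -ler_pdivlMr ?normr_gt0// ge_min lexx orbT.
  by rewrite ltr_pdivrMr// ltr_pMr// ltr1n.
pose y := tail e.
have yp : `|y - tail p| <= d / 16.
  apply/row_norm_leP => [|j]; first by rewrite divr_ge0// ltW.
  rewrite !mxE addrC addKr normrM gtr0_norm//.
  have := ler_wpM2l (ltW s10) (Lv j).
  have L0 : 0 < 16 * D / d by rewrite divr_gt0// mulr_gt0.
  rewrite mulrCA => h; rewrite -(ler_pM2l L0); apply: (le_trans h).
  have -> : 16 * D / d * (d / 16) = D by field; rewrite gt_eqF.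
  by move: s1v; lra.
have inn : inner Om (3 / 4 * d) y.
  move=> z zy; exists (p ord0 ord0); apply: dO.
  rewrite -[p in _ - p]row_consE -scaleN1r row_cons_scale row_cons_add mulN1r subrr scaleN1r.
  apply: (@le_lt_trans _ _ (3 / 4 * d + d / 16)); last by move: d0; lra.
  have dd : 0 <= 3 / 4 * d + d / 16 by move: d0; lra.
  apply: row_cons_norm; rewrite ?normr0//.
  rewrite -(subrK y z) -addrA; apply: (le_trans (ler_normD _ _)).
  by apply: lerD => //; exact: ltW.
exists s1, y; split => //.
rewrite -/e /top -[e]row_consE -/(tail e) -/y; congr (row_cons (_, _)).
have Oa : Om (row_cons (p ord0 ord0, y)).
  apply: dO; rewrite -[p in _ - p]row_consE -scaleN1r row_cons_scale row_cons_add.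
  rewrite mulN1r subrr scaleN1r; apply: (@le_lt_trans _ _ (d / 16)); last by move: d0; lra.
  by apply: row_cons_norm; rewrite ?normr0// divr_ge0// ltW.
have pe : p ord0 ord0 < e ord0 ord0 by rewrite !mxE ltrDl mulr_gt0.
(* The end point is a limit of points of Om. Above the graph, the segment towards the point of Om
   below it would contain points of Om above the graph; below the graph, it would itself belong to
   Om. *)
apply/eqP; rewrite eq_le; apply/andP; split; rewrite leNgt; apply/negP => lt; last first.
  apply: nOe; rewrite -[e]row_consE -/(tail e) -/y.
  exact: (@height_between _ _ Om cO (p ord0 ord0) (e ord0 ord0) y Oa (ltW pe) lt).
pose l := Num.min 1 ((e ord0 ord0 - height Om y) / (e ord0 ord0 - p ord0 ord0)).
have l0 : 0 < l by rewrite lt_min ltr01 divr_gt0// subr_gt0.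
have l1 : l <= 1 by rewrite ge_min lexx.
have le : l * (e ord0 ord0 - p ord0 ord0) <= e ord0 ord0 - height Om y.
  by rewrite -ler_pdivlMr ?subr_gt0// ge_min lexx orbT.
have := convex_closure_segment oO cO Ce Oa l0 l1.
rewrite -[e in X in X -> _]row_consE -/(tail e) -/y -scaleN1r row_cons_scale row_cons_add.
rewrite scaleN1r subrr row_cons_scale row_cons_add scaler0 addr0 => /(height_gt oO bO).
by move: le; lra.
Qed.

(** Along -w the point sinks at rate w_0, while the graph above it falls at rate at most (4 D / r)
    |w'|, which is less. A fixed point of Om under [top y] bounds the fibre from below for small
    s. *)
Lemma below_graph (r : R) (y : W) (w : V) : 0 < r -> inner Om (r + r) y ->
  4 * D / r * `|tail w| < w ord0 ord0 ->
  exists2 eta, 0 < eta & forall s, 0 < s -> s < eta -> Om (top y - s *: w).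
Proof.
move=> r0 Iy Lw.
have Sy : shadow Om y by apply: inner_sub Iy; rewrite addr_gt0.
have [h Oh] := Sy; have [d d0 dO] := open_ball Oh.
have hy := height_gt oO bO Oh.
pose k := 1 + `|w|; have k0 : 0 < k by rewrite ltr_pwDl.
pose eta := Num.min (Num.min r d) (height Om y - h) / k.
have eta0 : 0 < eta by rewrite divr_gt0// !lt_min r0 d0 subr_gt0.
exists eta => // s s0 seta.
have : s * k < Num.min (Num.min r d) (height Om y - h) by rewrite -ltr_pdivlMr.
rewrite !lt_min => /andP[/andP[skr skd] skh].
have sw : s * `|w| <= s * k by rewrite ler_pM2l// lerDr.
pose z := y - s *: tail w.
have zy : `|z - y| <= s * `|tail w|.
  by rewrite addrC addKr normrN normrZ gtr0_norm.
have zy' : `|z - y| <= s * k.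
  by apply: (le_trans zy); apply: le_trans sw; rewrite ler_pM2l// tail_norm.
have -> : top y - s *: w = row_cons (height Om y - s * w ord0 ord0, z).
  by rewrite /top -[w in LHS]row_consE -scaleN1r !row_cons_scale row_cons_add mulN1r scaleN1r.
have Iz : inner Om r z by apply: (inner_near Iy); apply: le_trans zy' (ltW skr).
have Iy' : inner Om r y by apply: (inner_near Iy); rewrite subrr normr0 ltW.
have := height_lipschitz oO cO bO r0 Iy' Iz; rewrite [X in _ * X]distrC => lip.
have w0 : w ord0 ord0 <= `|w| by apply: le_trans (ler_norm _) (coord_le_norm _ _).
apply: (@height_between _ _ Om cO h).
- apply: dO; rewrite -scaleN1r row_cons_scale row_cons_add mulN1r scaleN1r subrr.
  by apply: row_cons_norm; rewrite ?normr0 ?(ltW d0)//; apply: le_trans zy' (ltW skd).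
- have : s * w ord0 ord0 <= s * k by apply: le_trans sw; rewrite ler_pM2l.
  by move: skh; lra.
have L0 : 0 < 4 * D / r by rewrite divr_gt0// mulr_gt0.
have : height Om y - height Om z <= 4 * D / r * (s * `|tail w|).
  by apply: (le_trans (ler_norm _)); apply: (le_trans lip); rewrite ler_pM2l.
have : s * (4 * D / r * `|tail w|) < s * w ord0 ord0 by rewrite ltr_pM2l.
lra.
Qed.

End exit_points.

Section outgoing.
Context {R : realType} {m : nat}.
Local Notation V := ('rV[R]_m.+2).
Local Notation W := ('rV[R]_m.+1).
Variables (Om : set V) (D : R).
Hypotheses (oO : open Om) (cO : convex_set Om) (D0 : 0 < D) (bO : forall x, Om x -> `|x| <= D).

Lemma boundary_top r y : 0 < r -> inner Om r y -> boundary Om (top Om y).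
Proof.
move=> r0 /(inner_sub r0) Sy; split; first exact: height_closure oO bO _ Sy.
by move=> /interior_subset; exact: height_notin oO bO _.
Qed.

(* rho vanishes at the boundary point and is negative on the segments that leave it
   into Om, so its derivative is nonnegative on a cone of directions; being linear and
   nonzero, it is positive inside that cone. *)
Lemma outgoing (r : R) (y : W) (v : V) : smooth_boundary Om -> 0 < r ->
  inner Om (r + r) y -> 4 * D / r * `|tail v| < v ord0 ord0 ->
  Gamma_plus Om (top Om y, v).
Proof.
move=> sO r0 Iy Lv; set x := top Om y.
have rr0 : 0 < r + r by exact: addr_gt0.
have Bx : boundary Om x by exact: boundary_top rr0 Iy.
split => //=; rewrite /outer_normal.
(* The normal is the one [xget] selects; what follows holds for every local defining function. *)
have : is_outer_normal Om x (xget 0 (is_outer_normal Om x)).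
  apply: xgetPex; have [U [rho [Ux rhoU]]] := sO _ Bx.
  by exists (normalize (grad rho x)), U, rho.
move: (xget _ _) => nu [U [rho [Ux [oU srho g0 OU] ->]]].
have [_ d1] := srho 1.
have dr w z : U z -> derivable rho z w by have [H _] := d1 w; exact: H.
have cr w : {for x, continuous (fun z => 'D_w rho z)}.
  by have [_ [H _]] := d1 w; apply: H; rewrite inE.
set g := grad rho x; have gn : g != 0 by exact: g0.
have rx : 0 <= rho x.
  rewrite leNgt; apply/negP => rx.
  have : (Om `&` U) x by rewrite OU.
  by move=> [Ox _]; case: Bx => _; apply; exact: open_nbhs_nbhs.
have D_ge0 w : 4 * D / r * `|tail w| < w ord0 ord0 -> 0 <= 'D_w rho x.
  move=> /(below_graph oO cO D0 bO r0 Iy)[eta eta0 Oeta].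
  rewrite leNgt; apply/negP => neg.
  have : \forall h \near 0^', `|'D_w rho x - h^-1 *: ((rho \o shift x) (h *: w) - rho x)| < - 'D_w rho x.
    by have /cvgrPdist_lt := dr w x Ux; apply; rewrite oppr_gt0.
  move/nbhs_ballP=> [e /= e0 eP].
  have [e' e'0 eU] : exists2 e', 0 < e' & forall s, `|s| < e' -> U (x - s *: w).
    have /nbhs_ballP[d /= d0 dU] : nbhs x U by apply: open_nbhs_nbhs.
    exists (d / (1 + `|w|)); first by rewrite divr_gt0// ltr_pwDl.
    move=> s sd; apply: dU; rewrite mx_norm_ball /ball_ /= opprB addrC subrK normrZ.
    apply: (@le_lt_trans _ _ (`|s| * (1 + `|w|))); first by rewrite ler_wpM2l// lerDr.
    by rewrite -ltr_pdivlMr// ltr_pwDl.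
  pose s := Num.min (Num.min eta e) e' / 2.
  have s0 : 0 < s by rewrite divr_gt0// !lt_min eta0 e0.
  have : s < Num.min (Num.min eta e) e'.
    by rewrite ltr_pdivrMr// ltr_pMr ?ltr1n// !lt_min eta0 e0.
  rewrite !lt_min => /andP[/andP[seta se] se'].
  have rs : rho (x - s *: w) < 0.
    have : (Om `&` U) (x - s *: w) by split; [exact: Oeta|apply: eU; rewrite gtr0_norm].
    by rewrite OU => -[].
  have := eP (- s); rewrite /ball /= sub0r opprK gtr0_norm// => /(_ se).
  rewrite oppr_eq0 gt_eqF// => /(_ isT).
  rewrite scaleNr addrC invrN scaleNr opprK /GRing.scale /=.
  rewrite ltr_norml => /andP[+ _]; apply/negP; rewrite -leNgt opprK gerDr.
  rewrite pmulr_rle0 ?invr_gt0// subr_le0; apply: le_trans rx; rewrite addrC; exact: ltW.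
have DE w : 'D_w rho x = dot w g by exact: derive_dot_grad oU Ux dr cr.
suff : 0 < dot v g.
  move=> vg; rewrite (_ : dot _ _ = (enorm g)^-1 * dot v g).
    by rewrite mulr_gt0// invr_gt0 enorm_gt0.
  by rewrite /dot mulr_sumr; apply: eq_bigr => i _; rewrite mxE; ring.
set L := 4 * D / r; have L0 : 0 < L by rewrite divr_gt0// mulr_gt0.
have k0 : 0 < (1 + L) * (1 + `|g|) by rewrite mulr_gt0// ltr_pwDl// ltW.
(* So small that w = v - eta g stays in the open cone. Then 0 <= dot w g = dot v g - eta dot g g,
   which gives strict positivity. *)
pose eta := (v ord0 ord0 - L * `|tail v|) / 2 / ((1 + L) * (1 + `|g|)).
have eta0 : 0 < eta by rewrite !divr_gt0// subr_gt0.
pose w := v - eta *: g.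
have := D_ge0 w; rewrite DE => H.
have wg : dot w g = dot v g - eta * dot g g.
  rewrite /dot mulr_sumr -sumrB; apply: eq_bigr => i _; rewrite !mxE; ring.
have gg : 0 < dot g g.
  rewrite -sqrtr_gt0; exact: enorm_gt0.
suff /H : L * `|tail w| < w ord0 ord0.
  by rewrite wg subr_ge0; apply: lt_le_trans; rewrite mulr_gt0.
have tw : `|tail w| <= `|tail v| + eta * `|g|.
  have -> : tail w = tail v - eta *: tail g by apply/rowP => j; rewrite !mxE.
  apply: (le_trans (ler_normB _ _)); rewrite lerD2l normrZ gtr0_norm//.
  by rewrite ler_wpM2l ?tail_norm// ltW.
have gi : g ord0 ord0 <= `|g| by apply: le_trans (ler_norm _) (coord_le_norm _ _).
have w0 : v ord0 ord0 - eta * `|g| <= w ord0 ord0.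
  by rewrite /w mxE lerD2l mxE lerN2 mxE; apply: (ler_wpM2l (ltW eta0)).
have := ler_wpM2l (ltW L0) tw.
have E : eta * ((1 + L) * (1 + `|g|)) = (v ord0 ord0 - L * `|tail v|) / 2.
  by rewrite divfK// gt_eqF.
have : eta * (1 + L) * `|g| <= eta * ((1 + L) * (1 + `|g|)).
  by rewrite -mulrA ler_pM2l// ler_pM2l ?lerDr// ltr_pwDl// ltW.
move: w0 Lv; rewrite -/L; lra.
Qed.

End outgoing.

(** * The light-ray identity *)

Section scattering.
Context {R : realType} {n : nat}.
Local Notation V := 'rV[R]_n.
Local Notation TR := (measurableTypeR R).
Local Notation Z := (TR * V * V)%type.
Variables (Om : set V) (T : R).
Hypotheses (n0 : (0 < n)%N) (oO : open Om) (cO : convex_set Om) (T0 : 0 < T).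
Notation U := (cylinder T (phase_space Om)).

Section source.
Variables (K : R * V * V * V * V -> R) (kh : Z * (V * V) -> R) (M kappa : R) (phi : V -> R).
Hypotheses (M0 : 0 <= M) (repK : kernel_rep Om T K kh) (massK : kernel_mass_le kh M).
Hypotheses (mphi : measurable_fun setT phi) (phi0 : forall v, 0 <= phi v)
  (phi1 : forall v, phi v <= 1).

Lemma data_small e : 0 < e -> 2 * e <= kappa ->
  small_data Om T kappa (gdat phi e, hdat phi e) /\
  (data_norm Om T (gdat phi e) (hdat phi e) <= (2 * e)%:E)%E.
Proof.
move=> e0 ek.
have b v : `|e * phi v| <= e.
  by rewrite normrM (gtr0_norm e0) (ger0_norm (phi0 v)) ler_piMr// ltW.
have le : (data_norm Om T (gdat phi e) (hdat phi e) <= (2 * e)%:E)%E.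
  rewrite mulr_natl mulr2n EFinD; apply: leeD; apply: Linf_norm_le; rewrite ?(ltW e0)//.
    by move=> z _; exact: b.
  by move=> z _; exact: b.
split => //; split => /=; last by apply: (le_trans le); rewrite lee_fin.
  apply: (@Linf_bounded _ _ _ _ _ _ e) => [|z]; last exact: b.
  apply: measurable_funM; first exact: measurable_cst.
  by apply: measurableT_comp => //; exact: measurable_snd.
apply: (@Linf_bounded _ _ _ _ _ _ e) => [|z]; last exact: b.
apply: measurable_funM; first exact: measurable_cst.
by apply: measurableT_comp => //; exact: measurable_snd.
Qed.

(** The norm bound of [well_posed] concerns some solution; uniqueness transfers it to the one picked
    by [solution]. The constant c does not depend on e because C does not. *)
Lemma solution_source : well_posed Om T K kappa ->
  exists2 c, 0 <= c & forall e, 0 < e -> e <= 1 -> 2 * e <= kappa ->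
  let F := solution Om T K (gdat phi e) (hdat phi e) in
  exists q : Z -> R, [/\ measurable_fun setT q,
    \forall z \ae @dtdxdv R n, U z -> Q K F F z = q z,
    forall z, ~ U z -> q z = 0,
    exists2 b, 0 <= b & \forall z \ae @dtdxdv R n, `|q z| <= b &
    \forall z \ae @dtdxdv R n,
      `|q z - e ^+ 2 * qint kh (fun z => phi z.2) z| <= c * e ^+ 3].
Proof.
move=> [C C0 wp]; pose C' := C * 2; have C'0 : 0 <= C' by rewrite mulr_ge0 // ltW.
pose B := T * (2 * C' ^+ 2 * M).
have B0 : 0 <= B by rewrite mulr_ge0 ?(ltW T0)// mulr_ge0// mulr_ge0// exprn_ge0.
exists (4 * (1 + B) * B * M) => [|e e0 e1 ek F].
  have B1 : 0 <= 1 + B by move: B0; lra.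
  by do 3 apply: mulr_ge0 => //.
have [sd dn] := data_small e0 ek.
have [G [solG Gle Guniq]] := wp _ _ sd.
have solF : is_solution Om T K (gdat phi e) (hdat phi e) F.
  by apply: (@xgetPex _ (fun=> 0) [set F | is_solution Om T K _ _ F]); exists G.
apply: (solution_expansion n0 oO cO T0 M0 repK massK mphi phi0 phi1 e0 e1 C'0 solF).
have : (Linf_norm (@dtdxdv R n) U G <= (C' * e)%:E)%E.
  apply: (le_trans Gle); rewrite /C' -mulrA EFinM; by apply: lee_wpmul2l => //; rewrite lee_fin ltW.
move/Linf_norm_ae => Gb; apply: aeI Gb (Guniq _ solF) => z Gz FGz Uz.
by rewrite FGz//; exact: Gz.
Qed.

End source.

(* The sources are e^2 times the quadratic term up to O(e^3), and the same data cancel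
   in the two traces: divide by e^2 and let e tend to 0. *)
Lemma ray_vanishes (t : R) (x v : V) (f1 f2 g : nat -> R * V * V -> R) (h : nat -> V * V -> R)
    (q1 q2 : nat -> Z -> R) (d : Z -> R) (w c Bd : R) (e b : nat -> R) :
  closure Om x -> 0 < t -> t <= T ->
  (forall k, measurable_fun setT (q1 k)) -> (forall k, measurable_fun setT (q2 k)) ->
  (forall k z, ~ U z -> q1 k z = 0) -> (forall k z, ~ U z -> q2 k z = 0) ->
  measurable_fun setT d -> (forall z, `|d z| <= Bd) ->
  (forall k, transport Om (f1 k) (g k) (h k) (t, x, v) =
             transport Om (f2 k) (g k) (h k) (t, x, v)) ->
  (forall k, \forall s \ae @dt R, let z := (t - s, x - s *: v, v) in
     [/\ U z -> f1 k z = q1 k z, U z -> f2 k z = q2 k z,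
         `|q1 k z| <= b k, `|q2 k z| <= b k &
         `|q1 k z - q2 k z - e k ^+ 2 * (d z * w)| <= c * e k ^+ 3]) ->
  (forall k, 0 <= b k) -> (forall k, 0 < e k) -> e @ \oo --> 0 -> 0 <= c ->
  w * \int[@dt R]_(s in `]0, t[) d (t - s, x - s *: v, v) = 0.
Proof.
move=> Cx t0 tT mq1 mq2 q10 q20 md dB tr good b0 e0 ecvg c0.
set I := Rintegral _ _ _.
have Bd0 : 0 <= Bd by apply: le_trans (dB (0, 0, 0)).
have [id _] := @line_integral_bound R n d Bd t x v md Bd0 t0 (aeW _ (fun s => dB _)).
have est k : `|w * I| <= c * t * e k.
  have gk := good k.
  have [i1 _] := @line_integral_bound R n (q1 k) (b k) t x v (mq1 k) (b0 k) t0
    (aeS _ (fun s (H : [/\ _, _, _, _ & _]) => let: And5 _ _ h _ _ := H in h) gk).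
  have [i2 _] := @line_integral_bound R n (q2 k) (b k) t x v (mq2 k) (b0 k) t0
    (aeS _ (fun s (H : [/\ _, _, _, _ & _]) => let: And5 _ _ _ h _ := H in h) gk).
  have E : \int[@dt R]_(s in `]0, t[) q1 k (t - s, x - s *: v, v) =
           \int[@dt R]_(s in `]0, t[) q2 k (t - s, x - s *: v, v).
    have := tr k; rewrite /transport.
    rewrite (transport_source oO cO Cx tT _ (q10 k)); last by move: gk; apply: aeS => s [].
    rewrite (transport_source oO cO Cx tT _ (q20 k)); last by move: gk; apply: aeS => s [].
    exact: addrI.
  pose r (z : Z) := q1 k z - q2 k z - e k ^+ 2 * (d z * w).
  have mr : measurable_fun setT r.
    apply: measurable_funB; first exact: measurable_funB.
    apply: measurable_funM; first exact: measurable_cst.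
    by apply: measurable_funM => //; exact: measurable_cst.
  have ck : 0 <= c * e k ^+ 3 by rewrite mulr_ge0// exprn_ge0// ltW.
  have [_] := @line_integral_bound R n r (c * e k ^+ 3) t x v mr ck t0
    (aeS _ (fun s (H : [/\ _, _, _, _ & _]) => let: And5 _ _ _ _ h := H in h) gk).
  rewrite /r.
  have i3 : (@dt R).-integrable `]0, t[
      (EFin \o (fun s => e k ^+ 2 * w * d (t - s, x - s *: v, v))).
    have := @integrableZl _ _ R (@dt R) `]0, t[%classic (measurable_itv _) (e k ^+ 2 * w) _ id.
    by apply.
  rewrite (_ : Rintegral _ _ _ = - (e k ^+ 2 * w * I)); last first.
    transitivity (\int[@dt R]_(s in `]0, t[) ((q1 k (t - s, x - s *: v, v) -
       q2 k (t - s, x - s *: v, v)) - e k ^+ 2 * w * d (t - s, x - s *: v, v))).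
      by apply: eq_Rintegral => s _; ring.
    have i12 := @integrableB _ _ R (@dt R) `]0, t[%classic (measurable_itv _) _ _ i1 i2.
    rewrite RintegralB//.
    by rewrite RintegralB// E subrr sub0r RintegralZl.
  rewrite normrN -mulrA normrM ger0_norm ?exprn_ge0 ?(ltW (e0 k))//.
  rewrite (_ : c * e k ^+ 3 * t = e k ^+ 2 * (c * t * e k)); last by ring.
  by rewrite ler_pM2l// exprn_gt0.
have cv : (fun k => c * t * e k) @ \oo --> c * t * 0 by apply: cvgM => //; exact: cvg_cst.
have : `|w * I| <= c * t * 0.
  rewrite -(cvg_lim _ cv)//; apply: limr_ge; first by apply/cvg_ex; exists (c * t * 0).
  exact: nearW.
by rewrite mulr0 normr_le0 => /eqP.
Qed.

End scattering.

(** Outside the projection of the null set the whole vertical line is good, in particular its point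
    on the graph. *)
Lemma ae_surface_proj (R : realType) (m : nat) (P : 'rV[R]_m.+2 -> Prop) :
  (\forall x \ae @surface_measure R m.+2, P x) ->
  \forall y \ae lebesgue_row m.+1, forall h, P (row_cons (h, y)).
Proof.
move=> [N [_ N0 PN]]; have [B [mB B0 NB]] := hausdorff_null_proj N0.
exists B; split => // y /existsNP[h nP]; apply: NB; exists h; exact: PN.
Qed.

Lemma transverse_tail (R : realType) (m : nat) (L : R) (v : 'rV[R]_m.+2) : 0 < L ->
  transverse L v -> L * `|tail v| < v ord0 ord0.
Proof.
move=> L0 [v0 _ Lv]; apply: (@le_lt_trans _ _ (1 / 2 * v ord0 ord0)); last by lra.
rewrite -ler_pdivlMl//; apply/row_norm_leP => [|j].
  by rewrite mulr_ge0 ?invr_ge0 ?(ltW L0)//; lra.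
by rewrite mxE ler_pdivlMl.
Qed.

(** * Vanishing of almost all ray integrals *)

Section rays.
Context {R : realType} {m : nat}.
Local Notation n := m.+2.
Local Notation V := 'rV[R]_n.
Local Notation TR := (measurableTypeR R).
Local Notation Z := (TR * V * V)%type.
Variables (Om : set V) (T : R).
Hypotheses (oO : open Om) (cO : convex_set Om) (T0 : 0 < T).
Notation U := (cylinder T (phase_space Om)).
Variables (K1 K2 : R * V * V * V * V -> R) (ph1 ph2 : Z -> R) (psih : V * (V * V) -> R).
Variables (M M1 kappa : R).
Hypotheses (M0 : 0 <= M) (kappa0 : 0 < kappa).
Hypotheses (mph1 : measurable_fun setT ph1) (mph2 : measurable_fun setT ph2)
  (mpsi : measurable_fun setT psih).
Hypotheses (ph1b : forall z, `|ph1 z| <= M1) (ph2b : forall z, `|ph2 z| <= M1).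
Hypotheses (rep1 : kernel_rep Om T K1 (kernel_ext ph1 psih))
  (rep2 : kernel_rep Om T K2 (kernel_ext ph2 psih)).
Hypotheses (mass1 : kernel_mass_le (kernel_ext ph1 psih) M)
  (mass2 : kernel_mass_le (kernel_ext ph2 psih) M).
Hypotheses (wp1 : well_posed Om T K1 kappa) (wp2 : well_posed Om T K2 kappa).
Hypothesis hA : forall gh, small_data Om T kappa gh ->
  eq_measurement Om T (measurement Om T K1 gh) (measurement Om T K2 gh).
Variable v1 : V.

Let phi := away v1.
Let d (z : Z) := ph1 z - ph2 z.
(** [weight] is meaningful only where Psi is integrable at v, and this is known only for v at which
    the potentials differ somewhere. *)
Let positive_weight (v : V) :=
  (@dudw R n).-integrable setT (EFin \o (fun p => psih (v, p))) -> 0 < weight phi psih v.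

(** All exceptional sets, for a sequence of amplitudes e k tending to 0, are gathered into one
    condition P on points and one condition [tr] on traces. Rays that end at time T and rays that
    end on the boundary then share one argument. *)
Lemma ray_good : exists P : Z -> Prop, exists tr : R * V * V -> Prop,
  [/\ \forall z \ae @dtdxdv R n, P z,
      \forall z \ae @dtdSdv R n, cylinder T (Gamma_plus Om) z -> tr z,
      \forall p \ae @dxdv R n, Om p.1 -> tr (T, p.1, p.2) &
      forall (t : R) x v, closure Om x -> 0 < t -> t <= T -> positive_weight v ->
        tr (t, x, v) -> (\forall s \ae @dt R, P (t - s, x - s *: v, v)) ->
        \int[@dt R]_(s in `]0, t[) d (t - s, x - s *: v, v) = 0].
Proof.
have mphi : measurable_fun setT phi by exact: measurable_away.
have phi0 := away_ge0 v1 : forall v, 0 <= phi v.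
have phi1 := away_le1 v1 : forall v, phi v <= 1.
have [c1 c10 S1] := solution_source (isT : (0 < n)%N) oO cO T0 M0 rep1 mass1 mphi phi0 phi1 wp1.
have [c2 c20 S2] := solution_source (isT : (0 < n)%N) oO cO T0 M0 rep2 mass2 mphi phi0 phi1 wp2.
(* The data for amplitude e have norm at most 2 e, and the expansion needs e <= 1. *)
pose e0 : R := Num.min 1 (kappa / 2).
have e00 : 0 < e0 by rewrite lt_min ltr01 divr_gt0.
pose e (k : nat) : R := e0 * k.+1%:R^-1.
have ek0 k : 0 < e k by rewrite mulr_gt0.
have ele k : e k <= e0 by rewrite ler_piMr ?invf_le1 ?ler1n// ltW.
have ek1 k : e k <= 1 by apply: le_trans (ele k) _; rewrite ge_min lexx.
have ekk k : 2 * e k <= kappa.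
  rewrite mulrC -ler_pdivlMr//; apply: le_trans (ele k) _.
  by rewrite ge_min lexx orbT.
have [q1 q1P] := choice (fun k => S1 (e k) (ek0 k) (ek1 k) (ekk k)).
have [q2 q2P] := choice (fun k => S2 (e k) (ek0 k) (ek1 k) (ekk k)).
have [b1 b1P] : {b : nat -> R & forall k, 0 <= b k /\ \forall z \ae @dtdxdv R n, `|q1 k z| <= b k}.
  apply: (@choice nat R (fun k b => 0 <= b /\ \forall z \ae @dtdxdv R n, `|q1 k z| <= b)) => k.
  by have [_ _ _ [b b0 bP] _] := q1P k; exists b.
have [b2 b2P] : {b : nat -> R & forall k, 0 <= b k /\ \forall z \ae @dtdxdv R n, `|q2 k z| <= b k}.
  apply: (@choice nat R (fun k b => 0 <= b /\ \forall z \ae @dtdxdv R n, `|q2 k z| <= b)) => k.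
  by have [_ _ _ [b b0 bP] _] := q2P k; exists b.
pose g k := gdat phi (e k); pose h k := hdat phi (e k).
pose F1 k := solution Om T K1 (g k) (h k); pose F2 k := solution Om T K2 (g k) (h k).
pose w v := weight phi psih v.
pose P z := (forall k, [/\ U z -> Q K1 (F1 k) (F1 k) z = q1 k z,
    U z -> Q K2 (F2 k) (F2 k) z = q2 k z, `|q1 k z| <= b1 k + b2 k, `|q2 k z| <= b1 k + b2 k &
    `|q1 k z - q2 k z - e k ^+ 2 * (d z * w z.2)| <= (c1 + c2) * e k ^+ 3]) /\
  (d z != 0 -> positive_weight z.2 -> 0 < w z.2).
pose tr z := forall k, transport Om (Q K1 (F1 k) (F1 k)) (g k) (h k) z =
                       transport Om (Q K2 (F2 k) (F2 k)) (g k) (h k) z.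
have sd k : small_data Om T kappa (g k, h k).
  by have [] := data_small Om T mphi phi0 phi1 (ek0 k) (ekk k).
exists P, tr; split.
- suff H : \forall z \ae @dtdxdv R n, forall k, [/\ U z -> Q K1 (F1 k) (F1 k) z = q1 k z,
    U z -> Q K2 (F2 k) (F2 k) z = q2 k z, `|q1 k z| <= b1 k + b2 k, `|q2 k z| <= b1 k + b2 k &
    `|q1 k z - q2 k z - e k ^+ 2 * (d z * w z.2)| <= (c1 + c2) * e k ^+ 3].
    apply: aeI (aeAnd mass1 mass2) H => z [k1 k2] Hz; split => // dz; apply.
    have [_] := qint_difference mphi phi0 phi1 mpsi mph1 mph2 k1 k2.
    by apply; rewrite -subr_eq0.
  apply/ae_foralln => k.
  have [_ Q1 _ _ E1] := q1P k; have [_ Q2 _ _ E2] := q2P k.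
  have [b10 B1] := b1P k; have [b20 B2] := b2P k.
  apply: aeS (aeAnd (aeAnd mass1 mass2) (aeAnd (aeAnd Q1 Q2) (aeAnd (aeAnd E1 E2) (aeAnd B1 B2)))).
  move=> z [[k1 k2] [[Q1z Q2z] [[E1z E2z] [B1z B2z]]]]; split => //.
  + by apply: (le_trans B1z); rewrite lerDl.
  + by apply: (le_trans B2z); rewrite lerDr.
  have [<- _] := qint_difference mphi phi0 phi1 mpsi mph1 mph2 k1 k2.
  rewrite [X in `|X|](_ : _ =
    (q1 k z - e k ^+ 2 * qint (kernel_ext ph1 psih) (fun z => phi z.2) z) -
    (q2 k z - e k ^+ 2 * qint (kernel_ext ph2 psih) (fun z => phi z.2) z)); last by ring.
  by apply: (le_trans (ler_normB _ _)); rewrite mulrDl; exact: lerD.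
- suff H : \forall z \ae @dtdSdv R n, forall k, cylinder T (Gamma_plus Om) z ->
      transport Om (Q K1 (F1 k) (F1 k)) (g k) (h k) z =
      transport Om (Q K2 (F2 k) (F2 k)) (g k) (h k) z.
    by apply: aeS H => z Hz Gz k; exact: Hz.
  by apply/ae_foralln => k; have [H _] := hA (sd k).
- suff H : \forall p \ae @dxdv R n, forall k, Om p.1 ->
      transport Om (Q K1 (F1 k) (F1 k)) (g k) (h k) (T, p.1, p.2) =
      transport Om (Q K2 (F2 k) (F2 k)) (g k) (h k) (T, p.1, p.2).
    by apply: aeS H => z Hz Gz k; exact: Hz.
  apply/ae_foralln => k; have [_ H] := hA (sd k).
  by apply: aeS H => -[x v] /= H Ox; exact: H.
move=> t x v Cx t0 tT wv trt gs.
have [md db] : measurable_fun setT d /\ forall z, `|d z| <= M1 + M1.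
  split; first exact: measurable_funB.
  by move=> z; apply: (le_trans (ler_normB _ _)); exact: lerD.
have good k : \forall s \ae @dt R, let z := (t - s, x - s *: v, v) in
     [/\ U z -> Q K1 (F1 k) (F1 k) z = q1 k z, U z -> Q K2 (F2 k) (F2 k) z = q2 k z,
         `|q1 k z| <= b1 k + b2 k, `|q2 k z| <= b1 k + b2 k &
         `|q1 k z - q2 k z - e k ^+ 2 * (d z * w v)| <= (c1 + c2) * e k ^+ 3].
  by apply: aeS gs => s [H _]; exact: H.
have ecv : e @ \oo --> 0.
  rewrite -(mulr0 e0); apply: cvgM; first exact: cvg_cst.
  exact: cvg_harmonic.
have := @ray_vanishes R n Om T oO cO t x v _ _ g h q1 q2 d (w v) (c1 + c2) (M1 + M1) e
  (fun k => b1 k + b2 k) Cx t0 tT.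
move/(_ _ _ (fun k => let: And5 m _ _ _ _ := q1P k in m) (fun k => let: And5 m _ _ _ _ := q2P k in m)
  (fun k => let: And5 _ _ z _ _ := q1P k in z) (fun k => let: And5 _ _ z _ _ := q2P k in z)
  md db trt good _ ek0 ecv (addr_ge0 c10 c20)).
move=> /(_ (fun k => addr_ge0 (proj1 (b1P k)) (proj1 (b2P k)))) /eqP.
(* If the weight is zero, the last clause of P excludes d <> 0 at almost every point of the ray, so
   the integral vanishes anyway. *)
rewrite mulf_eq0 => /orP[/eqP w0|/eqP//].
transitivity (\int[@dt R]_(s in `]0, t[) (fun _ : R => 0) s).
  apply: Rintegral_ae; apply: aeS gs => s [_ Hs] _.
  apply/eqP/negPn/negP => /Hs /(_ wv); rewrite /= w0 ltxx//.
by rewrite Rintegral_cst ?mul0r//; exact: measurable_itv.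
Qed.

Lemma top_rays : \forall p \ae @dxdv R n, Om p.1 -> positive_weight p.2 ->
  \int[@dt R]_(s in `]0, T[) d (T - s, p.1 - s *: p.2, p.2) = 0.
Proof.
have [P [tr [/(@ae_line_top _ _ T) aeP _ aetr ray]]] := ray_good.
apply: aeI aeP aetr => -[x v] /= Pxv trxv Ox wv.
by apply: ray => //; [exact: subset_closure|exact: trxv].
Qed.

(** [outgoing] puts (top y, v) into Gamma_plus, so equality of the traces applies there;
    [ae_surface_proj] and [ae_line_side] bring both exceptional sets to the same parameters y, t,
    v. *)
Lemma side_rays (D r : R) (A : set V) : smooth_boundary Om -> 0 < D ->
  (forall x, Om x -> `|x| <= D) -> 0 < r -> measurable A ->
  (forall v, A v -> transverse (4 * D / r) v) ->
  \forall y \ae lebesgue_row m.+1, \forall t \ae @dt R, \forall v \ae @lebesgue_row R n,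
    inner Om (r + r) y -> A v -> positive_weight v -> 0 < t < T ->
    \int[@dt R]_(s in `]0, t[) d (t - s, top Om y - s *: v, v) = 0.
Proof.
move=> sO D0 bO r0 mA At.
have [P [tr [aeP aetr _ ray]]] := ray_good.
have rr0 : 0 < r + r by exact: addr_gt0.
have L0 : 0 < 4 * D / r by rewrite divr_gt0// mulr_gt0.
have lip y y' : inner Om (r + r) y -> inner Om (r + r) y' ->
    `|height Om y - height Om y'| <= 4 * D / r * `|y - y'|.
  have sub z : inner Om (r + r) z -> inner Om r z.
    by move=> Iz; apply: (inner_near Iz); rewrite subrr normr0 ltW.
  by move=> /sub Iy /sub Iy'; have := @height_lipschitz R m Om D oO cO bO r y y' r0 Iy Iy'.
have H1 := ae_line_side (measurable_height oO bO) (measurable_inner Om (r + r)) mA (ltW L0) lip At aeP.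
have H2 : \forall y \ae lebesgue_row m.+1, \forall t \ae @dt R, \forall v \ae @lebesgue_row R n,
    cylinder T (Gamma_plus Om) (t, top Om y, v) -> tr (t, top Om y, v).
  have /ae_ysection/ae_surface_proj := ae_xsection aetr.
  by apply: aeS => y; exact.
apply: aeI H1 H2 => y; apply: aeI => t; apply: aeI => v Pv trv Iy Av wv /andP[t0 tT].
apply: ray => //.
- by apply: (height_closure oO bO); exact: inner_sub rr0 Iy.
- exact: ltW.
- apply: trv; split => /=; first by rewrite t0.
  by apply: (outgoing oO cO D0 bO sO r0 Iy); apply: transverse_tail (At _ Av).
- exact: Pv.
Qed.

End rays.

Section Rintegral_lemmas.
Context d (T : measurableType d) (R : realType) (mu : {measure set T -> \bar R}).

Lemma Rintegral_support (D : set T) (f : T -> R) : (forall x, ~ D x -> f x = 0) ->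
  \int[mu]_(x in D) f x = \int[mu]_x f x.
Proof.
move=> f0; rewrite /Rintegral integral_mkcond; congr fine; apply: eq_integral => x _.
by rewrite /patch; case: ifPn => //; rewrite notin_setE => /f0 ->.
Qed.

Lemma bounded_cvg_Rintegral0 (D : set T) (f : nat -> T -> R) (g : T -> R) (B : R) :
  measurable D -> (mu D < +oo)%E ->
  (forall k, measurable_fun setT (f k)) -> measurable_fun setT g ->
  (forall k x, `|f k x| <= B) -> (forall x, D x -> f ^~ x @ \oo --> g x) ->
  (forall k, \int[mu]_(x in D) f k x = 0) -> \int[mu]_(x in D) g x = 0.
Proof.
move=> mD muD mf mg fB fg f0.
have ib (h : T -> R) : measurable_fun setT h -> (forall x, `|h x| <= B) -> mu.-integrable D (EFin \o h).
  move=> mh hB; have [] := @Rintegral_ae_bound _ T R mu D h `|B| mD muD mh (normr_ge0 _) _ => //.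
  by apply: aeW => x _; exact: le_trans (hB x) (ler_norm _).
have iB : mu.-integrable D (EFin \o cst `|B|).
  have [] := @Rintegral_ae_bound _ T R mu D (cst `|B|) `|B| mD muD _ (normr_ge0 _) _ => //.
  by apply: aeW => x _; rewrite normr_id.
have [|||||_ _] := @dominated_convergence _ T R mu D mD (fun k => EFin \o f k) (EFin \o g) (EFin \o cst `|B|).
- by move=> k; apply/measurable_EFinP; exact: measurable_funTS.
- by apply/measurable_EFinP; exact: measurable_funTS.
- by apply: aeW => x Dx; apply: cvg_EFin; [exact: nearW|exact: fg].
- by [].
- by apply: aeW => x k Dx; rewrite lee_fin; apply: le_trans (fB k x) (ler_norm _).
have -> : (fun k => \int[mu]_(x in D) (EFin \o f k) x)%E = cst 0%E.
  apply/funext => k /=; have ik := ib _ (mf k) (fB k).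
  have := f0 k; rewrite /Rintegral => h.
  by rewrite -(fineK (integrable_fin_num mD ik)) /= h.
by move=> /(cvg_lim (@ereal_hausdorff R)); rewrite lim_cst// /Rintegral => <-.
Qed.

End Rintegral_lemmas.

Lemma Rintegral_shift1 (R : realType) (a : R) (f : R -> R) :
  measurable_fun setT (f : measurableTypeR R -> R) ->
  \int[@dt R]_s f (s + a) = \int[@dt R]_s f s.
Proof.
move=> mf; rewrite /Rintegral; congr fine.
have me : measurable_fun setT (EFin \o f : measurableTypeR R -> \bar R) by exact/measurable_EFinP.
rewrite integralE [RHS]integralE; congr (_ - _)%E.
  rewrite -(ge0_integral_shift1 a (measurable_funepos me) (funepos_ge0 _)).
  by apply: eq_integral => x _; rewrite !funeposE.
rewrite -(ge0_integral_shift1 a (measurable_funeneg me) (funeneg_ge0 _)).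
by apply: eq_integral => x _; rewrite !funenegE.
Qed.

Lemma Rintegral_shift_row (R : realType) n (a : 'rV[R]_n) (f : 'rV[R]_n -> R) :
  measurable_fun setT f ->
  \int[lebesgue_row n]_s f (s + a) = \int[lebesgue_row n]_s f s.
Proof.
move=> mf; rewrite /Rintegral; congr fine.
have me : measurable_fun setT (EFin \o f) by exact/measurable_EFinP.
rewrite integralE [RHS]integralE; congr (_ - _)%E.
  rewrite -(ge0_integral_shift_row a (measurable_funepos me) (funepos_ge0 _)).
  by apply: eq_integral => x _; rewrite !funeposE.
rewrite -(ge0_integral_shift_row a (measurable_funeneg me) (funeneg_ge0 _)).
by apply: eq_integral => x _; rewrite !funenegE.
Qed.

Lemma cvg_of_le_harmonic (R : realType) (W : normedModType R) (u : nat -> W) (l : W) :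
  (forall k, `|u k - l| <= k.+1%:R^-1) -> u @ \oo --> l.
Proof.
move=> H; apply/cvgrPdist_le => e e0.
have : \forall k \near \oo, `|0 - (k.+1%:R^-1 : R)| <= e.
  by have /cvgrPdist_le := @cvg_harmonic R; exact.
apply: filterS => k; rewrite sub0r normrN distrC => h.
by apply: le_trans (H k) (le_trans (ler_norm _) h).
Qed.

(** * From almost all rays to all rays *)

Section all_rays.
Context {R : realType} {m : nat}.
Local Notation n := m.+2.
Local Notation V := 'rV[R]_n.
Local Notation TR := (measurableTypeR R).
Local Notation Z := (TR * V * V)%type.
Variables (Om : set V) (T D a B : R) (V0 : set V) (fb : R * V * R -> R).
Hypotheses (oO : open Om) (cO : convex_set Om) (T0 : 0 < T) (D0 : 0 < D)
  (bO : forall x, Om x -> `|x| <= D) (a0 : 0 < a).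
Hypotheses (oV : open V0) (V0t : forall v, V0 v -> transverse (16 * D / a) v).
Let dz (z : Z) := fb (z.1.1, z.1.2, enorm z.2).
Hypotheses (mfb : measurable_fun setT dz) (fbB : forall p, `|fb p| <= B)
  (fbO : forall t x r, fb (t, x, r) != 0 -> 0 < t < T /\ Om x)
  (fb_supp : forall t x v, V0 v -> fb (t, x, enorm v) != 0 ->
     [/\ 0 < t, t < T & forall y, `|y - x| < a -> Om y])
  (fb_cont : forall t x v, V0 v -> {for (t, x, enorm v), continuous fb}).
Hypothesis top0 : \forall p \ae @dxdv R n, Om p.1 -> V0 p.2 ->
  \int[@dt R]_(s in `]0, T[) dz (T - s, p.1 - s *: p.2, p.2) = 0.
Hypothesis side0 : \forall y \ae lebesgue_row m.+1, \forall t \ae @dt R,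
  \forall v \ae @lebesgue_row R n, inner Om (a / 4 + a / 4) y -> V0 v -> 0 < t < T ->
    \int[@dt R]_(s in `]0, t[) dz (t - s, top Om y - s *: v, v) = 0.

Definition ray (t : R) (x v : V) : R := \int[@dt R]_s fb (t - s, x - s *: v, enorm v).

Let mray (t : R) (x v : V) :
  measurable_fun setT (fun s : TR => fb (t - s, x - (s : R) *: v, enorm v)).
Proof.
have ml : measurable_fun setT (fun s : TR => (t - (s : R), x - (s : R) *: v, v) : Z).
  by apply: (@measurable_line _ _ _ _ (cst t) id (cst x) (cst v)).
exact: (measurableT_comp mfb ml).
Qed.

Let ray_shift (c t : R) (x v : V) : ray (t + c) (x + c *: v) v = ray t x v.
Proof.
rewrite /ray -[LHS](Rintegral_shift1 c (mray (t + c) (x + c *: v) v)).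
apply: eq_Rintegral => s _; congr (fb (_, _, _)); first by ring.
by apply/rowP => i; rewrite !mxE; ring.
Qed.

Let ray_cut (t : R) (x v : V) : 0 < t ->
  (forall s, s <= 0 -> fb (t - s, x - s *: v, enorm v) = 0) ->
  \int[@dt R]_(s in `]0, t[) dz (t - s, x - s *: v, v) = ray t x v.
Proof.
move=> t0 H; apply: Rintegral_support => s; rewrite /= in_itv /= => /negP.
rewrite negb_and -!leNgt => /orP[/H//|ts].
by apply/eqP/negPn/negP => /fbO[/andP[]]; rewrite subr_gt0 ltNge ts.
Qed.

(** Dominated convergence: [fb] is continuous at all points of the limit ray, also across the
    boundary, and only s in [-T, T] contribute because [fb] is supported in times between 0 and
    T. *)
Let ray_limit (t : R) (x v : V) (tk : nat -> R) (xk vk : nat -> V) : 0 <= t -> t <= T ->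
  V0 v -> (forall k, 0 <= tk k /\ tk k <= T) ->
  tk @ \oo --> t -> xk @ \oo --> x -> vk @ \oo --> v ->
  (forall k, ray (tk k) (xk k) (vk k) = 0) -> ray t x v = 0.
Proof.
move=> t0 tT Vv tkT ct cx cv r0.
have cut t' x' v' : 0 <= t' -> t' <= T ->
    \int[@dt R]_(s in `[- T, T]) fb (t' - s, x' - s *: v', enorm v') = ray t' x' v'.
  move=> t'0 t'T; apply: Rintegral_support => s; rewrite /= in_itv /= => nT.
  apply/eqP/negPn/negP => /fbO[/andP[h1 h2] _]; apply: nT; apply/andP; split; lra.
rewrite -cut//; apply: (@bounded_cvg_Rintegral0 _ _ R (@dt R) `[- T, T]%classic
  (fun k s => fb (tk k - s, xk k - (s : R) *: vk k, enorm (vk k)))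
  (fun s => fb (t - s, x - (s : R) *: v, enorm v)) B) => //.
- by rewrite /dt /= lebesgue_measure_itv/=; case: ifPn => // _; rewrite -EFinB ltry.
- move=> s _.
  have c1 : (fun k => tk k - s) @ \oo --> t - s by apply: cvgB => //; exact: cvg_cst.
  have c2 : (fun k => xk k - s *: vk k) @ \oo --> x - s *: v.
    by apply: cvgB => //; apply: cvgZ => //; exact: cvg_cst.
  have c3 : (fun k => enorm (vk k)) @ \oo --> enorm v by exact: cvg_enorm.
  exact: (cvg_comp _ _ (cvg_pair (cvg_pair c1 c2) c3) (@fb_cont (t - s) (x - s *: v) v Vv)).
- by move=> k; have [k0 kT] := tkT k; rewrite cut.
Qed.

Let pick (U : set V) (x : V) (P : V -> Prop) : open U ->
  closure U x -> (\forall z \ae @lebesgue_row R n, P z) ->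
  forall k : nat, exists z, [/\ U z, P z & `|z - x| <= k.+1%:R^-1].
Proof.
move=> oU Ux aeP k; have k0 : 0 < (k.+1%:R^-1 : R) by [].
have [y [Uy By]] := Ux _ (nbhsx_ballx x _ k0).
have [z [Uz Bz] Pz] := @ae_row_meets R n (U `&` ball x k.+1%:R^-1) P
  (openI oU (ball_open x _)) (ex_intro _ y (conj Uy By)) aeP.
exists z; split => //; move: Bz; rewrite mx_norm_ball /ball_ /= distrC; exact: ltW.
Qed.

Lemma ray_top x v : closure Om x -> V0 v -> ray T x v = 0.
Proof.
move=> Cx Vv; have H := ae_xsection top0.
have H1 k : exists p, [/\ Om p.1, V0 p.2, `|p.1 - x| <= k.+1%:R^-1,
   `|p.2 - v| <= k.+1%:R^-1 & ray T p.1 p.2 = 0].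
  have [x' [Ox' Hx' xx']] := pick oO Cx H k.
  have [v' [Vv' Hv' vv']] := pick oV (subset_closure Vv) Hx' k.
  exists (x', v'); split => //=; rewrite -(Hv' Ox' Vv') ray_cut// => s s0.
  by apply/eqP/negPn/negP => /fbO[/andP[_ h] _]; move: h s0; lra.
have [p pP] := choice H1.
apply: (@ray_limit T x v (fun=> T) (fun k => (p k).1) (fun k => (p k).2)) => //.
- exact: ltW.
- by move=> _; rewrite (ltW T0) lexx.
- exact: cvg_cst.
- by apply: cvg_of_le_harmonic => k; have [] := pP k.
- by apply: cvg_of_le_harmonic => k; have [] := pP k.
- by move=> k; have [] := pP k.
Qed.

(** Triples (y', t', v') with vanishing integral accumulate at (y, t, v), and [top y'] tends to
    [top y] by the Lipschitz bound. *)
Lemma ray_side y v (t : R) : inner Om (3 / 4 * a) y -> V0 v -> 0 < t -> t < T ->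
  ray t (top Om y) v = 0.
Proof.
move=> Iy Vv t0 tT.
have L0 : 0 < 16 * D / a by rewrite divr_gt0// mulr_gt0.
have r0 : 0 < a / 4 by rewrite divr_gt0.
have LE : 4 * D / (a / 4) = 16 * D / a by field; rewrite gt_eqF.
have Ia y' : `|y' - y| < a / 4 -> inner Om (a / 4 + a / 4) y'.
  move=> yy; apply: (@inner_near _ _ _ _ (a / 4) y); last exact: ltW.
  by rewrite (_ : a / 4 + a / 4 + a / 4 = 3 / 4 * a)//; field.
(* The line does not re-enter Om beyond its exit: it lies in Om just before [top y'], and convexity
   would put [top y'] itself into Om. Hence cutting the integral at s = 0 loses nothing. *)
have outside y' v' s : inner Om (a / 4 + a / 4) y' -> V0 v' -> 0 <= s ->
    ~ Om (top Om y' + s *: v').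
  move=> Iy' /V0t tv; rewrite le_eqVlt => /orP[/eqP <-|s0].
    by rewrite scale0r addr0; have := @height_notin R m Om D oO bO y'.
  have := transverse_tail L0 tv; rewrite -LE.
  move=> /(below_graph oO cO D0 bO r0 Iy')[eta eta0 Oeta] Os.
  have e2 : 0 < eta / 2 by rewrite divr_gt0.
  have Oe : Om (top Om y' - (eta / 2) *: v').
    by apply: Oeta => //; rewrite ltr_pdivrMr// ltr_pMr// ltr1n.
  pose l := eta / 2 / (s + eta / 2).
  have l0 : 0 <= l by rewrite divr_ge0 ?addr_ge0// ltW.
  have l1 : l <= 1 by rewrite ler_pdivrMr ?addr_gt0// mul1r lerDr ltW.
  have := convex_combination cO l0 l1 Os Oe.
  rewrite (_ : l *: _ + _ = top Om y'); first by have := @height_notin R m Om D oO bO y'.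
  apply/rowP => i; rewrite !mxE /l; field.
  by apply: lt0r_neq0; move: s0 eta0; lra.
have H1 k : exists p : ('rV[R]_m.+1 * R * V)%type, [/\ 0 <= p.1.2 /\ p.1.2 <= T,
    `|top Om p.1.1 - top Om y| <= k.+1%:R^-1,
    `|p.1.2 - t| <= k.+1%:R^-1, `|p.2 - v| <= k.+1%:R^-1 & ray p.1.2 (top Om p.1.1) p.2 = 0].
  have k0 : 0 < (k.+1%:R^-1 : R) by [].
  (* The first bound keeps y' in the inner region, the second compensates the Lipschitz constant 16
     D / a of the graph. *)
  pose q := Num.min (a / 4) (k.+1%:R^-1 / (1 + 16 * D / a)).
  have q0 : 0 < q by rewrite lt_min r0 divr_gt0// addr_gt0.
  have [y' By Hy] := ae_row_meets (ball_open y q) (ex_intro _ y (ballxx y q0)) side0.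
  move: By; rewrite mx_norm_ball /ball_ /= distrC /q lt_min => /andP[/Ia Iy' yq].
  have [|t' /andP[t1 t2] Ht] := @ae_itv_meets R (Num.max 0 (t - k.+1%:R^-1))
      (Num.min T (t + k.+1%:R^-1)) _ _ Hy.
    move: k0; set c := _^-1 => c0; rewrite lt_min !gt_max T0 /=; apply/and3P; split; lra.
  have [v' [Vv' Hv vv]] := pick oV (subset_closure Vv) Ht k.
  move: t1 t2; rewrite gt_max lt_min => /andP[t'0 t'1] /andP[t'T t'2].
  exists (y', t', v'); split => //=.
  - by split; exact: ltW.
  - rewrite /top -scaleN1r row_cons_scale row_cons_add mulN1r scaleN1r.
    have yk : `|y' - y| <= k.+1%:R^-1.
      apply: le_trans (ltW yq) _; rewrite ler_pdivrMr ?addr_gt0//.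
      by rewrite ler_peMr ?lerDl ?(ltW L0) ?(ltW k0).
    apply: row_cons_norm => //.
    have I1 z : inner Om (a / 4 + a / 4) z -> inner Om (a / 4) z.
      by move=> Iz; apply: (inner_near Iz); rewrite subrr normr0 ltW.
    have Iy1 : inner Om (a / 4 + a / 4) y by apply: Ia; rewrite subrr normr0.
    apply: (le_trans (height_lipschitz oO cO bO r0 (I1 _ Iy') (I1 _ Iy1))).
    rewrite LE; move: yq; rewrite ltr_pdivlMr ?addr_gt0// => /ltW; apply: le_trans.
    by rewrite mulrC ler_wpM2l// lerDr.
  - move: t'1 t'2; set c := _^-1 => h1 h2; rewrite ler_distl; apply/andP; split; lra.
  rewrite -(Hv Iy' Vv') ?t'0// ray_cut// => s s0.
  apply/eqP/negPn/negP => /fbO[_].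
  rewrite (_ : top Om y' - s *: v' = top Om y' + (- s) *: v'); last by rewrite scaleNr.
  by apply: outside; rewrite ?oppr_ge0.
have [p pP] := choice H1.
apply: (@ray_limit t _ v (fun k => (p k).1.2) (fun k => top Om (p k).1.1) (fun k => (p k).2)) => //.
- exact: ltW.
- exact: ltW.
- by move=> k; have [] := pP k.
- by apply: cvg_of_le_harmonic => k; have [] := pP k.
- by apply: cvg_of_le_harmonic => k; have [] := pP k.
- by apply: cvg_of_le_harmonic => k; have [] := pP k.
- by move=> k; have [] := pP k.
Qed.

(** A ray that meets the support has a point p of depth a at a time u between 0 and T. From p it
    either leaves through the graph before time T, or is still in the closure of Om at time T.
    Shifting along the ray identifies its integral with one of the two known ones. *)
Lemma ray_zero b v : V0 v -> ray 0 b v = 0.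
Proof.
move=> Vv; have [E|] := pselect (forall s, fb (0 - s, b - s *: v, enorm v) = 0).
  transitivity (\int[@dt R]_s (fun _ : R => 0) s); last by rewrite Rintegral_cst ?mul0r.
  by apply: eq_Rintegral => s _; exact: E.
move=> /existsNP[s' /eqP]; pose u := - s'; pose p := b + u *: v.
rewrite sub0r -/u (_ : b - _ = p); last by rewrite /p /u scaleNr.
move=> /(fb_supp Vv)[u0 uT pO].
have [s [y [s0 py Iy before]]] := exit_graph oO cO D0 bO a0 pO (V0t Vv).
have E t : b + t *: v = p + (t - u) *: v by rewrite /p scalerBl addrC addrACA subrr addr0 addrC.
have [tT|Tt] := ltP (u + s) T.
  have := @ray_side y v (u + s) Iy Vv (addr_gt0 u0 s0) tT.
  have -> : top Om y = b + (u + s) *: v by rewrite -py E [u + s]addrC addrK.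
  by rewrite -{1}(add0r (u + s)) ray_shift.
have <- : ray T (b + T *: v) v = ray 0 b v by rewrite -{1}(add0r T) ray_shift.
apply: ray_top => //; rewrite E.
have Tu : 0 < T - u by rewrite subr_gt0.
move: Tt; rewrite -lerBlDl le_eqVlt => /orP[/eqP ->|lt]; last first.
  by apply: subset_closure; apply: before => //; exact: ltW.
rewrite py; apply: (height_closure oO bO); apply: inner_sub Iy; rewrite mulr_gt0//.
Qed.

End all_rays.

(** * Injectivity of the light-ray transform *)

Lemma Rintegral_swap d1 d2 (T1 : measurableType d1) (T2 : measurableType d2) (R : realType)
    (m1 : {sigma_finite_measure set T1 -> \bar R})
    (m2 : {sigma_finite_measure set T2 -> \bar R}) (k : T1 * T2 -> R) :
  (prod_measure m1 m2).-integrable setT (EFin \o k) ->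
  \int[m1]_x \int[m2]_y k (x, y) = \int[m2]_y \int[m1]_x k (x, y).
Proof.
move=> ik; rewrite (Rintegral_fubini ik) /Rintegral; congr fine.
have /= <- := @integral21_prod_meas1 _ _ _ _ R m1 m2 (EFin \o k) ik.
apply: integral_ae; have := @ae_integrable2 _ _ _ _ R m1 m2 (EFin \o k) ik.
apply: aeS => y iy _; rewrite fineK//.
exact: (integrable_fin_num measurableT iy).
Qed.

Lemma poly_zero_on_itv (R : realType) (k : nat) (c : nat -> R) (a0 a1 : R) : a0 < a1 ->
  (forall a, a0 <= a -> a <= a1 -> \sum_(i < k.+1) c i * a ^+ i = 0) ->
  forall i, (i <= k)%N -> c i = 0.
Proof.
move=> a01 H i ik; pose p := \poly_(i < k.+1) c i.
have pE a : p.[a] = \sum_(i < k.+1) c i * a ^+ i by rewrite horner_poly.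
pose x (j : nat) : R := a0 + (a1 - a0) * j.+1%:R^-1.
have da : 0 < a1 - a0 by rewrite subr_gt0.
suff p0 : p = 0 by have := coef0 R i; rewrite -p0 coef_poly ltnS ik.
apply: (@roots_geq_poly_eq0 _ p [seq x j | j <- iota 0 k.+1]).
- apply/allP => _ /mapP[j _ ->]; rewrite /root pE; apply/eqP/H.
    by rewrite lerDl mulr_ge0// ltW.
  rewrite -lerBrDl ler_piMr ?(ltW da)//.
  by rewrite invf_le1// ler1n.
- rewrite map_inj_uniq ?iota_uniq// => j1 j2 /addrI/(mulfI (lt0r_neq0 da))/invr_inj/eqP.
  by rewrite eqr_nat => /eqP [].
- by rewrite size_map size_iota size_poly.
Qed.

Lemma support_integrable d (X : measurableType d) (R : realType)
    (mu : {measure set X -> \bar R}) (D : set X) (h : X -> R) (C : R) :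
  measurable D -> (mu D < +oo)%E -> measurable_fun setT h ->
  (forall x, D x -> `|h x| <= C) -> (forall x, ~ D x -> h x = 0) ->
  mu.-integrable setT (EFin \o h).
Proof.
move=> mD muD mh hC h0.
have [] := @Rintegral_ae_bound _ X R mu D h `|C| mD muD mh (normr_ge0 _).
  by apply: aeW => x /hC; move/le_trans; apply; exact: ler_norm.
move=> /(integrable_mkcond _ mD) + _; congr (mu.-integrable _ _).
by apply/funext => x; rewrite /patch; case: ifPn => //; rewrite notin_setE => /h0 /= ->.
Qed.

Section weighted_integral.
Context d (X : measurableType d) (R : realType) (mu : {measure set X -> \bar R}).
Variables (S : set X) (f : X -> R) (B : R).
Hypotheses (mS : measurable S) (muS : (mu S < +oo)%E) (mf : measurable_fun setT f)
  (fB : forall z, `|f z| <= B).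

Definition tame (p : X -> R) := measurable_fun setT p /\ exists C, forall z, S z -> `|p z| <= C.

Definition pairing (p : X -> R) : R := \int[mu]_(z in S) (f z * p z).

Lemma tame_cst c : tame (cst c).
Proof. by split => //; exists `|c| => z _. Qed.

Lemma tameD p q : tame p -> tame q -> tame (p \+ q).
Proof.
move=> [mp [C pC]] [mq [E qE]]; split; first exact: measurable_funD.
by exists (C + E) => z Sz; apply: (le_trans (ler_normD _ _)); apply: lerD; [exact: pC|exact: qE].
Qed.

Lemma tameM p q : tame p -> tame q -> tame (p \* q).
Proof.
move=> [mp [C pC]] [mq [E qE]]; split; first exact: measurable_funM.
by exists (C * E) => z Sz; rewrite normrM; apply: ler_pM => //; [exact: pC|exact: qE].
Qed.

Lemma tameX p k : tame p -> tame (fun z => p z ^+ k).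
Proof.
move=> tp; elim: k => [|k IH].
  by rewrite (_ : (fun _ => _) = cst 1); [exact: tame_cst|apply/funext => z; rewrite expr0].
rewrite (_ : (fun _ => _) = p \* (fun z => p z ^+ k)); first exact: tameM.
by apply/funext => z; rewrite exprS.
Qed.

Lemma tame_sum (I : Type) (r : seq I) (p : I -> X -> R) : (forall i, tame (p i)) ->
  tame (fun z => \sum_(i <- r) p i z).
Proof.
move=> tp; elim: r => [|i r IH].
  by rewrite (_ : (fun _ => _) = cst 0); [exact: tame_cst|apply/funext => z; rewrite big_nil].
rewrite (_ : (fun _ => _) = p i \+ (fun z => \sum_(j <- r) p j z)); first exact: tameD.
by apply/funext => z; rewrite big_cons.
Qed.

Lemma tame_integrable p : tame p -> mu.-integrable S (EFin \o (fun z => f z * p z)).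
Proof.
move=> [mp [C pC]].
have [] := @Rintegral_ae_bound _ X R mu S (fun z => f z * p z) `|B * C| mS muS => //.
- exact: measurable_funM.
- apply: aeW => z Sz; apply: le_trans (ler_norm _); rewrite normrM.
  by apply: ler_pM => //; exact: pC.
Qed.

Lemma pairingD p q : tame p -> tame q -> pairing (p \+ q) = pairing p + pairing q.
Proof.
move=> tp tq; rewrite /pairing -RintegralD//; try exact: tame_integrable.
by apply: eq_Rintegral => z _; rewrite mulrDr.
Qed.

Lemma pairingZ c p : tame p -> pairing (fun z => c * p z) = c * pairing p.
Proof.
move=> tp; rewrite /pairing -RintegralZl//; last exact: tame_integrable.
by apply: eq_Rintegral => z _; rewrite mulrCA.
Qed.

Lemma pairing_sum (I : Type) (r : seq I) (p : I -> X -> R) : (forall i, tame (p i)) ->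
  pairing (fun z => \sum_(i <- r) p i z) = \sum_(i <- r) pairing (p i).
Proof.
move=> tp; elim: r => [|i r IH].
  rewrite big_nil /pairing; transitivity (\int[mu]_(z in S) (fun _ : X => 0) z).
    by apply: eq_Rintegral => z _; rewrite big_nil mulr0.
  by rewrite Rintegral_cst ?mul0r.
rewrite big_cons -IH -pairingD//; last exact: tame_sum.
by congr pairing; apply/funext => z; rewrite big_cons.
Qed.

(* The pairing is a polynomial in a, so all of its coefficients vanish. *)
Lemma pairing_coef (p q1 q2 : X -> R) (k : nat) (a0 a1 : R) :
  tame p -> tame q1 -> tame q2 -> a0 < a1 ->
  (forall a, a0 <= a -> a <= a1 -> pairing (fun z => p z * (q1 z + a * q2 z) ^+ k) = 0) ->
  forall i, (i <= k)%N -> pairing (fun z => p z * (q1 z ^+ (k - i) * q2 z ^+ i)) = 0.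
Proof.
move=> tp t1 t2 a01 H i ik.
pose u i z := p z * (q1 z ^+ (k - i) * q2 z ^+ i).
have tu j : tame (u j) by apply: tameM => //; apply: tameM; exact: tameX.
suff : pairing (u i) * 'C(k, i)%:R = 0.
  by move/eqP; rewrite mulf_eq0 pnatr_eq0 -leqn0 leqNgt bin_gt0 ik orbF => /eqP.
apply: (@poly_zero_on_itv R k (fun j => pairing (u j) * 'C(k, j)%:R) a0 a1 a01 _ i ik) => a h0 h1.
rewrite -[RHS](H a h0 h1).
transitivity (\sum_(i < k.+1) pairing (fun z => (a ^+ i * 'C(k, i)%:R) * u i z)).
  by apply: eq_bigr => j _; rewrite pairingZ//; ring.
rewrite -pairing_sum.
  congr pairing; apply/funext => z; rewrite exprDn mulr_sumr; apply: eq_bigr => j _.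
  by rewrite /u exprMn -mulr_natr; ring.
by move=> j; apply: tameM => //; exact: tame_cst.
Qed.

End weighted_integral.

(** * Vanishing of all moments *)

Section moments.
Context {R : realType} {n : nat}.
Local Notation V := 'rV[R]_n.
Local Notation TR := (measurableTypeR R).
Local Notation X := (TR * V)%type.
Local Notation mu := (prod_measure (@dt R) (lebesgue_row n)).
Variables (T D B : R) (f : R * V -> R) (gam : R -> V).
Hypotheses (T0 : 0 < T) (D0 : 0 < D) (mf : measurable_fun setT (f : X -> R))
  (fB : forall z, `|f z| <= B) (fS : forall z, f z != 0 -> `|z.1| < T /\ `|z.2| < D).
Hypotheses (cg : continuous gam) (gam_ne : gam 0 != gam 1)
  (ray0 : forall sg, 0 <= sg -> sg <= 1 -> forall b,
    \int[@dt R]_s f (s, b - s *: gam sg) = 0).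

Definition slab : set X := `[- T, T]%classic `*` box 0 D.

Let mslab : measurable slab.
Proof. by apply: measurableX; [exact: measurable_itv|exact: measurable_box]. Qed.

Let slabP z : slab z <-> `|z.1| <= T /\ `|z.2| <= D.
Proof.
rewrite /slab /= in_itv /= -ler_norml; split => -[h1 h2]; split => //.
  by apply/row_norm_leP => [|i]; [exact: ltW|have := h2 i; rewrite mxE subr0].
by move=> i; rewrite mxE subr0; apply: le_trans h2; exact: coord_le_norm.
Qed.

Let box_fin (c e : R) : 0 <= c -> 0 <= e ->
  mu (`[- c, c]%classic `*` box 0 e) = (2 * c * (2 * e) ^+ n)%:E.
Proof.
move=> c0 e0; rewrite /prod_measure product_measure1E//; last exact: measurable_box.
rewrite lebesgue_row_box// EFinM; congr (_ * _)%E.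
rewrite /dt /= lebesgue_measure_itv/= lte_fin; case: ltP => h.
  by rewrite -EFinB; congr (_%:E); ring.
have -> : c = 0 by lra.
by rewrite mulr0.
Qed.

Let mu_slab : (mu slab < +oo)%E.
Proof. by rewrite box_fin ?ltry// ltW. Qed.

Local Notation tame := (tame slab).
Local Notation pairing := (pairing mu slab f).

Let tm (z : X) : R := z.1.
Let lin (xi : V) (z : X) : R := dot xi z.2.

Let tame_tm : tame tm.
Proof. by split; [exact: measurable_fst|exists T => z /slabP[]]. Qed.

Let tame_lin xi : tame (lin xi).
Proof.
split.
  apply: measurable_dot; first exact: measurable_cst.
  exact: measurable_snd.
exists (\sum_i `|xi ord0 i| * D) => z /slabP[_ zD].
apply: (le_trans (ler_norm_sum _ _ _)); apply: ler_sum => i _.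
by rewrite normrM ler_wpM2l//; apply: le_trans zD; exact: coord_le_norm.
Qed.

Let w := gam 1 - gam 0.

Let w0 : dot w w != 0.
Proof.
have : 0 < dot w w by rewrite -sqrtr_gt0; apply: enorm_gt0; rewrite subr_eq0 eq_sym.
by move=> h; rewrite gt_eqF.
Qed.

(** The extra factors t^j (xi . x)^k make the condition stable under multiplication by polynomials.
    The restriction on xi says that xi . gam takes different values at the two ends of the arc. *)
Definition moment (p : X -> R) := tame p /\ forall xi, dot xi w != 0 ->
  forall j k, pairing (fun z => p z * (tm z ^+ j * lin xi z ^+ k)) = 0.

(** The function x + t gam is constant along the rays, so Fubini in the coordinates (t, x + t gam)
    reduces the pairing to ray integrals. *)
Let ray_pairing sg (G : V -> R) : 0 <= sg -> sg <= 1 -> measurable_fun setT G ->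
  (forall r : R, exists C, forall y, `|y| <= r -> `|G y| <= C) ->
  pairing (fun z => G (z.2 + z.1 *: gam sg)) = 0.
Proof.
move=> s0 s1 mG Gb; pose g := gam sg.
have fG0 (c e : R) h : T <= c -> D <= e -> measurable_fun setT (h : X -> R) ->
    (exists C, forall z : X, `|z.1| <= c -> `|z.2| <= e -> `|h z| <= C) ->
    (forall z, h z != 0 -> `|z.1| < c /\ `|z.2| < e) ->
    mu.-integrable setT (EFin \o h).
  move=> Tc De mh [C hC] hS.
  have c0 : 0 <= c by exact: le_trans (ltW T0) Tc.
  have e0 : 0 <= e by exact: le_trans (ltW D0) De.
  pose Cs : set X := `[- c, c]%classic `*` box 0 e.
  have mC : measurable Cs.
    by apply: measurableX; [exact: measurable_itv|exact: measurable_box].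
  have muC : (mu Cs < +oo)%E by rewrite box_fin// ltry.
  apply: (@support_integrable _ _ R mu _ h C mC muC) => //.
  - move=> z [/= z1 z2]; apply: hC; first by move: z1; rewrite in_itv/= -ler_norml.
    by apply/row_norm_leP => // i; have := z2 i; rewrite mxE subr0.
  move=> z nz; apply/eqP/negPn/negP => /hS[h1 h2]; apply: nz; split => /=.
    by rewrite in_itv/= -ler_norml ltW.
  by move=> i; rewrite mxE subr0; apply: le_trans (coord_le_norm _ _) (ltW h2).
pose H (z : X) := f z * G (z.2 + z.1 *: g).
pose H' (z : X) := f (z.1, z.2 - z.1 *: g) * G z.2.
have mz : measurable_fun setT (fun z : X => (z.1 : R) *: g).
  by apply: measurable_rowZ; [exact: measurable_fst|exact: measurable_cst].
have mH : measurable_fun setT H.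
  apply: measurable_funM => //; apply: measurableT_comp => //.
  by apply: measurable_rowD => //; exact: measurable_snd.
have mH' : measurable_fun setT H'.
  apply: measurable_funM; last by apply: measurableT_comp => //; exact: measurable_snd.
  apply: (measurableT_comp (g := fun z : X => (z.1, z.2 - (z.1 : R) *: g) : X) mf).
  apply/measurable_fun_pairP; split => /=; first exact: measurable_fst.
  by apply: measurable_rowB => //; exact: measurable_snd.
have B0 : 0 <= B by exact: le_trans (fB (0, 0)).
have DT : D <= D + T * `|g| by rewrite lerDl mulr_ge0// ltW.
have zg (z : X) c : `|z.1| <= T -> `|z.2| <= c -> `|z.2 + z.1 *: g| <= c + T * `|g|.
  move=> z1 z2; apply: (le_trans (ler_normD _ _)); apply: lerD => //.
  by rewrite normrZ ler_wpM2r.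
have iH : mu.-integrable setT (EFin \o H).
  apply: (@fG0 T D) => //.
    have [C GC] := Gb (D + T * `|g|); exists (B * C) => z z1 z2.
    by rewrite normrM; apply: ler_pM => //; apply: GC; exact: zg.
  by move=> z; rewrite mulf_eq0 negb_or => /andP[/fS].
have iH' : mu.-integrable setT (EFin \o H').
  apply: (@fG0 T (D + T * `|g|)) => //.
    have [C GC] := Gb (D + T * `|g|); exists (B * C) => z z1 z2.
    by rewrite normrM; apply: ler_pM => //; exact: GC.
  move=> z; rewrite mulf_eq0 negb_or => /andP[/fS/= [h1 h2] _]; split => //.
  rewrite -(subrK (z.1 *: g) z.2); apply: (le_lt_trans (ler_normD _ _)).
  by rewrite normrZ ltr_leD// ler_wpM2r// ltW.
rewrite /pairing (Rintegral_support _ (f := H)); last first.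
  move=> z nz; apply/eqP/negPn/negP; rewrite mulf_eq0 negb_or => /andP[/fS[h1 h2] _].
  by apply: nz; apply/slabP; split; exact: ltW.
rewrite -Rintegral_fubini//.
transitivity (\int[@dt R]_s \int[lebesgue_row n]_y H' (s, y)).
  apply: eq_Rintegral => s _.
  rewrite -[RHS](@Rintegral_shift_row R n (s *: g)).
    by apply: eq_Rintegral => y _; rewrite /H' /= addrK.
  exact: measurable_section1.
rewrite Rintegral_swap//.
transitivity (\int[lebesgue_row n]_y (fun _ : V => 0) y); last by rewrite Rintegral_cst ?mul0r.
apply: eq_Rintegral => y _; rewrite /H' /=.
pose fy (s : TR) : R := f (s, y - (s : R) *: g).
have ify : (@dt R).-integrable setT (EFin \o fy).
  apply: (@support_integrable _ _ R (@dt R) `[- T, T]%classic fy B) => //.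
  - by rewrite /dt /= lebesgue_measure_itv/=; case: ifPn => // _; rewrite -EFinB ltry.
  - apply: (measurableT_comp (g := fun s : TR => (s, y - (s : R) *: g) : X) mf).
    apply/measurable_fun_pairP; split => /=; first exact: measurable_id.
    apply: measurable_rowB; first exact: measurable_cst.
    by apply: measurable_rowZ; [exact: measurable_id|exact: measurable_cst].
  - by move=> s _; exact: fB.
  move=> s ns; apply/eqP/negPn/negP => sn; apply: ns; have [/= h1 _] := fS sn.
  by rewrite /= in_itv/= -ler_norml ltW.
by rewrite RintegralZr// ray0// mul0r.
Qed.

Let dotZr (c : R) (x y : V) : dot x (c *: y) = c * dot x y.
Proof. by rewrite /dot mulr_sumr; apply: eq_bigr => i _; rewrite mxE mulrCA. Qed.

Let linD (x y : V) (c : R) z : lin (x + c *: y) z = lin x z + c * lin y z.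
Proof.
rewrite /lin /dot mulr_sumr -big_split; apply: eq_bigr => i _ /=; rewrite !mxE; ring.
Qed.

(** By the intermediate value theorem a = xi . gam runs through an interval. There the pairing with
    (xi . x + a t)^(j+k) vanishes, and its coefficient of a^j is a multiple of the moment sought. *)
Lemma moment_one : moment (cst 1).
Proof.
split=> [|xi xiw j k]; first exact: tame_cst.
pose tau sg := dot xi (gam sg).
have ct : continuous tau.
  move=> sg; apply: cvg_dot; [exact: cvg_cst|exact: cg].
have tne : tau 0 != tau 1.
  apply: contraNneq xiw => E; rewrite /w -scaleN1r dotDr dotZr -/(tau 1) -/(tau 0) E.
  by rewrite mulN1r subrr.
pose a0 := Num.min (tau 0) (tau 1); pose a1 := Num.max (tau 0) (tau 1).
have a01 : a0 < a1 by rewrite gt_min !lt_max ltxx/= ltxx orbF; case: ltgtP tne.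
have H a : a0 <= a -> a <= a1 ->
    pairing (fun z => cst 1 z * (lin xi z + a * tm z) ^+ (j + k)) = 0.
  move=> h0 h1.
  have [|sg] := @IVT R tau 0 1 a ler01 (continuous_subspaceT ct); first by rewrite h0.
  rewrite in_itv/= => /andP[s0 s1] <-.
  rewrite -[RHS](@ray_pairing sg (fun y => dot xi y ^+ (j + k)) s0 s1).
  - congr pairing; apply/funext => z; rewrite mul1r dotDr dotZr; congr (_ ^+ _).
    by rewrite /lin /tm mulrC.
  - apply: measurable_funX; apply: measurable_dot; [exact: measurable_cst|exact: measurable_id].
  move=> r; exists ((\sum_i `|xi ord0 i| * r) ^+ (j + k)) => y yr; rewrite normrX.
  rewrite lerXn2r ?nnegrE// ?sumr_ge0//.
    move=> i _; rewrite mulr_ge0//; exact: le_trans yr.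
  apply: (le_trans (ler_norm_sum _ _ _)); apply: ler_sum => i _.
  by rewrite normrM ler_wpM2l//; apply: le_trans yr; exact: coord_le_norm.
have := pairing_coef mslab mu_slab mf fB (tame_cst _ 1) (tame_lin xi) tame_tm a01 H (leq_addr k j).
rewrite addKn => E; rewrite -[RHS]E; congr pairing; apply/funext => z.
by congr (_ * _); exact: mulrC.
Qed.

(** The condition on directions is open: eta + a xi remains admissible for small a, even if xi is
    not. The coefficient of a in (eta . x + a xi . x)^(k+1) produces the factor xi . x. *)
Lemma moment_lin p xi : moment p -> moment (p \* lin xi).
Proof.
move=> [tp mp]; split=> [|eta etaw j k]; first exact: tameM.
(* Then e |xi . w| < |eta . w|, so eta . w + a xi . w is nonzero for 0 <= a <= e. *)
pose e := `|dot eta w| / (1 + `|dot xi w|) / 2.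
have k0 : 0 < 1 + `|dot xi w| by rewrite ltr_pwDl.
have e0 : 0 < e by rewrite !divr_gt0// normr_gt0.
have H a : 0 <= a -> a <= e ->
    pairing (fun z => (p z * tm z ^+ j) * (lin eta z + a * lin xi z) ^+ k.+1) = 0.
  move=> a0 ae; have : dot (eta + a *: xi) w != 0.
    rewrite /dot; under eq_bigr do rewrite 2!mxE mulrDl -mulrA.
    rewrite big_split /= -mulr_sumr addr_eq0; apply/eqP => E.
    have : `|dot eta w| <= e * `|dot xi w| by rewrite /dot E normrN normrM ger0_norm// ler_wpM2r.
    rewrite leNgt => /negP; apply.
    apply: (@le_lt_trans _ _ (e * (1 + `|dot xi w|))); first by rewrite ler_wpM2l ?lerDr// ltW.
    rewrite /e mulrAC divfK ?gt_eqF//.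
    by rewrite ltr_pdivrMr// ltr_pMr ?normr_gt0// ltr1n.
  move=> /mp /(_ j k.+1) <-; congr pairing; apply/funext => z.
  by rewrite linD; ring.
have := pairing_coef mslab mu_slab mf fB (tameM tp (tameX j tame_tm)) (tame_lin eta) (tame_lin xi) e0 H
  (isT : (1 <= k.+1)%N).
by rewrite subSS subn0 => E; rewrite -[RHS]E; congr pairing; apply/funext => z /=; ring.
Qed.

Lemma moment_tm p : moment p -> moment (p \* tm).
Proof.
move=> [tp mp]; split=> [|eta etaw j k]; first exact: tameM.
rewrite -[RHS](mp eta etaw j.+1 k); congr pairing; apply/funext => z /=.
by rewrite exprS; ring.
Qed.

Lemma momentD p q (c : R) : moment p -> moment q -> moment (fun z => p z + c * q z).
Proof.
move=> [tp mp] [tq mq]; have tcq := tameM (tame_cst slab c) tq.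
split=> [|eta etaw j k]; first exact: tameD tp tcq.
have tr : tame (fun z => tm z ^+ j * lin eta z ^+ k) by apply: tameM; exact: tameX.
rewrite (_ : (fun z => _) = (p \* (fun z => tm z ^+ j * lin eta z ^+ k)) \+
    (fun z => c * (q z * (tm z ^+ j * lin eta z ^+ k)))); last first.
  by apply/funext => z /=; ring.
have t1 : tame (fun z => q z * (tm z ^+ j * lin eta z ^+ k)) by exact: tameM.
have t2 : tame (fun z => c * (q z * (tm z ^+ j * lin eta z ^+ k))).
  exact: tameM (tame_cst slab c) t1.
rewrite (pairingD mslab mu_slab mf fB (tameM tp tr) t2) (pairingZ mslab mu_slab mf fB c t1).
by rewrite mq// mulr0 addr0; exact: mp.
Qed.

Lemma moment_pairing p : moment p -> pairing p = 0.
Proof.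
move=> [tp mp]; rewrite -[RHS](mp w w0 0 0); congr pairing; apply/funext => z.
by rewrite !expr0 !mulr1.
Qed.

Definition moment_factor (q : X -> R) := forall p, moment p -> moment (p \* q).

Lemma moment_factor_comb (q r : X -> R) (c : R) : moment_factor q -> moment_factor r ->
  moment_factor (fun z => q z + c * r z).
Proof.
move=> mq mr p mp; rewrite (_ : _ \* _ = fun z => (p \* q) z + c * (p \* r) z).
  by apply: momentD; [exact: mq|exact: mr].
by apply/funext => z /=; ring.
Qed.

Lemma moment_factor_cst c : moment_factor (cst c).
Proof.
move=> p mp; rewrite (_ : _ \* _ = fun z => p z + (c - 1) * p z); first exact: momentD.
by apply/funext => z /=; ring.
Qed.

Lemma moment_factorM q r : moment_factor q -> moment_factor r -> moment_factor (q \* r).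
Proof.
move=> mq mr p mp; rewrite (_ : _ \* _ = (p \* q) \* r); first by apply: mr; exact: mq.
by apply/funext => z /=; ring.
Qed.

Lemma moment_factor_sum (I : Type) (r : seq I) (q : I -> X -> R) :
  (forall i, moment_factor (q i)) -> moment_factor (fun z => \sum_(i <- r) q i z).
Proof.
move=> mq; elim: r => [|i r IH].
  by rewrite (_ : (fun _ => _) = cst 0); [exact: moment_factor_cst|apply/funext => z; rewrite big_nil].
rewrite (_ : (fun _ => _) = fun z => q i z + 1 * \sum_(j <- r) q j z).
  exact: moment_factor_comb.
by apply/funext => z; rewrite big_cons mul1r.
Qed.

Definition sqdist (z0 z : X) : R :=
  (tm z - z0.1) ^+ 2 + \sum_i (z.2 ord0 i - z0.2 ord0 i) ^+ 2.

Lemma moment_sqdist (z0 : X) (c : R) k : moment (fun z => (1 - c * sqdist z0 z) ^+ k).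
Proof.
elim: k => [|k IH].
  by rewrite (_ : (fun _ => _) = cst 1); [exact: moment_one|apply/funext => z; rewrite expr0].
have fsq (q : X -> R) b : moment_factor q -> moment_factor (fun z => (q z - b) ^+ 2).
  move=> mq; have m1 : moment_factor (fun z => q z + (- b) * cst 1 z).
    by apply: moment_factor_comb => //; exact: moment_factor_cst.
  rewrite (_ : (fun _ => _) = (fun z => q z + (- b) * cst 1 z) \* (fun z => q z + (- b) * cst 1 z)).
    exact: moment_factorM.
  by apply/funext => z /=; rewrite mulr1 expr2.
have ft : moment_factor tm by move=> p; exact: moment_tm.
have fx i : moment_factor (fun z : X => z.2 ord0 i).
  rewrite (_ : (fun _ => _) = lin (delta_mx ord0 i)); first by move=> p; exact: moment_lin.
  apply/funext => z; rewrite /lin /dot (bigD1 i)//= big1 => [|j ji].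
    by rewrite mxE !eqxx mul1r addr0.
  by rewrite mxE (negbTE ji) andbF mul0r.
rewrite (_ : (fun _ => _) = (fun z => (1 - c * sqdist z0 z) ^+ k) \*
   (fun z => cst 1 z + (- c) * sqdist z0 z)); last first.
  by apply/funext => z /=; rewrite exprSr mulNr.
apply: (_ : moment_factor _) IH.
apply: moment_factor_comb; first exact: moment_factor_cst.
rewrite (_ : sqdist z0 = fun z => (tm z - z0.1) ^+ 2 + 1 *
   \sum_i (z.2 ord0 i - z0.2 ord0 i) ^+ 2); last by apply/funext => z; rewrite mul1r.
apply: moment_factor_comb; first exact: fsq.
by apply: moment_factor_sum => i; exact: fsq.
Qed.

End moments.

(* All moments of f vanish; Landau's kernels (1 - |z - z0|^2 / rho)^k, which
   concentrate at z0, then give f z0 = 0. *)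
Lemma light_ray_injective (R : realType) (n : nat) (T D B : R) (f : R * 'rV[R]_n -> R)
    (gam : R -> 'rV[R]_n) (z0 : R * 'rV[R]_n) :
  0 < T -> 0 < D -> measurable_fun setT (f : measurableTypeR R * 'rV[R]_n -> R) ->
  (forall z, `|f z| <= B) -> (forall z, f z != 0 -> `|z.1| < T /\ `|z.2| < D) ->
  continuous gam -> gam 0 != gam 1 ->
  (forall sg, 0 <= sg -> sg <= 1 -> forall b, \int[@dt R]_s f (s, b - s *: gam sg) = 0) ->
  {for z0, continuous f} -> f z0 = 0.
Proof.
move=> T0 D0 mf fB fS cg gne ray0 cf; apply/eqP/negPn/negP => fz0.
pose X := (measurableTypeR R * 'rV[R]_n)%type.
pose mu := prod_measure (@dt R) (lebesgue_row n).
have [z1 z2] := fS _ fz0.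
pose c := `|f z0|; have c0 : 0 < c by rewrite normr_gt0.
pose s := Num.sg (f z0).
have sf : s * f z0 = c by rewrite /c normrEsg.
have [d [d0 d1 dT dD dP]] : exists d, [/\ 0 < d, d <= 1, d <= T - `|z0.1|, d <= D - `|z0.2| &
    forall z : X, `|z.1 - z0.1| < d -> `|z.2 - z0.2| < d -> c / 2 <= s * f z].
  have c2 : 0 < c / 2 by rewrite divr_gt0.
  have /cvgrPdist_le/(_ _ c2)[[A1 A2] [/nbhs_ballP[e1 /= e10 e1A] /nbhs_ballP[e2 /= e20 e2A]] AP] := cf.
  exists (Num.min (Num.min e1 e2) (Num.min 1 (Num.min (T - `|z0.1|) (D - `|z0.2|)))).
  split; rewrite ?lt_min ?e10 ?e20 ?subr_gt0 ?z1 ?z2 ?ltr01//; rewrite ?ge_min ?lexx ?orbT//.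
  move=> z; rewrite !lt_min => /andP[/andP[h1 _] _] /andP[/andP[_ h2] _].
  have fz : `|f z0 - f z| <= c / 2.
    apply: (AP z); split; first by apply: e1A; rewrite /ball/= distrC.
    by apply: e2A; rewrite mx_norm_ball /ball_ /= distrC.
  have : s * (f z0 - f z) <= c / 2.
    apply: (le_trans (ler_norm _)); rewrite normrM normr_sg fz0 mul1r; exact: fz.
  by rewrite mulrBr sf; lra.
have B0 : 0 <= B by exact: le_trans (fB z0).
(* An upper bound for the squared distance on the slab, where each coordinate of z - z0 is at most 2
   T or 2 D; so P takes values in [0, 1] there. *)
pose rho := 1 + (4 * T ^+ 2 + n%:R * (4 * D ^+ 2)).
have rho1 : 1 <= rho by rewrite lerDl addr_ge0 ?mulr_ge0// ?exprn_ge0// ltW.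
have rho0 : 0 < rho by exact: lt_le_trans rho1.
pose h := d / 2; have h0 : 0 < h by rewrite divr_gt0.
have h1 : h < 1 by rewrite /h; move: d1; lra.
have hd : h < d by rewrite ltr_pdivrMr// ltr_pMr// ltr1n.
have h2 : h ^+ 2 < 1 by rewrite exprn_ilt1// ltW.
have h20 : 0 < h ^+ 2 by rewrite exprn_gt0.
pose P (z : X) := 1 - rho^-1 * sqdist z0 z.
(* Where P >= b, z is so close to z0 that s f >= c / 2. On the small box A one has P >= a, and a >
   b. *)
pose b := 1 - rho^-1 * h ^+ 2; pose a := 1 - rho^-1 * (h ^+ 2 / 2).
have ir0 : 0 < rho^-1 by rewrite invr_gt0.
have b0 : 0 < b.
  rewrite subr_gt0; apply: le_lt_trans h2; apply: ler_piMl; first exact: ltW.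
  by rewrite invf_le1.
have ba : b < a by rewrite ltrD2l ltrN2 ltr_pM2l// ltr_pdivrMr// ltr_pMr// ltr1n.
have a0 : 0 < a by exact: lt_trans ba.
have sq0 z : 0 <= sqdist z0 z.
  by rewrite addr_ge0 ?sqr_ge0//; apply: sumr_ge0 => i _; exact: sqr_ge0.
pose S := slab (n := n) T D.
have PS z : S z -> 0 <= P z /\ P z <= 1.
  move=> [/= z1T z2D]; split; last by rewrite gerBl mulr_ge0// ltW.
  rewrite subr_ge0 mulrC ler_pdivrMr// mul1r /rho.
  have b1 (u v w : R) : `|v| <= w -> `|u| <= w -> (u - v) ^+ 2 <= 4 * w ^+ 2.
    move=> vw uw; rewrite -real_normK ?num_real//.
    have : `|u - v| <= 2 * w by apply: (le_trans (ler_normB _ _)); lra.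
    move=> H; have := lerXn2r 2 (normr_ge0 (u - v)) (le_trans (normr_ge0 _) H) H.
    by rewrite exprMn (_ : 2 ^+ 2 = 4 :> R)//; ring.
  apply: ler_wpDl => //; apply: lerD.
    by apply: b1; [exact: ltW|move: z1T; rewrite in_itv/= -ler_norml].
  rewrite mulr_natl -[X in _ *+ X](card_ord n) -sumr_const; apply: ler_sum => i _.
  apply: b1; first by apply: le_trans (ltW z2); exact: coord_le_norm.
  by have := z2D i; rewrite mxE subr0.
(* With n + 1 coordinates each at most r, the squared distance on A is at most (n + 1) r^2 <= h^2 /
   2. *)
pose r := h / (2 * n.+1%:R); have r0 : 0 < r by rewrite divr_gt0// mulr_gt0.
have rh : r <= h.
  by rewrite ler_pdivrMr ?mulr_gt0// ler_pMr// -natrM ler1n muln_gt0.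
have nr : n.+1%:R * r ^+ 2 <= h ^+ 2 / 2.
  have -> : n.+1%:R * r ^+ 2 = h ^+ 2 / 2 * (2 * n.+1%:R)^-1.
    by rewrite /r; field; rewrite addrC natr1 pnatr_eq0.
  apply: ler_piMr; first by rewrite divr_ge0// exprn_ge0// ltW.
  by rewrite invf_le1 ?mulr_gt0// -natrM ler1n muln_gt0.
pose A : set X := `[z0.1 - r, z0.1 + r]%classic `*` box z0.2 r.
have mA : measurable A by apply: measurableX; [exact: measurable_itv|exact: measurable_box].
have AP z : A z -> [/\ `|z.1 - z0.1| <= r, `|z.2 - z0.2| <= r & a <= P z].
  move=> [/= Az1 Az2].
  have zz1 : `|z.1 - z0.1| <= r by rewrite ler_distl; move: Az1; rewrite in_itv.
  split => //.
    by apply/row_norm_leP => [|i]; [exact: ltW|rewrite !mxE; exact: Az2].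
  rewrite lerD2l lerN2 ler_pM2l//; apply: le_trans nr.
  rewrite -natr1 addrC mulrDl mul1r; apply: lerD.
    by rewrite -real_normK ?num_real// lerXn2r ?nnegrE// ltW.
  rewrite mulr_natl -[X in _ *+ X](card_ord n) -sumr_const; apply: ler_sum => i _.
  by rewrite -real_normK ?num_real// lerXn2r ?nnegrE// ?(ltW r0)//; exact: Az2.
have AS z : A z -> S z.
  move=> /AP[zz1 zz2 _]; split => /=.
    rewrite in_itv/= -ler_norml -(subrK z0.1 z.1); apply: (le_trans (ler_normD _ _)).
    by move: zz1 rh hd dT; lra.
  move=> i; rewrite mxE subr0; apply: (le_trans (coord_le_norm _ _)).
  rewrite -(subrK z0.2 z.2); apply: (le_trans (ler_normD _ _)).
  by move: zz2 rh hd dD; lra.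
have muA : mu A = (2 * r * (2 * r) ^+ n)%:E.
  rewrite /mu /prod_measure product_measure1E//; last exact: measurable_box.
  rewrite lebesgue_row_box ?(ltW r0)// EFinM; congr (_ * _)%E.
  rewrite /dt /= lebesgue_measure_itv/= lte_fin ltrD2l ifT; last by move: r0; lra.
  by rewrite -EFinB; congr (_%:E); ring.
have mS : measurable S by apply: measurableX; [exact: measurable_itv|exact: measurable_box].
have muS : (mu S < +oo)%E.
  rewrite /mu /prod_measure product_measure1E//; last exact: measurable_box.
  rewrite lebesgue_row_box ?(ltW D0)// /dt /= lebesgue_measure_itv/=.
  by case: ifPn => _; rewrite ?mul0e ?ltry// -EFinB -EFinM ltry.
pose x := c / 2 * (2 * r * (2 * r) ^+ n); pose y := B * fine (mu S).
have x0 : 0 < x by rewrite mulr_gt0 ?divr_gt0// mulr_gt0 ?exprn_gt0// mulr_gt0.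
(* The vanishing integral of s f P^k is at least (c / 2) a^k mu(A) - B b^k mu(S); dividing by a^k
   makes the second term tend to 0. *)
have key k : x <= y * (b / a) ^+ k.
  have mom := moment_sqdist T0 D0 mf fB fS cg ray0 z0 rho^-1 k.
  have J0 : \int[mu]_(z in S) (f z * P z ^+ k) = 0.
    by have := moment_pairing gne mom.
  have tP : tame S (fun z => s * P z ^+ k).
    by have [tp _] := mom; exact: tameM (tame_cst S s) tp.
  have i1 := tame_integrable mS muS mf fB tP.
  have i1A : mu.-integrable S (EFin \o \1_A).
    have [] := @Rintegral_ae_bound _ X R mu S \1_A 1 mS muS (measurable_indic mA) ler01 => //.
    by apply: aeW => z _; rewrite indicE; case: (_ \in _); rewrite ?normr1 ?normr0.
  have icst : mu.-integrable S (EFin \o cst (B * b ^+ k)).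
    have [] := @Rintegral_ae_bound _ X R mu S (cst (B * b ^+ k)) `|B * b ^+ k| mS muS _ (normr_ge0 _) => //.
    exact: aeW.
  have iZA : mu.-integrable S (EFin \o (fun z => c / 2 * a ^+ k * \1_A z)) 
    by have := @integrableZl _ _ R mu S mS (c / 2 * a ^+ k) _ i1A.
  have iA : mu.-integrable S (EFin \o (fun z => c / 2 * a ^+ k * \1_A z - B * b ^+ k)).
    by have := @integrableB _ _ R mu S mS _ _ iZA icst.
  have le z : S z -> 0 <= f z * (s * P z ^+ k) - (c / 2 * a ^+ k * \1_A z - B * b ^+ k).
    move=> Sz; have [P0 P1] := PS z Sz; rewrite subr_ge0 indicE mulrA [f z * s]mulrC.
    have Bb : 0 <= B * b ^+ k by rewrite mulr_ge0// exprn_ge0// ltW.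
    have [bP|Pb] := leP b (P z).
      have sq : sqdist z0 z <= h ^+ 2.
        by move: bP; rewrite lerD2l lerN2 ler_pM2l.
      have fz : c / 2 <= s * f z.
        apply: dP; apply: le_lt_trans hd.
          rewrite -(@ler_pXn2r _ 2) ?nnegrE ?(ltW h0)// real_normK ?num_real//.
          by apply: le_trans sq; rewrite lerDl; apply: sumr_ge0 => i _; exact: sqr_ge0.
        apply/row_norm_leP => [|i]; first exact: ltW.
        rewrite !mxE -(@ler_pXn2r _ 2) ?nnegrE ?(ltW h0)// real_normK ?num_real//.
        apply: le_trans sq; rewrite ler_wpDl ?sqr_ge0// (bigD1 i)//= lerDl.
        by apply: sumr_ge0 => j _; exact: sqr_ge0.
      have fz0' : 0 <= s * f z by apply: le_trans fz; rewrite divr_ge0// ltW.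
      have [Az|nAz] := boolP (z \in A); last first.
        by rewrite mulr0 sub0r (le_trans (y := 0))// ?oppr_le0// mulr_ge0// exprn_ge0.
      have [_ _ aP] := AP z (set_mem Az).
      rewrite mulr1; apply: (@le_trans _ _ (c / 2 * a ^+ k)); first by rewrite gerBl.
      apply: ler_pM => //; [by rewrite divr_ge0// ltW|by rewrite exprn_ge0// ltW|].
      by rewrite lerXn2r ?nnegrE// ltW.
    have -> : (z \in A) = false.
      apply/negbTE/negP => /set_mem/AP[_ _ aP].
      by move: (lt_le_trans ba aP); rewrite ltNge (ltW Pb).
    rewrite mulr0 sub0r lerNl -mulNr.
    have Pk : P z ^+ k <= b ^+ k by rewrite lerXn2r ?nnegrE ?(ltW b0)// ltW.
    apply: (@le_trans _ _ (B * P z ^+ k)); last by rewrite ler_wpM2l.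
    apply: ler_wpM2r; first by rewrite exprn_ge0.
    have : `|s * f z| <= B by rewrite normrM normr_sg fz0 mul1r; exact: fB.
    by rewrite ler_norml => /andP[+ _]; rewrite lerNl.
  have := Rintegral_ge0 mu le; rewrite RintegralB//.
  have -> : \int[mu]_(z in S) (f z * (s * P z ^+ k)) = 0.
    transitivity (\int[mu]_(z in S) (s * (f z * P z ^+ k))).
      by apply: eq_Rintegral => z _; rewrite mulrCA.
    rewrite RintegralZl ?J0 ?mulr0//; have [tp _] := mom; exact: tame_integrable tp.
  have -> : \int[mu]_(z in S) (c / 2 * a ^+ k * \1_A z - B * b ^+ k) =
      c / 2 * a ^+ k * (2 * r * (2 * r) ^+ n) - B * b ^+ k * fine (mu S).
    rewrite (RintegralB mS iZA icst) (RintegralZl _ mS i1A) (Rintegral_cst mu mS).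
    rewrite (_ : Rintegral _ _ \1_A = 2 * r * (2 * r) ^+ n)//.
    rewrite /Rintegral integral_indic// setIidl//.
    by transitivity (fine (mu A)); last by rewrite muA.
  rewrite sub0r oppr_ge0 subr_le0 => H.
  rewrite expr_div_n mulrA ler_pdivlMr ?exprn_gt0//; move: H; rewrite /x /y.
  by congr (_ <= _); ring.
have ba1 : `|b / a| < 1 by rewrite ger0_norm ?divr_ge0 ?ltW// ltr_pdivrMr// mul1r.
have cv : (fun k => y * (b / a) ^+ k) @ \oo --> y * 0.
  by apply: cvgM; [exact: cvg_cst|exact: cvg_expr].
have : x <= y * 0.
  rewrite -(cvg_lim _ cv)//; apply: limr_ge; first by apply/cvg_ex; exists (y * 0).
  exact: nearW.
by rewrite mulr0 leNgt x0.
Qed.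

(** * Uniform support of the difference of the potentials *)

(** Otherwise every [E k] is dense in I0. Adding the complement of the closure of I0 makes it dense
    in R, and Baire gives a point of I0 lying in all [E k]. *)
Lemma baire_itv (R : realType) (I0 : set R) (E : nat -> set R) :
  open I0 -> I0 !=set0 -> (forall k, open (E k)) ->
  (forall r, I0 r -> exists k, ~ E k r) ->
  exists k J, [/\ open J, J !=set0, J `<=` I0 & forall r, J r -> ~ E k r].
Proof.
move=> oI I0n oE cov; apply: contrapT => nJ.
have : dense (\bigcap_k (E k `|` ~` closure I0)).
  apply: (@Baire R R^o) => k; split.
    by apply: openU => //; apply: closed_openC; exact: closed_closure.
  move=> A [r Ar] oA; have [[s [As Is]]|nAI] := pselect ((A `&` I0) !=set0).
    apply: contrapT => nAE; apply: nJ; exists k, (A `&` I0); split => //.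
    - exact: openI.
    - by exists s.
    - by move=> u [Au Iu] Eu; apply: nAE; exists u; split => //; left.
  exists r; split => //; right => Cr; apply: nAI.
  by have [u [Iu Au]] := Cr A (open_nbhs_nbhs (conj oA Ar)); exists u.
move=> /(_ I0 I0n oI)[r [Ir Er]]; have [k nEr] := cov _ Ir.
by have [/nEr//|nC] := Er k I; apply: nC; exact: subset_closure.
Qed.

Section time_space.
Context {R : realType} {n : nat}.
Local Notation V := 'rV[R]_n.
Variables (Om : set V) (T : R).
Hypothesis oO : open Om.

Definition deep (a : R) : set (R * V) :=
  [set z | a <= z.1 <= T - a /\ forall y, `|y - z.2| < a -> Om y].

Lemma compact_deep (S : set (R * V)) : compact S -> S `<=` time_space Om T ->
  exists k, S `<=` deep k.+1%:R^-1.
Proof.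
move=> /compact_near_coveringP/(_ nat \oo (fun k => deep k.+1%:R^-1) _) nc ST.
have H : forall z, S z -> \forall z' \near z & k \near \oo, deep k.+1%:R^-1 z'.
  move=> [t x] /ST[/=]; rewrite in_itv/= => /andP[t0 tT] Ox.
  have /nbhs_ballP[e /= e0 eO] : nbhs x Om by apply: open_nbhs_nbhs.
  pose d := Num.min (Num.min t (T - t)) e / 2.
  have m0 : 0 < Num.min (Num.min t (T - t)) e by rewrite !lt_min t0 e0 subr_gt0 tT.
  have d0 : 0 < d by rewrite divr_gt0.
  have : d + d <= Num.min (Num.min t (T - t)) e by rewrite /d -splitr.
  rewrite !le_min => /andP[/andP[dt1 dt2] de].
  exists (ball t d `*` ball x d, [set k | k.+1%:R^-1 < d]).
    split; first by exists (ball t d, ball x d) => //; split; exact: nbhsx_ballx.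
    exact: near_infty_natSinv_lt (PosNum d0).
  move=> [[t' x'] k] /= [[tt xx] kd]; split => /=.
    move: tt; rewrite /ball /= ltr_distl => /andP[h1 h2].
    by move: kd; set q := _^-1 => kd; apply/andP; split; lra.
  move=> y yx; apply: eO; rewrite mx_norm_ball /ball_ /=.
  move: xx; rewrite mx_norm_ball /ball_ /= => xx.
  have -> : x - y = (x - x') - (y - x') by rewrite opprB addrA subrK.
  apply: (le_lt_trans (ler_normB _ _)); apply: lt_le_trans de; apply: ltrD => //.
  exact: lt_trans yx kd.
have [k _ kS] := nc H; exists k; exact: (kS k (leqnn k)).
Qed.

End time_space.

(** * An arc of transverse velocities of equal length *)

Section circle.
Context {R : realType} {m : nat}.
Local Notation V := 'rV[R]_m.+2.

(** An arc of the sphere |v| = r in the plane of the first two axes, parametrised by the second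
    coordinate so that sg = 0 is the first axis. *)
Definition circle (r sg : R) : V :=
  row_cons (Num.sqrt (r ^+ 2 - sg ^+ 2), row_cons (sg, 0)).

Lemma dot_row_cons k (p q : R * 'rV[R]_k) :
  dot (row_cons p) (row_cons q) = p.1 * q.1 + dot p.2 q.2.
Proof.
case: p q => [a y] [b z]; rewrite /dot big_ord_recl !row_cons0; congr (_ + _).
by apply: eq_bigr => i _; rewrite !row_consS.
Qed.

Lemma circle_enorm (r sg : R) : 0 <= r -> `|sg| <= r -> enorm (circle r sg) = r.
Proof.
move=> r0 sr; rewrite /enorm !dot_row_cons /= -expr2 sqr_sqrtr.
  rewrite -expr2 (_ : dot 0 0 = 0) ?addr0 ?subrK ?sqrtr_sqr ?ger0_norm//.
  by rewrite /dot big1// => i _; rewrite mxE mul0r.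
by rewrite subr_ge0 -real_normK ?num_real// lerXn2r// nnegrE.
Qed.

Lemma circle_continuous (r : R) : continuous (circle r).
Proof.
move=> sg; apply: cvg_coord => i; case: (unliftP ord0 i) => [j|] ->; last first.
  rewrite row_cons0; under eq_fun do rewrite row_cons0.
  apply: (cvg_comp (fun s => r ^+ 2 - s ^+ 2)); last exact: sqrt_continuous.
  by apply: cvgB; [exact: cvg_cst|exact: exprn_continuous].
rewrite row_consS; under eq_fun do rewrite row_consS.
case: (unliftP ord0 j) => [k|] ->.
  by rewrite row_consS; under eq_fun do rewrite row_consS mxE; rewrite mxE; exact: cvg_cst.
by rewrite row_cons0; under eq_fun do rewrite row_cons0; exact: cvg_id.
Qed.

Lemma circle_transverse (r L : R) : 0 < r -> 0 <= L -> exists2 sg, 0 < sg < r &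
  \forall v \near circle r sg, transverse L v.
Proof.
move=> r0 L0; pose sg := r / (2 * (1 + L)).
have L1 : 0 < 1 + L by rewrite ltr_pwDl.
have s0 : 0 < sg by rewrite divr_gt0// mulr_gt0.
have rs : r = 2 * (1 + L) * sg by rewrite /sg; field; rewrite gt_eqF.
have sr : sg < r by rewrite rs ltr_pMl//; move: L0; lra.
have Ls : L * sg < 1/2 * Num.sqrt (r ^+ 2 - sg ^+ 2).
  have : (2 * (L * sg)) ^+ 2 < r ^+ 2 - sg ^+ 2.
    rewrite rs -subr_gt0.
    rewrite (_ : _ - _ = sg ^+ 2 * (3 + 8 * L)); last by ring.
    by rewrite mulr_gt0 ?exprn_gt0//; move: L0; lra.
  have LL : 0 <= 2 * (L * sg) by rewrite mulr_ge0// mulr_ge0// ltW.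
  move=> /[dup] /(le_lt_trans (sqr_ge0 _)) h; rewrite -{1}(sqr_sqrtr (ltW h)).
  rewrite ltr_pXn2r ?nnegrE ?sqrtr_ge0//; lra.
have root0 : 0 < Num.sqrt (r ^+ 2 - sg ^+ 2).
  have : 0 <= L * sg by rewrite mulr_ge0// ltW.
  move: Ls; lra.
exists sg; first by rewrite s0.
have cc i : (fun v : V => v ord0 i) @ circle r sg --> circle r sg ord0 i.
  exact: coord_continuous.
have h1 : \forall v \near circle r sg, 0 < (v : V) ord0 ord0.
  by apply: (cvgr_gt _ (cc ord0)); rewrite row_cons0.
have h2 : \forall v \near circle r sg, 0 < (v : V) ord0 (lift ord0 ord0).
  by apply: (cvgr_gt _ (cc (lift ord0 ord0))); rewrite row_consS row_cons0.
have /filter_forall h3 : forall j : 'I_m.+1, \forall v \near circle r sg,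
    0 < 1/2 * (v : V) ord0 ord0 - L * `|(v : V) ord0 (lift ord0 j)|.
  move=> j.
  have cj : (fun v : V => 1/2 * v ord0 ord0 - L * `|v ord0 (lift ord0 j)|) @ circle r sg -->
      1/2 * circle r sg ord0 ord0 - L * `|circle r sg ord0 (lift ord0 j)|.
    have e1 := cvgM (cvg_cst (1/2 : R)) (cc ord0).
    have e2 := cvgM (cvg_cst L) (cvg_norm (cc (lift ord0 j))).
    have FF : Filter (nbhs (circle r sg)) by exact: nbhs_filter.
    exact: cvgB (e1 FF FF) (e2 FF FF FF).
  apply: (cvgr_gt _ cj); rewrite row_cons0 row_consS subr_gt0.
  case: (unliftP ord0 j) => [k|] ->.
    by rewrite row_consS mxE normr0 mulr0 mulr_gt0//.
  by rewrite row_cons0 gtr0_norm.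
near=> v; split.
- by near: v.
- by rewrite gt_eqF//; near: v.
- by move=> j; apply: ltW; rewrite -subr_gt0; move: j; near: v.
Unshelve. all: by end_near. Qed.

End circle.

(** * The difference of the potentials, extended by zero *)

Section potential_difference.
Context {R : realType} {n : nat}.
Local Notation V := 'rV[R]_n.
Variables (Om : set V) (T M1 : R) (Phi1 Phi2 : R * V * R -> R).
Local Notation dom := (Phi_domain Om T).
Hypotheses (oO : open Om).
Hypotheses (c1 : {in dom, continuous Phi1}) (c2 : {in dom, continuous Phi2}).

Definition Phi_diff (p : R * V * R) : R := (Phi1 \_ dom) p - (Phi2 \_ dom) p.

Lemma Phi_diffE p : dom p -> Phi_diff p = Phi1 p - Phi2 p.
Proof. by move=> pd; rewrite /Phi_diff /patch mem_set. Qed.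

Lemma Phi_diff_domain p : Phi_diff p != 0 -> dom p.
Proof.
by apply: contraNP => pd; rewrite /Phi_diff /patch memNset// subrr.
Qed.

Lemma Phi_diff_continuous p : dom p -> {for p, continuous Phi_diff}.
Proof.
move=> pd; have cd : (fun q => Phi1 q - Phi2 q) @ p --> Phi1 p - Phi2 p.
  by apply: cvgB; [exact/c1/mem_set|exact/c2/mem_set].
apply/cvgrPdist_le => e e0; have /cvgrPdist_le/(_ _ e0) := cd.
have : \forall q \near p, dom q.
  by apply: open_nbhs_nbhs; split => //; exact: open_Phi_domain.
by apply: filterS2 => q qd; rewrite !Phi_diffE.
Qed.

Lemma open_Phi_diff_neq0 (z : R * V) : open [set r | Phi_diff (z, r) != 0].
Proof.
rewrite openE => r /= fr.
have cr : (fun s => Phi_diff (z, s)) @ r --> Phi_diff (z, r).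
  have := Phi_diff_continuous (Phi_diff_domain fr); apply: cvg_comp.
  exact: cvg_pair (cvg_cst z) cvg_id.
have f0 : 0 < `|Phi_diff (z, r)| by rewrite normr_gt0.
have /cvgrPdist_lt/(_ _ f0) := cr; apply: filterS => s /=.
by apply: contraTneq => ->; rewrite subr0 ltxx.
Qed.

(* The radii at which the support of Phi1 - Phi2 is not 1/(k+1)-far from the boundary. *)
Definition shallow (k : nat) : set R :=
  [set r | exists z, Phi_diff (z, r) != 0 /\ ~ deep Om T k.+1%:R^-1 z].

(** The same point z is a witness for all nearby radii. *)
Lemma open_shallow k : open (shallow k).
Proof.
rewrite openE => r [z [fz nz]].
have : nbhs r [set s | Phi_diff (z, s) != 0].
  by apply: open_nbhs_nbhs; split => //; exact: open_Phi_diff_neq0.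
by apply: filterS => s fs; exists z.
Qed.

Lemma not_shallow r : 0 < r ->
  let S := supp (time_space Om T) (fun z => Phi1 (z, r) - Phi2 (z, r)) in
  compact S -> S `<=` time_space Om T -> exists k, ~ shallow k r.
Proof.
move=> r0 S cS ST; have [k kS] := compact_deep oO cS ST.
exists k => -[z [fz]]; apply; apply: kS; apply: subset_closure.
by have zd := Phi_diff_domain fz; move: fz; rewrite Phi_diffE//; case: zd.
Qed.

(** At a point outside the domain the difference vanishes in a whole neighbourhood: a nearby nonzero
    value with radius in J would occur at depth 1/(k+1), and this would put the point itself into
    the domain. *)
Lemma Phi_diff_continuous_deep (J : set R) k t x r : open J ->
  (forall s, J s -> 0 < s /\ ~ shallow k s) -> J r -> {for (t, x, r), continuous Phi_diff}.
Proof.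
move=> oJ JP Jr; have [/Phi_diff_continuous//|nd] := pselect (dom (t, x, r)).
have fe : 0 < k.+1%:R^-1 :> R by [].
suff : \forall q \near (t, x, r), Phi_diff q = 0.
  move=> H; apply/cvgrPdist_le => e e0; apply: filterS H => q ->.
  have -> : Phi_diff (t, x, r) = 0 by apply/eqP/negPn/negP => /Phi_diff_domain.
  by rewrite subrr normr0 ltW.
exists (ball t k.+1%:R^-1 `*` ball x k.+1%:R^-1, J).
  split; last by apply: open_nbhs_nbhs.
  by exists (ball t k.+1%:R^-1, ball x k.+1%:R^-1) => //; split; exact: nbhsx_ballx.
move=> [[t' x'] r'] [/= [tt xx] Jr']; apply/eqP/negPn/negP => fz; apply: nd.
have [_ nsh] := JP _ Jr'; have [r0 _] := JP _ Jr.
have [/= /andP[h1 h2] h3] : deep Om T k.+1%:R^-1 (t', x').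
  by apply: contrapT => nd; apply: nsh; exists (t', x').
split => //; split => /=.
  move: tt h1 h2; rewrite /ball /= ltr_distl in_itv /=; set c := _^-1.
  by move=> /andP[h4 h5] h1 h2; apply/andP; split; lra.
by apply: h3; move: xx; rewrite mx_norm_ball.
Qed.

Hypotheses (b1 : forall r : R, 0 < r ->
    (sup_norm (time_space Om T) (fun z => Phi1 (z, r)) <= M1%:E)%E)
  (M10 : 0 <= M1).

Lemma patch_bound p : `|(Phi1 \_ dom) p| <= M1.
Proof.
rewrite /patch; case: ifPn => [|_]; last by rewrite normr0.
case: p => z r /set_mem[/= zt r0]; rewrite -lee_fin; apply: le_trans (b1 r0).
by apply: ereal_sup_ubound; exists z.
Qed.

End potential_difference.

(** * Conclusion: contradiction at one radius *)

Unset Implicit Arguments.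

Theorem theorem1p2 (R : realType) (n : nat) (hn : (2 <= n)%N)
  (T : R) (hT : 0 < T)
  (Omega : set 'rV[R]_n)
  (hOmega0 : Omega !=set0) (hOmega_open : open Omega)
  (hOmega_bounded : bounded_set Omega) (hOmega_convex : convex_set Omega)
  (hOmega_smooth : smooth_boundary Omega)
  (c0 : R) (hc0 : 0 < c0)
  (Psi : 'rV[R]_n * 'rV[R]_n * 'rV[R]_n -> R)
  (hPsi_C1 : C1_ext (setT `*` setT `*` sphere) Psi)
  (hPsi_ge0 : forall v u w, sphere w -> 0 <= Psi (v, u, w))
  (hPsi_lb : forall v u w, eball v 3 u -> sphere w -> c0 <= Psi (v, u, w))
  (Phi1 Phi2 : R * 'rV[R]_n * R -> R)
  (hPhi1_C1 : Ck 1 (Phi_domain Omega T) Phi1)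
  (hPhi2_C1 : Ck 1 (Phi_domain Omega T) Phi2)
  (M1 : R) (hM1 : 0 < M1)
  (hPhi1_bd : forall r : R, 0 < r ->
    (sup_norm (time_space Omega T) (fun z => Phi1 (z, r)) <= M1%:E)%E)
  (hPhi2_bd : forall r : R, 0 < r ->
    (sup_norm (time_space Omega T) (fun z => Phi2 (z, r)) <= M1%:E)%E)
  (hsupp : forall r : R, 0 < r ->
    let S := supp (time_space Omega T)
               (fun z => Phi1 (z, r) - Phi2 (z, r)) in
    compact S /\ S `<=` time_space Omega T)
  (M : R) (hM : 0 < M)
  (K1 K2 : R * 'rV[R]_n * 'rV[R]_n * 'rV[R]_n * 'rV[R]_n -> R)
  (hK1 : K1 = product_kernel Phi1 Psi)
  (hK2 : K2 = product_kernel Phi2 Psi)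
  (hK1_adm : admissible Omega T M K1)
  (hK1_adm_x : admissible_vec Omega T M (grad_x K1))
  (hK1_adm_v : admissible_vec Omega T M (grad_v K1))
  (hK2_adm : admissible Omega T M K2)
  (hK2_adm_x : admissible_vec Omega T M (grad_x K2))
  (hK2_adm_v : admissible_vec Omega T M (grad_v K2))
  (kappa : R) (hkappa : 0 < kappa)
  (hwp1 : well_posed Omega T K1 kappa)
  (hwp2 : well_posed Omega T K2 kappa)
  (hA : forall gh, small_data Omega T kappa gh ->
    eq_measurement Omega T (measurement Omega T K1 gh)
                           (measurement Omega T K2 gh)) :
  forall (t : R) (x : 'rV[R]_n) (r : R),
    0 < t < T -> Omega x -> 0 < r -> Phi1 (t, x, r) = Phi2 (t, x, r).
Proof.
destruct n as [|[|m]] => // t0 x0 r0 t0T Ox0 r00.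
apply/eqP/negPn/negP => Phi_ne.
have [cPhi1 _] := hPhi1_C1; have [cPhi2 _] := hPhi2_C1.
pose fb := Phi_diff Omega T Phi1 Phi2.
have dom0 : Phi_domain Omega T (t0, x0, r0) by split => //; split => //=; rewrite in_itv.
have fb0 : fb (t0, x0, r0) != 0 by rewrite /fb Phi_diffE// subr_eq0.
(* Baire is applied among radii at which the difference at (t0, x0) is nonzero, so that any radius
   in the interval found still leads to a contradiction. *)
pose I0 : set R := [set r | 0 < r /\ fb (t0, x0, r) != 0].
have oI0 : open I0.
  by have := openI (@open_gt R 0) 
    (@open_Phi_diff_neq0 R m.+2 Omega T Phi1 Phi2 hOmega_open cPhi1 cPhi2 (t0, x0)).
have I0n : I0 !=set0 by exists r0.
have cover r : I0 r -> exists k, ~ shallow Omega T Phi1 Phi2 k r.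
  by move=> [r_gt0 _]; have [cS ST] := hsupp r r_gt0; exact: not_shallow cS ST.
have [k [J [oJ [r1 Jr1] JI Jdeep]]] :=
  baire_itv oI0 I0n (open_shallow hOmega_open cPhi1 cPhi2) cover.
have [r1_gt0 fb1] := JI _ Jr1.
have Jsh s : J s -> 0 < s /\ ~ shallow Omega T Phi1 Phi2 k s.
  by move=> Js; split; [case: (JI _ Js)|exact: Jdeep].
pose a : R := k.+1%:R^-1; have a0 : 0 < a by rewrite invr_gt0.
(* The spare 1 gives the strict bound |x| < D that [light_ray_injective] asks for. *)
have [D D0 bO] : exists2 D : R, 0 < D & forall x, Omega x -> `|x| <= D - 1.
  have [b [_ bb]] := hOmega_bounded; exists (`|b| + 1 + 1); first by have := normr_ge0 b; lra.
  by move=> x Ox; rewrite addrK; apply: (bb (`|b| + 1)) => //; rewrite ltr_pwDr// ler_norm.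
have bO' x : Omega x -> `|x| <= D.
  by move=> /bO; move/le_trans; apply; rewrite gerBl.
have [sg1 /andP[sg0 sgr] near_tr] := circle_transverse (m := m) r1_gt0
  (ltW (divr_gt0 (mulr_gt0 (ltr0n R 16) D0) a0)).
pose v1 : 'rV[R]_m.+2 := circle r1 sg1.
have [Ps [psi [oO psO [cpsi _] psiE]]] := hPsi_C1.
pose psih := psi_ext Ps psi.
have psihE v u w : sphere w -> psih (v, (u, w)) = Psi (v, u, w).
  move=> sw; have Oq : (setT `*` setT `*` sphere) (v, u, w) by [].
  rewrite /psih /psi_ext /= indicE mem_set// mulr1 /patch mem_set; last exact: psO.
  by rewrite psiE// inE.
have psih0 v p : 0 <= psih (v, p).
  case: p => u w; have [sw|nsw] := pselect (sphere w); first by rewrite psihE//; exact: hPsi_ge0.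
  by rewrite /psih /psi_ext /= indicE memNset// mulr0.
have mpsi : measurable_fun setT psih by exact: measurable_psi_ext.
have psihc v u w : eball v 3 u -> sphere w -> c0 <= psih (v, (u, w)).
  by move=> vu sw; rewrite psihE//; exact: hPsi_lb.
pose ph1 := phi_ext Omega T Phi1; pose ph2 := phi_ext Omega T Phi2.
have mph1 : measurable_fun setT ph1 by exact: measurable_phi_ext.
have mph2 : measurable_fun setT ph2 by exact: measurable_phi_ext.
have ph1b z : `|ph1 z| <= M1 by exact: patch_bound hPhi1_bd (ltW hM1) _.
have ph2b z : `|ph2 z| <= M1 by exact: patch_bound hPhi2_bd (ltW hM1) _.
have rep1 : kernel_rep Omega T K1 (kernel_ext ph1 psih).
  by rewrite hK1; exact: kernel_ext_rep.
have rep2 : kernel_rep Omega T K2 (kernel_ext ph2 psih).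
  by rewrite hK2; exact: kernel_ext_rep.
have mass1 := kernel_mass rep1 isT (ltW hM) (ltW (proj2 hK1_adm)).
have mass2 := kernel_mass rep2 isT (ltW hM) (ltW (proj2 hK2_adm)).
have near_weight := weight_gt0 v1 hc0 mpsi psih0 psihc.
have ev1 : enorm v1 = r1 by rewrite circle_enorm ?(ltW r1_gt0)// gtr0_norm// ltW.
have near_J : \forall v \near v1, J (enorm v).
  apply: (@enorm_continuous R m.+2 v1); apply: open_nbhs_nbhs; split => //.
  by rewrite ev1.
have [e /= e0 V0P] : exists2 e : R, 0 < e & forall v, ball v1 e v ->
    [/\ transverse (16 * D / a) v, J (enorm v) &
      (@dudw R m.+2).-integrable setT (EFin \o (fun p => psih (v, p))) ->
      0 < weight (away v1) psih v].
  have : nbhs v1 [set v | [/\ transverse (16 * D / a) v, J (enorm v) &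
      (@dudw R m.+2).-integrable setT (EFin \o (fun p => psih (v, p))) ->
      0 < weight (away v1) psih v]].
    by apply: filterS3 near_tr near_J near_weight => v.
  by move=> /nbhs_ballP[e e0 eP]; exists e.
pose V0 : set 'rV[R]_m.+2 := ball v1 e.
have oV0 : open V0 by exact: ball_open.
have V0t v : V0 v -> transverse (16 * D / a) v by move=> /V0P[].
have V0J v : V0 v -> J (enorm v) by move=> /V0P[].
have fbB p : `|fb p| <= M1 + M1.
  apply: (le_trans (ler_normB _ _)); apply: lerD.
    exact: patch_bound hPhi1_bd (ltW hM1) _.
  exact: patch_bound hPhi2_bd (ltW hM1) _.
have fbO t x r : fb (t, x, r) != 0 -> 0 < t < T /\ Omega x.
  by move=> /Phi_diff_domain[[/= + Ox] _]; rewrite in_itv.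
have fb_deep t x r : J r -> fb (t, x, r) != 0 -> deep Omega T a (t, x).
  by move=> Jr fr; apply: contrapT => nd; apply: (Jdeep _ Jr); exists (t, x).
have fb_cont t x v : V0 v -> {for (t, x, enorm v), continuous fb}.
  by move=> /V0J Jv; exact: (Phi_diff_continuous_deep hOmega_open cPhi1 cPhi2 oJ Jsh).
have mfb : measurable_fun setT (fun z : measurableTypeR R * 'rV[R]_m.+2 * 'rV[R]_m.+2 =>
    fb (z.1.1, z.1.2, enorm z.2)) by exact: measurable_funB mph1 mph2.
have top0 := top_rays hOmega_open hOmega_convex hT (ltW hM) hkappa mph1 mph2 mpsi ph1b ph2b
  rep1 rep2 mass1 mass2 hwp1 hwp2 hA v1.
(* With r = a / 4 the slope 4 D / r of the graph equals the 16 D / a of [exit_graph]; the depth 3/4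
   a obtained there leaves a / 4 for the approximation in [ray_side]. *)
have r40 : 0 < a / 4 by rewrite divr_gt0.
have LE : 4 * D / (a / 4) = 16 * D / a by field; rewrite gt_eqF.
have V0t' v : V0 v -> transverse (4 * D / (a / 4)) v by rewrite LE; exact: V0t.
have side0 := side_rays hOmega_open hOmega_convex hT (ltW hM) hkappa mph1 mph2 mpsi ph1b ph2b
  rep1 rep2 mass1 mass2 hwp1 hwp2 hA v1 hOmega_smooth D0 bO' r40 (open_measurable_row oV0) V0t'.
have fb_supp t x v : V0 v -> fb (t, x, enorm v) != 0 ->
    [/\ 0 < t, t < T & forall y, `|y - x| < a -> Omega y].
  move=> /V0J Jv fv; have [/andP[h1 h2] h3] := fb_deep _ _ _ Jv fv; split => //.
    exact: lt_le_trans h1.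
  by apply: (le_lt_trans h2); rewrite gtrBl.
have topV : \forall p \ae @dxdv R m.+2, Omega p.1 -> V0 p.2 ->
    \int[@dt R]_(s in `]0, T[) fb (T - s, p.1 - s *: p.2, enorm p.2) = 0.
  by apply: aeS top0 => -[x v] /= H Ox /V0P[_ _ wv]; exact: H.
have sideV : \forall y \ae lebesgue_row m.+1, \forall t \ae @dt R,
    \forall v \ae @lebesgue_row R m.+2, inner Omega (a / 4 + a / 4) y -> V0 v -> 0 < t < T ->
    \int[@dt R]_(s in `]0, t[) fb (t - s, top Omega y - s *: v, enorm v) = 0.
  apply: aeS side0 => y; apply: aeS => t; apply: aeS => v H Iy Vv t0'.
  by apply: H => //; case: (V0P _ Vv).
have ray0 b v : V0 v -> ray fb 0 b v = 0.
  exact: (ray_zero hOmega_open hOmega_convex hT D0 bO' a0 oV0 V0t mfb fbB fbO fb_supp fb_cont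
    topV sideV).
have [eta eta0 near_sg] : exists2 eta, 0 < eta & forall sg, `|sg1 - sg| <= eta -> V0 (circle r1 sg).
  have : nbhs sg1 [set sg | V0 (circle r1 sg)].
    apply: (@circle_continuous R m r1 sg1); exact: nbhsx_ballx.
  move=> /nbhs_ballP[d /= d0 dV]; exists (d / 2); first by rewrite divr_gt0.
  move=> sg sd; apply: dV; apply: (le_lt_trans sd).
  by rewrite ltr_pdivrMr// ltr_pMr// ltr1n.
(* The bound [eta] keeps the arc in V0, [sg1] keeps its parameter between 0 and sg1, and q > 0 makes
   its end points differ. *)
pose q := Num.min eta sg1; have q0 : 0 < q by rewrite lt_min eta0.
pose gam s : 'rV[R]_m.+2 := circle r1 (sg1 - s * q).
have gam_in s : 0 <= s -> s <= 1 -> V0 (gam s) /\ enorm (gam s) = r1.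
  move=> s0 s1; have sq : s * q <= q by rewrite ler_piMl// ltW.
  have sq0 : 0 <= s * q by rewrite mulr_ge0// ltW.
  split.
    apply: near_sg; rewrite opprB addrC subrK ger0_norm//.
    by apply: (le_trans sq); rewrite ge_min lexx.
  have : q <= sg1 by rewrite ge_min lexx orbT.
  move=> qs; apply: circle_enorm; first exact: ltW.
  by rewrite ler_norml; apply/andP; split; lra.
have gam_cont : continuous gam.
  move=> s; apply: (cvg_comp (fun s => sg1 - s * q)); last exact: circle_continuous.
  apply: cvgB; first exact: cvg_cst.
  by apply: cvgM; [exact: cvg_id|exact: cvg_cst].
have gam_ne : gam 0 != gam 1.
  apply/eqP => /rowP/(_ (lift ord0 ord0)); rewrite !row_consS !row_cons0.
  by rewrite mul0r mul1r subr0 => E; move: q0; lra.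
(* Time is reversed, so that the rays (-s, b - s v) of [ray fb 0] become (s, b - s v). *)
pose f (z : R * 'rV[R]_m.+2) : R := fb (- z.1, z.2, r1).
have mf : measurable_fun setT (f : measurableTypeR R * 'rV[R]_m.+2 -> R).
  pose Z := (measurableTypeR R * 'rV[R]_m.+2 * 'rV[R]_m.+2)%type.
  have mg : measurable_fun setT (fun z : measurableTypeR R * 'rV[R]_m.+2 => (- z.1, z.2, v1) : Z).
    apply/measurable_fun_pairP; split => /=; last exact: measurable_cst.
    apply/measurable_fun_pairP; split => /=; last exact: measurable_snd.
    exact: (measurableT_comp (@oppr_measurable R setT) measurable_fst).
  by have := measurableT_comp mfb mg; rewrite /comp /= ev1.
have fS z : f z != 0 -> `|z.1| < T /\ `|z.2| < D.
  move=> /fbO[/andP[h1 h2] /bO h3]; split; first by rewrite ltr_norml; apply/andP; split; lra.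
  by apply: (le_lt_trans h3); rewrite gtrBl.
have f0 : f (- t0, x0) = 0.
  apply: (light_ray_injective hT D0 mf (fun z => fbB _) fS gam_cont gam_ne).
    move=> s s0 s1 b; have [Vs Es] := gam_in s s0 s1.
    rewrite -[RHS](ray0 b (gam s) Vs) /ray Es.
    by apply: eq_Rintegral => u _; rewrite sub0r.
  have [V1 E1] : V0 v1 /\ enorm v1 = r1 by split => //; exact: ballxx.
  have c3 := @fb_cont (- (- t0)) x0 v1 V1; rewrite ev1 in c3.
  have c1 : (fun z : R * 'rV[R]_m.+2 => - z.1) @ (- t0, x0) --> - (- t0).
    by apply: cvgN; exact: cvg_fst.
  have c2 : (fun z : R * 'rV[R]_m.+2 => z.2) @ (- t0, x0) --> x0 by exact: cvg_snd.
  exact: (cvg_comp _ _ (cvg_pair (cvg_pair c1 c2) (cvg_cst r1)) c3).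
by move: fb1; rewrite -[t0]opprK -/(f (- t0, x0)) f0 eqxx.
Qed.
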